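(* Let $X=\{X_t,t\in[0,1]\}$ be an $\mathbb F$-adapted centered Gaussian process for which there exist $H_1,H_2\in(0,1]$ and $C_1,C_2>0$ such that for all $s,t\in[0,1]$ $$C_1|t-s|^{2H_1}\le \mathbf E(X_t-X_s)^2\le C_2|t-s|^{2H_2},$$ and such that $\mathbf E(X_{t_1}-X_{s_1})(X_{t_2}-X_{s_2})\ge 0$ for all $s_1\le t_1\le s_2\le t_2$ in $[0,1]$. Assume $0<2H_1-1<H_2\le H_1$ and $H_2>1/2$. Let $\xi$ be a random variable such that $\xi=Z_1$ for some $\mathbb F$-adapted process $Z$ with $Z\in C^\rho[0,1]$ almost surely, where $\rho>\rho_0$ and $$\rho_0=\frac{(1+H_2)(H_1-H_2)}{H_2+1-2H_1}.$$ Then there exists an $\mathbb F$-adapted process $\psi=\{\psi_t,t\in[0,1]\}$ such that, for some $\alpha\in(1-H_2,1/2)$, $\|\psi\|_{\alpha,1}<\infty$ and $$\int_0^1\psi_s\,dX_s=\xi$$ almost surely, where the integral is the pathwise generalized Lebesgue--Stieltjes integral (with this $\alpha$).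
   Context: $(\Omega,\mathcal F,\mathbb F=(\mathcal F_t)_{t\in[0,1]},\mathbf P)$ is a stochastic basis satisfying the usual assumptions. $C^\rho[0,1]$ denotes the class of Hölder continuous functions of order $\rho$ on $[0,1]$, i.e. functions $f$ with $|f(t)-f(s)|\le C|t-s|^\rho$ for some finite $C$ (depending on $f$). By the upper variance bound $X$ has a modification with paths in $C^\theta[0,1]$ for every $\theta\in(0,H_2)$; $X$ is taken to be this modification. Fractional derivatives: for $[a,b]\subset[0,1]$, $\alpha\in(0,1)$, $f,g:[0,1]\to\mathbb R$, $$(D_{a+}^{\alpha}f)(x)=\frac{1}{\Gamma(1-\alpha)}\Big(\frac{f(x)}{(x-a)^\alpha}+\alpha\int_a^x\frac{f(x)-f(u)}{(x-u)^{1+\alpha}}du\Big)\mathbf 1_{(a,b)}(x),$$ $$(D_{b-}^{1-\alpha}g)(x)=\frac{e^{i\pi\alpha}}{\Gamma(\alpha)}\Big(\frac{g(x)}{(b-x)^{1-\alpha}}+(1-\alpha)\int_x^b\frac{g(x)-g(u)}{(u-x)^{2-\alpha}}du\Big)\mathbf 1_{(a,b)}(x).$$ If $D_{a+}^\alpha f\in L_1[a,b]$ and $D_{b-}^{1-\alpha}g_{b-}\in L_\infty[a,b]$, where $g_{b-}(x)=g(x)-g(b)$, the generalized Lebesgue--Stieltjes integral is $$\int_a^b f(x)\,dg(x)=-e^{-i\pi\alpha}\int_a^b (D_{a+}^\alpha f)(x)\,(D_{b-}^{1-\alpha}g_{b-})(x)\,dx.$$ (For $f\in C^\beta[a,b]$,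 $g\in C^\gamma[a,b]$ with $\beta+\gamma>1$ it exists and equals the limit of Riemann sums.) Norm: $$\|f\|_{\alpha,[a,b]}=\int_a^b\Big(\frac{|f(s)|}{(s-a)^\alpha}+\int_a^s\frac{|f(s)-f(z)|}{(s-z)^{1+\alpha}}dz\Big)ds,\qquad \|f\|_{\alpha,t}=\|f\|_{\alpha,[0,t]}.$$ When $X\in C^\theta[0,1]$ with $\theta>1/2$ and $\alpha\in(1-\theta,1/2)$, the integral $\int_0^t f(s)\,dX_s$ is well defined for every $f$ with $\|f\|_{\alpha,t}<\infty$. *)

(* Defs.v *)
From mathcomp Require Import all_boot all_order all_algebra.
From mathcomp Require Import all_classical all_reals all_analysis.
From mathcomp Require Import complex.

Set Implicit Arguments.
Unset Strict Implicit.
Unset Printing Implicit Defensive.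

Import Order.TTheory GRing.Theory Num.Theory.
Import numFieldNormedType.Exports.

Local Open Scope classical_set_scope.
Local Open Scope ring_scope.

(* Processes and filtrations are indexed by the whole real line, but only the
   indices in [0, 1] are ever constrained or used. *)

Section stochastic_basis.
Context d (T : measurableType d) (R : realType) (P : probability T R).

Record usual_conditions (F : R -> set_system T) : Prop := UsualConditions {
  uc_sigma_algebra : forall t : R, t \in `[0, 1] -> sigma_algebra setT (F t) ;
  uc_measurable : forall t : R, t \in `[0, 1] -> F t `<=` measurable ;
  uc_incr : forall s t : R, 0 <= s -> s <= t -> t <= 1 -> F s `<=` F t ;
  uc_complete : measure_is_complete P ;
  uc_null : P.-negligible `<=` F 0 ;
  uc_right_cont : forall t : R, 0 <= t -> t < 1 ->
    \bigcap_(s in `]t, 1]) F s `<=` F t }.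

Definition adapted (F : R -> set_system T) (X : R -> T -> R) : Prop :=
  forall t : R, t \in `[0, 1] ->
  forall B : set R, measurable B -> F t (X t @^-1` B).

(* The degenerate law is spelled out because the library's [normal_prob m 0] is
   the uniform distribution on [0, 1], not the Dirac mass at m. *)
Definition centered_normal_rv (Y : T -> R) : Prop :=
  measurable_fun setT Y /\
  exists s : R, 0 <= s /\
    forall B : set R, measurable B ->
      P (Y @^-1` B) = if s == 0 then \d_(0 : R) B else normal_prob 0 s B.

Definition centered_gaussian_process (X : R -> T -> R) : Prop :=
  forall (n : nat) (t c : 'I_n -> R), (forall i, t i \in `[0, 1]) ->
    centered_normal_rv (fun w => \sum_(i < n) c i * X (t i) w).

End stochastic_basis.

Section pathwise.
Context {R : realType}.
Local Notation mu := (@lebesgue_measure R).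

Definition holder01 (rho : R) (f : R -> R) : Prop :=
  exists C : R, forall s t : R, s \in `[0, 1] -> t \in `[0, 1] ->
    `|f t - f s| <= C * `|t - s| `^ rho.

Definition Gamma (x : R) : R :=
  \int[mu]_(t in `]0, +oo[) (t `^ (x - 1) * expR (- t)).

Definition cexpi (x : R) : R[i] := (cos x +i* sin x)%C.

Definition complex_integral (D : set R) (h : R -> R[i]) : R[i] :=
  (\int[mu]_(x in D) @complex.Re R (h x) +i* \int[mu]_(x in D) @complex.Im R (h x))%C.

Definition in_Linfty (D : set R) (h : R -> R[i]) : Prop :=
  [/\ measurable_fun D (@complex.Re R \o h), measurable_fun D (@complex.Im R \o h) &
      exists M : R, {ae mu, forall x, D x -> ComplexField.Normc.normc (h x) <= M}].

Definition lkernel (alpha : R) (f : R -> R) (x u : R) : R :=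
  (f x - f u) / (x - u) `^ (1 + alpha).

Definition rkernel (alpha : R) (g : R -> R) (x u : R) : R :=
  (g x - g u) / (u - x) `^ (2 - alpha).

(* $D_{a+}^{\alpha} f$ *)
Definition lfrac_deriv (a b alpha : R) (f : R -> R) (x : R) : R :=
  (Gamma (1 - alpha))^-1 *
  (f x / (x - a) `^ alpha + alpha * \int[mu]_(u in `[a, x]) lkernel alpha f x u)
  * \1_(`]a, b[ : set R) x.

(* $D_{b-}^{1-\alpha} g$; note that alpha stands for the complementary order. *)
Definition rfrac_deriv (a b alpha : R) (g : R -> R) (x : R) : R[i] :=
  (cexpi (pi * alpha) / (Gamma alpha)%:C%C *
  ((g x / (b - x) `^ (1 - alpha)
    + (1 - alpha) * \int[mu]_(u in `[x, b]) rkernel alpha g x u)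
   * \1_(`]a, b[ : set R) x)%:C%C).

(* The first two conjuncts say that the inner integrals, which [Rintegral] would
   otherwise replace by a default value, exist for almost every x. *)
Definition is_gls_integral (alpha a b : R) (f g : R -> R) (v : R) : Prop :=
  let gb := fun x => g x - g b in
  [/\ {ae mu, forall x, a < x < b ->
        mu.-integrable `[a, x] (EFin \o lkernel alpha f x)},
      {ae mu, forall x, a < x < b ->
        mu.-integrable `[x, b] (EFin \o rkernel alpha gb x)},
      mu.-integrable `[a, b] (EFin \o lfrac_deriv a b alpha f),
      in_Linfty `[a, b] (rfrac_deriv a b alpha gb) &
      (v%:C%C = - cexpi (- (pi * alpha)) *
        complex_integral `[a, b] (fun x =>
          (lfrac_deriv a b alpha f x)%:C%C * rfrac_deriv a b alpha gb x))].

Definition frac_norm (alpha a b : R) (f : R -> R) : \bar R :=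
  (\int[mu]_(s in `[a, b])
     ((`|f s| / (s - a) `^ alpha)%:E +
      \int[mu]_(z in `[a, s]) (`|f s - f z| / (s - z) `^ (1 + alpha))%:E))%E.

(* Without measurability the library's integral of a nonnegative function is
   only a lower integral, hence the first conjunct. *)
Definition finite_frac_norm (alpha a b : R) (f : R -> R) : Prop :=
  measurable_fun `[a, b] f /\ (frac_norm alpha a b f < +oo)%E.

End pathwise.

(* Main.v *)
(* Put t_n = 1 - 2^-n and let Phi ([step] below) be a C^1 function with Phi(0) = 0,
   Phi'(0) = 0 and Phi = 1 off [-1, 1].  On [t_n, t_(n+1)[ take
     psi_s = r_n / eps_n * Phi'((X_s - X_(t_n)) / eps_n),
   where r_n = Z_(t_n) - V_n and V_n is the integral of psi over [0, t_n[.  By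
   the chain rule the n-th block contributes
   r_n Phi((X_(t_(n+1)) - X_(t_n)) / eps_n), which is exactly r_n as soon as the
   increment of X is at least eps_n.  For eps_n = 2^-((n+1)(H1 + eta)) the
   boundedness of the Gaussian density, the lower variance bound and the
   Borel-Cantelli lemma show that this happens for all large n, almost surely.
   Then V_(n+1) = Z_(t_n) tends to Z_1 = xi, and r_n = O(2^-(n rho)), so that the
   norm of the n-th block is O(2^-(n s)) with s close to rho - 2 (H1 - H2), which
   is positive because rho > rho_0 >= 2 (H1 - H2).

   For f vanishing off [0, 1[, both the norm of f and its integral are double
   integrals of the Marchaud kernel (f(x) - f(u)) / (x - u)^(1 + alpha) over
   u < x <= 1; this makes the functions with a given integral stable under sums
   and absolutely convergent series.  Everything reduces in this way to
   indicators of intervals, for which the integral is computed by inverting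
   Abel's transform: Gamma(alpha) Gamma(1 - alpha) is the integral of
   w^-alpha / (1 + w) over w > 0.  A block is the limit of its dyadic step
   functions, and the chain rule is the convergence of Riemann sums. *)
Require Import Defs.
From mathcomp Require Import all_boot all_order all_algebra.
From mathcomp Require Import all_classical all_reals all_analysis.
From mathcomp Require Import measurable_realfun complex.
From mathcomp Require Import ring lra.
Import Order.TTheory GRing.Theory Num.Theory.
Import numFieldNormedType.Exports.
Local Open Scope classical_set_scope.
Local Open Scope ring_scope.
Set Implicit Arguments.
Unset Strict Implicit.
Unset Printing Implicit Defensive.

(** The recursion reads r_n off the wealth actually reached. The finitely many blocks on which X
    moves too little therefore do no lasting harm: the first successful block erases all earlier
    errors. Phi' is Lipschitz and vanishes at 0, so a block starts at 0 and has a Hölder constant of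
    order |r_n| / eps_n^2; over a cell of length D its norm is of order |r_n| eps_n^-2 D^(theta + 1
    - alpha). Both theta and 1 - alpha can be taken close to H2, and eps_n is close to D^H1: this is
    the origin of 2 (H1 - H2). The integrand jumps at every t_n and may be unbounded near 1, so its
    integral is not at once a limit of Riemann sums. Hence a norm bound and a value are carried
    along together, and limits are taken by dominated convergence. The obstacle for indicators is
    that the difference in the Marchaud derivative of X cannot be split, each half being divergent.
    The singularity is shifted by d > 0, the halves are integrated explicitly, and d tends to 0
    after the change of variable x = u + d w. *)

Section integration_tools.
Context {R : realType}.
Local Notation mu := (@lebesgue_measure R).
Implicit Types (a b c p q r s t x y : R).

(** The measure |a| times the image of [mu] under the affine map agrees with [mu] on half-open
    intervals, hence everywhere by uniqueness of Lebesgue measure. For [a < 0] the preimage of a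
    half-open interval is closed on the other side, so the two signs are treated apart. *)
Lemma ge0_integral_affine a b (h : R -> \bar R) : a != 0 ->
  measurable_fun [set: R] h -> (forall x, (0 <= h x)%E) ->
  (\int[mu]_x h (a * x + b)%R = (`|a|^-1)%:E * \int[mu]_x h x)%E.
Proof.
move=> a0 mh h0.
pose phi : R -> measurableTypeR R := fun x => a * x + b.
have mphi : measurable_fun setT phi.
  by apply: measurable_funD => //; exact: measurable_funM.
have n0 : 0 <= `|a| by [].
pose k : {nonneg R} := NngNum n0.
pose nu : {measure set (measurableTypeR R) -> \bar R} :=
  mscale k (pushforward mu phi).
have E A : measurable A -> mu A = nu mphi A.
  move=> mA.
  suff H X : ocitv X -> lebesgue_measure X = nu mphi X.
    exact: (@lebesgue_measure_unique R (nu mphi) H A mA).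
  move=> [[x y] /= _ <-].
  rewrite /nu /mscale /= /pushforward /phi.
  have [a_gt0|a_lt0|a_eq0] := ltgtP 0 a; last by rewrite -a_eq0 eqxx in a0.
  - have -> : (fun z => a * z + b) @^-1` `]x, y]%classic = `](x - b) / a, (y - b) / a]%classic.
      apply/seteqP; split => z /=; rewrite !in_itv/=.
        by rewrite ltr_pdivrMr// ler_pdivlMr// => /andP[? ?]; apply/andP; split; lra.
      by rewrite ltr_pdivrMr// ler_pdivlMr// => /andP[? ?]; apply/andP; split; lra.
    rewrite !lebesgue_measure_itv/= !lte_fin ltr_pM2r ?invr_gt0// ltrD2r.
    case: ifPn => xy; last by rewrite mule0.
    rewrite -!EFinD -EFinM; congr EFin.
    by rewrite gtr0_norm//; field; rewrite gt_eqF.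
  - have -> : (fun z => a * z + b) @^-1` `]x, y]%classic = `[(y - b) / a, (x - b) / a[%classic.
      apply/seteqP; split => z /=; rewrite !in_itv/=.
        by rewrite ltr_ndivlMr// ler_ndivrMr// => /andP[? ?]; apply/andP; split; lra.
      by rewrite ltr_ndivlMr// ler_ndivrMr// => /andP[? ?]; apply/andP; split; lra.
    rewrite !lebesgue_measure_itv/= !lte_fin ltr_nM2r ?invr_lt0// ltrD2r.
    case: ifPn => xy; last by rewrite mule0.
    rewrite -!EFinD -EFinM; congr EFin.
    by rewrite ltr0_norm//; field; rewrite lt_eqF.
have -> : (\int[mu]_x h x = \int[nu mphi]_x h x)%E.
  by apply: eq_measure_integral => A mA _; exact: E.
rewrite /nu ge0_integral_mscale// ge0_integral_pushforward//.
rewrite muleA -EFinM /= mulVf ?normr_eq0// mul1e.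
by [].
Qed.

Lemma ge0_integral_shift b (h : R -> \bar R) :
  measurable_fun [set: R] h -> (forall x, (0 <= h x)%E) ->
  (\int[mu]_x h (x + b)%R = \int[mu]_x h x)%E.
Proof.
move=> mh h0; have := @ge0_integral_affine 1 b h (oner_neq0 _) mh h0.
by rewrite normr1 invr1 mul1e => <-; apply: eq_integral => x _; rewrite mul1r.
Qed.

Lemma ge0_integral_reflect b (h : R -> \bar R) :
  measurable_fun [set: R] h -> (forall x, (0 <= h x)%E) ->
  (\int[mu]_x h (b - x)%R = \int[mu]_x h x)%E.
Proof.
move=> mh h0; have := @ge0_integral_affine (-1) b h _ mh h0.
rewrite normrN normr1 invr1 mul1e oppr_eq0 oner_eq0 => <- //.
by apply: eq_integral => x _; rewrite mulN1r addrC.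
Qed.

(** The integrand may blow up at both ends: the fundamental theorem is applied on compact intervals
    exhausting the open one, and monotone convergence does the rest. *)
Lemma ge0_integral_itvoo_FTC (f F : R -> R) a b : a < b ->
  {in `]a, b[, forall x, 0 <= f x} ->
  {in `]a, b[, continuous f} ->
  {in `]a, b[, forall x, is_derive x 1 F (f x)} ->
  F x @[x --> a^'+] --> F a -> F x @[x --> b^'-] --> F b ->
  (\int[mu]_(x in `]a, b[) (f x)%:E = (F b - F a)%:E)%E.
Proof.
move=> ab f0 cf dF Fa Fb.
(* [n.+2] keeps [e n] strictly below half the length, so that no [D n] is degenerate. *)
pose e n := (b - a) / 2 / n.+2%:R.
have e0 n : 0 < e n by rewrite /e divr_gt0// divr_gt0// subr_gt0.
have e_lt n : e n < (b - a) / 2.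
  by rewrite /e ltr_pdivrMr// ltr_pMr ?ltr1n// divr_gt0// subr_gt0.
have e_cvg : e @ \oo --> 0.
  rewrite /e -[X in _ --> X](mulr0 ((b - a) / 2)); apply: cvgMr.
  have := @cvg_harmonic R; rewrite -cvg_shiftS; exact.
have e_decr m n : (m <= n)%N -> e n <= e m.
  move=> mn; rewrite /e ler_pM2l ?divr_gt0 ?subr_gt0//.
  by rewrite lef_pV2 ?posrE// ler_nat.
pose D n : set R := `[a + e n, b - e n]%classic.
have DU : `]a, b[%classic = \bigcup_n D n.
  apply/seteqP; split => x /=; rewrite in_itv/=.
    move=> /andP[ax xb].
    have : \forall n \near \oo, e n < Num.min (x - a) (b - x).
      have m0 : 0 < Num.min (x - a) (b - x) by rewrite lt_min !subr_gt0 ax.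
      have /cvgrPdist_lt/(_ _ m0) := e_cvg.
      by apply: filterS => n; rewrite sub0r normrN gtr0_norm.
    move=> [n _ /(_ n (leqnn n))]; rewrite lt_min => /andP[h1 h2].
    by exists n => //; rewrite /D /= in_itv/=; apply/andP; split; lra.
  move=> [n _]; rewrite /D /= in_itv/= => /andP[h1 h2]; have := e0 n.
  by move=> h3; apply/andP; split; lra.
have cvg1 : (\int[mu]_(x in D n) (f x)%:E @[n --> \oo] -->
             \int[mu]_(x in `]a, b[) (f x)%:E)%E.
  rewrite DU; apply: ge0_nondecreasing_set_cvg_integral.
  - move=> m n mn; apply/subsetPset => x; rewrite /D /= !in_itv/=.
    have := e_decr _ _ mn; move=> h /andP[h1 h2]; apply/andP; split; lra.
  - by move=> n; exact: measurable_itv.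
  - move=> n; apply/measurable_EFinP.
    apply: (@measurable_funS _ _ _ _ `]a, b[) => //.
      by rewrite DU => x Dx; exists n.
    by apply: open_continuous_measurable_fun => // x; rewrite inE => /cf.
  - move=> n x Dx; rewrite lee_fin; apply: f0.
    suff : `]a, b[%classic x by [].
    by rewrite DU; exists n.
have cvg2 : (F (b - e n) - F (a + e n))%:E @[n --> \oo] --> (F b - F a)%:E.
  apply: cvg_EFin; first exact: nearW.
  apply: cvgB.
    move/cvg_at_leftP : Fb; apply; split.
      by move=> n; have := e0 n; lra.
    by rewrite -[X in _ --> X]subr0; apply: cvgB => //; exact: cvg_cst.
  move/cvg_at_rightP : Fa; apply; split.
    by move=> n; have := e0 n; lra.
  by rewrite -[X in _ --> X]addr0; apply: cvgD => //; exact: cvg_cst.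
apply: (cvg_unique (@ereal_hausdorff R) cvg1).
move: cvg2; apply: cvg_trans; apply: near_eq_cvg; near=> n.
have e1 := e_lt n.
have e2 := e0 n.
have lt_ab : a + e n < b - e n by lra.
have sub x : x \in `[a + e n, b - e n] -> x \in `]a, b[.
  by rewrite !in_itv/= => /andP[h1 h2]; apply/andP; split; lra.
have cF x : x \in `]a, b[ -> {for x, continuous F}.
  move=> /dF dFx; apply: differentiable_continuous.
  by apply/derivable1_diffP; exact: (@ex_derive _ _ _ _ _ _ _ dFx).
have inl : a + e n \in `[a + e n, b - e n].
  by rewrite in_itv/= lexx ltW.
have inr : b - e n \in `[a + e n, b - e n].
  by rewrite in_itv/= lexx ltW.
rewrite EFinB; apply: esym; apply: (@continuous_FTC2 _ f F (a + e n) (b - e n) lt_ab).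
- by apply: continuous_in_subspaceT => x; rewrite inE => /sub/cf.
- split.
  + move=> x xI; have /dF dFx : x \in `]a, b[.
      by apply: sub; exact: subset_itv_oo_cc.
    exact: ex_derive.
  + by apply: cvg_at_right_filter; exact: (cF _ (sub _ inl)).
  + by apply: cvg_at_left_filter; exact: (cF _ (sub _ inr)).
- move=> x xI; have /dF dFx : x \in `]a, b[.
    by apply: sub; exact: subset_itv_oo_cc.
  by rewrite derive1E derive_val.
Unshelve. all: by end_near. Qed.

End integration_tools.

Section EFin_rules.
Context d (R : realType) (T : measurableType d) (m : {measure set T -> \bar R}).
Implicit Types (k : R) (f g : T -> R).

Lemma ge0_integralMl k f : 0 <= k -> measurable_fun [set: T] f ->
  (forall x, 0 <= f x) ->
  (\int[m]_x (k * f x)%:E = k%:E * \int[m]_x (f x)%:E)%E.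
Proof.
move=> k0 mf f0; under eq_integral do rewrite EFinM.
apply: ge0_integralZl => //.
- exact/measurable_EFinP.
- by move=> x _; rewrite lee_fin.
Qed.

Lemma ge0_integralDr f g : measurable_fun [set: T] f -> measurable_fun [set: T] g ->
  (forall x, 0 <= f x) -> (forall x, 0 <= g x) ->
  (\int[m]_x (f x + g x)%:E = \int[m]_x (f x)%:E + \int[m]_x (g x)%:E)%E.
Proof.
move=> mf mg f0 g0; under eq_integral do rewrite EFinD.
apply: ge0_integralD => //.
- by move=> x _; rewrite lee_fin.
- exact/measurable_EFinP.
- by move=> x _; rewrite lee_fin.
- exact/measurable_EFinP.
Qed.

Lemma le_integral_EFin f g : measurable_fun [set: T] f -> measurable_fun [set: T] g ->
  (forall x, 0 <= f x) -> (forall x, f x <= g x) ->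
  (\int[m]_x (f x)%:E <= \int[m]_x (g x)%:E)%E.
Proof.
move=> mf mg f0 fg; apply: ge0_le_integral => //.
- by move=> x _; rewrite lee_fin.
- exact/measurable_EFinP.
- exact/measurable_EFinP.
- by move=> x _; rewrite lee_fin.
Qed.

Lemma measurable_nat_of_bool (b : T -> bool) :
  measurable_fun [set: T] b -> measurable_fun [set: T] (fun x => (b x)%:R : R).
Proof. by move=> mb; apply: (measurableT_comp (f := fun c : bool => c%:R : R)). Qed.

End EFin_rules.

(** * Powers cut off at the origin and their integrals *)

Section pos_power.
Context {R : realType}.
Local Notation mu := (@lebesgue_measure R).
Implicit Types (a b c p q r s t x y : R).

(** Cut off at 0, a power lives on the whole line: a restriction such as u < x becomes part of the
    kernel, and integrals over half-lines follow by translation and reflection. *)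
Definition pospow p x : R := if 0 < x then x `^ p else 0.

Lemma pospow_ge0 p x : 0 <= pospow p x.
Proof. by rewrite /pospow; case: ifP => // _; exact: powR_ge0. Qed.

Lemma pospowE p x : 0 < x -> pospow p x = x `^ p.
Proof. by rewrite /pospow => ->. Qed.

Lemma pospow_le0 p x : x <= 0 -> pospow p x = 0.
Proof. by rewrite /pospow leNgt => /negbTE ->. Qed.

Lemma measurable_pospow p : measurable_fun [set: R] (pospow p).
Proof.
rewrite /pospow; apply: measurable_fun_ifT => //.
exact: measurable_fun_ltr.
Qed.

Lemma integral_mul_itv (i : interval R) (g : R -> R) :
  (\int[mu]_x (g x * (x \in i)%:R)%:E = \int[mu]_(x in [set` i]) (g x)%:E)%E.
Proof.
rewrite [RHS]integral_mkcond; apply: eq_integral => x _; rewrite patchE.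
by rewrite mem_setE; case: ifP; rewrite ?mulr1 ?mulr0.
Qed.

Lemma continuous_powR p x : 0 < x -> {for x, continuous (@powR R ^~ p)}.
Proof.
move=> x0; apply: differentiable_continuous; apply/derivable1_diffP.
by apply: derivable_powR; rewrite in_itv/= x0.
Qed.

Lemma cvg_powRN_pinfty p : 0 < p -> t `^ (- p) @[t --> +oo] --> (0 : R).
Proof.
move=> p0.
apply: (@cvg_trans _ (expR (- (p * ln t)) @[t --> +oo])).
  apply: near_eq_cvg; near=> t.
  by rewrite /powR gt_eqF ?mulNr//; near: t; exact: nbhs_pinfty_gt.
apply: (@cvg_comp _ _ _ (fun t => p * ln t) (fun z => expR (- z)) _ (pinfty_nbhs R)).
  apply: gt0_cvgMry => //; apply/cvgryPge => A; near=> t.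
  have t0 : 0 < t by near: t; exact: nbhs_pinfty_gt.
  by rewrite -(expRK A) ler_ln ?posrE ?expR_gt0//; near: t; exact: nbhs_pinfty_ge.
exact: cvgr_expR.
Unshelve. all: by end_near. Qed.

Lemma integral_pospow_tail p r : 0 < p -> 0 < r ->
  (\int[mu]_x (pospow (- 1 - p) x * (r < x)%R%:R)%:E = (r `^ (- p) / p)%:E)%E.
Proof.
move=> p0 r0.
pose F x : R := - (p^-1 * x `^ (- p)).
have dF x : 0 < x -> is_derive x 1 F (x `^ (- 1 - p)).
  move=> x0; have h := is_derive1_powR (- p) x0.
  rewrite /F.
  have -> : x `^ (- 1 - p) = - (p^-1 *: (- p * x `^ (- p - 1))).
    rewrite /GRing.scale /= mulNr mulrN opprK mulrA mulVf ?gt_eqF// mul1r.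
    by congr (_ `^ _); rewrite addrC.
  exact: is_deriveN.
transitivity (\int[mu]_(x in `[r, +oo[) (x `^ (- 1 - p))%:E)%E.
  rewrite -integral_itv_obnd_cbnd; last first.
    by apply/measurable_EFinP/measurable_funTS; exact: measurable_powR.
  rewrite -integral_mul_itv; apply: eq_integral => x _.
  rewrite in_itv/= andbT; case: ltP => rx; last by rewrite !mulr0.
  by rewrite pospowE// (lt_trans r0).
rewrite (@ge0_continuous_FTC2y _ _ F r 0).
- by rewrite /F sub0e -EFinN opprK mulrC.
- by move=> x _; exact: powR_ge0.
- apply: continuous_in_subspaceT => x; rewrite inE/= in_itv/= andbT => rx.
  by apply: continuous_powR; exact: lt_le_trans rx.
- rewrite -oppr0; apply: cvgN; rewrite -(mulr0 p^-1); apply: cvgMr.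
  exact: cvg_powRN_pinfty.
- by move=> x rx; have ? := dF x (lt_trans r0 rx); exact: ex_derive.
- apply: cvg_at_right_filter; apply: differentiable_continuous.
  by apply/derivable1_diffP; have ? := dF r r0; exact: ex_derive.
- move=> x; rewrite in_itv/= andbT => rx.
  by have := dF x (lt_trans r0 rx) => ?; rewrite derive1E derive_val.
Qed.

Lemma cvg_powR_right0 q : 0 < q -> x `^ q @[x --> 0^'+] --> (0 `^ q : R).
Proof. by move=> q0; rewrite powR0 ?gt_eqF//; exact: powR_cvg0. Qed.

(** For [q < 1] the integrand is singular at 0, which is why the primitive is used on an open
    interval. *)
Lemma integral_pospow_head q r : 0 < q -> 0 <= r ->
  (\int[mu]_x (pospow (q - 1) x * (x < r)%R%:R)%:E = (r `^ q / q)%:E)%E.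
Proof.
move=> q0; rewrite le_eqVlt => /predU1P[<-|r0].
  rewrite powR0 ?gt_eqF// mul0r integral0_eq// => x _.
  case: ltP => x0; last by rewrite mulr0.
  by rewrite pospow_le0 ?mul0r// ltW.
pose F x : R := q^-1 * x `^ q.
have dF x : 0 < x -> is_derive x 1 F (x `^ (q - 1)).
  move=> x0; have h := is_derive1_powR q x0.
  rewrite /F.
  have -> : x `^ (q - 1) = (q^-1 *: (q * x `^ (q - 1))).
    by rewrite /GRing.scale /= mulrA mulVf ?gt_eqF// mul1r.
  exact: is_deriveZ.
transitivity (\int[mu]_(x in `]0%R, r[) (x `^ (q - 1))%:E)%E.
  rewrite -integral_mul_itv; apply: eq_integral => x _.
  rewrite in_itv/=; case: (ltP 0 x) => x0; first by rewrite pospowE.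
  by rewrite pospow_le0// mul0r mulr0.
rewrite (@ge0_integral_itvoo_FTC _ _ F)//.
- by rewrite /F powR0 ?gt_eqF// mulr0 subr0 mulrC.
- by move=> x _; exact: powR_ge0.
- by move=> x; rewrite in_itv/= => /andP[x0 _]; exact: continuous_powR.
- by move=> x; rewrite in_itv/= => /andP[x0 _]; exact: dF.
- by apply: cvgMr; exact: cvg_powR_right0.
- apply: cvg_at_left_filter; apply: differentiable_continuous.
  by apply/derivable1_diffP; have ? := dF r r0; exact: ex_derive.
Qed.

Lemma integral_expR_tail s : 0 < s ->
  (\int[mu]_t (expR (- (s * t)) * (0 < t)%R%:R)%:E = (s^-1)%:E)%E.
Proof.
move=> s0.
have := integral_exponential_pdf s0.
have -> : (\int[mu]_x (exponential_pdf s x)%:E =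
  \int[mu]_(x in `]0%R, +oo[) (s%:E * (expR (- (s * x)))%:E))%E.
  rewrite integral_itv_obnd_cbnd; last first.
    apply: measurable_funTS; apply: measurable_funeM; apply/measurable_EFinP.
    by apply: measurableT_comp => //; apply: measurableT_comp.
  rewrite [RHS]integral_mkcond; apply: eq_integral => x _.
  rewrite /exponential_pdf !patchE; case: ifP => // _.
  by rewrite -EFinM mulNr.
rewrite ge0_integralZl//; last 2 first.
- apply: measurable_funTS; apply/measurable_EFinP.
  by apply: measurableT_comp => //; apply: measurableT_comp.
- by rewrite lee_fin ltW.
move=> h; transitivity (\int[mu]_(x in `]0%R, +oo[) (expR (- (s * x)))%:E)%E.
  by rewrite -integral_mul_itv; apply: eq_integral => x _; rewrite in_itv/= andbT.
set J := (\int[mu]_(x in _) _)%E in h *.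
have : (s^-1%:E * (s%:E * J) = s^-1%:E * 1)%E by rewrite h.
by rewrite muleA -EFinM mulVf ?gt_eqF// mul1e mule1.
Qed.

Lemma integral_expR_pospow p t : 0 < t ->
  (\int[mu]_w (pospow p w * expR (- (t * w)))%:E =
   (t `^ (- p - 1))%:E * \int[mu]_w (pospow p w * expR (- w))%:E)%E.
Proof.
move=> t0.
have mh : measurable_fun [set: R] (fun w => (pospow p w * expR (- w))%:E).
  apply/measurable_EFinP; apply: measurable_funM; first exact: measurable_pospow.
  by apply: measurableT_comp.
have h0 w : (0 <= (pospow p w * expR (- w))%:E)%E.
  by rewrite lee_fin mulr_ge0 ?pospow_ge0 ?expR_ge0.
have := ge0_integral_affine 0 _ mh h0 => /(_ t); rewrite gt_eqF// => /(_ isT).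
rewrite gtr0_norm// => E.
have -> : (t `^ (- p - 1) = t `^ (- p) * t^-1)%R.
  by rewrite powRB ?(gt_eqF t0) ?implybT// powRr1// ltW.
rewrite EFinM -muleA -E -ge0_integralZl//.
- apply: eq_integral => w _; rewrite addr0 -EFinM; congr EFin.
  rewrite /pospow pmulr_rgt0//; case: ifP => w0; last by rewrite !mul0r mulr0.
  rewrite powRM ?ltW// !mulrA -powRD ?(gt_eqF t0) ?implybT// addNr powRr0 mul1r//.
- have -> : (fun x => (pospow p (t * x + 0) * expR (- (t * x + 0)))%:E) =
    (fun w => (pospow p w * expR (- w))%:E) \o (fun x => t * x + 0) by [].
  apply: measurableT_comp => //.
  by apply: measurable_funD => //; exact: measurable_funM.
- by rewrite lee_fin powR_ge0.
Qed.

Lemma integral_pospow_headc q r : 0 < q -> 0 <= r ->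
  (\int[mu]_x (pospow (q - 1) x * (x <= r)%R%:R)%:E = (r `^ q / q)%:E)%E.
Proof.
move=> q0 r0; rewrite -integral_pospow_head//.
transitivity (\int[mu]_x (pospow (q - 1) x * (x \in `]-oo, r])%:R)%:E)%E.
  by apply: eq_integral => x _; rewrite in_itv.
rewrite integral_mul_itv -integral_itv_bndo_bndc; last first.
  by apply/measurable_EFinP/measurable_funTS; exact: measurable_pospow.
by rewrite -integral_mul_itv; apply: eq_integral => x _; rewrite in_itv.
Qed.

Lemma integral_pospow_tailc p r : 0 < p -> 0 < r ->
  (\int[mu]_x (pospow (- 1 - p) x * (r <= x)%R%:R)%:E = (r `^ (- p) / p)%:E)%E.
Proof.
move=> p0 r0; rewrite -integral_pospow_tail//.
transitivity (\int[mu]_x (pospow (- 1 - p) x * (x \in `[r, +oo[)%:R)%:E)%E.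
  by apply: eq_integral => x _; rewrite in_itv/= andbT.
rewrite integral_mul_itv -integral_itv_obnd_cbnd; last first.
  by apply/measurable_EFinP/measurable_funTS; exact: measurable_pospow.
by rewrite -integral_mul_itv; apply: eq_integral => x _; rewrite in_itv/= andbT.
Qed.

End pos_power.

(** * The reflection formula for Gamma *)

Section gamma_reflection.
Context {R : realType}.
Local Notation mu := (@lebesgue_measure R).
Implicit Types (a b c p q r s t x y : R).

(** This integral and [ebeta], which is Euler's B(1 - a, a), are kept in [\bar R]: Tonelli's theorem
    then relates them before anything is known to be finite. *)
Definition egamma p : \bar R := (\int[mu]_w (pospow (p - 1) w * expR (- w))%:E)%E.

Definition ebeta a : \bar R := (\int[mu]_w (pospow (- a) w / (1 + w))%:E)%E.

Lemma GammaE p : Gamma p = fine (egamma p).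
Proof.
rewrite /Gamma /Rintegral -(integral_mul_itv `]0, +oo[ ) /egamma; congr fine.
apply: eq_integral => x _; rewrite in_itv/= andbT /pospow; case: ifP => // _.
  by rewrite mulr1.
by rewrite mulr0 mul0r.
Qed.

Lemma egamma_ge0 p : (0 <= egamma p)%E.
Proof.
by apply: integral_ge0 => x _; rewrite lee_fin mulr_ge0 ?pospow_ge0 ?expR_ge0.
Qed.

(** Write 1 / (1 + w) as the integral of exp(- (1 + w) t) over t > 0 and exchange the integrals: for
    fixed t the integral over w is exp(- t) t^(a - 1) times Gamma(1 - a). *)
Lemma ebetaE a : ebeta a = (egamma (1 - a) * egamma a)%E.
Proof.
pose f (z : R * R) : \bar R :=
  (pospow (- a) z.1 * (expR (- ((1 + z.1) * z.2)) * (0 < z.2)%R%:R))%:E.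
have f0 z : (0 <= f z)%E.
  by rewrite lee_fin mulr_ge0 ?pospow_ge0// mulr_ge0 ?expR_ge0.
have mf : measurable_fun setT f.
  apply/measurable_EFinP; apply: measurable_funM.
    by apply: measurableT_comp; [exact: measurable_pospow|exact: measurable_fst].
  apply: measurable_funM.
    apply: measurableT_comp => //; apply: measurableT_comp => //.
    apply: measurable_funM; last exact: measurable_snd.
    by apply: measurable_funD => //; exact: measurable_fst.
  apply: (measurableT_comp (f := fun b : bool => b%:R : R)) => //.
  by apply: measurable_fun_ltr => //; exact: measurable_snd.
have := @fubini_tonelli _ _ _ _ _ mu mu f mf f0.
have -> : (\int[mu]_x \int[mu]_y f (x, y))%E = ebeta a.
  apply: eq_integral => w _; rewrite /f /=.
  under eq_integral do rewrite EFinM.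
  have [w0|w0] := ltP 0 w; last first.
    by rewrite pospow_le0// mul0r integral0_eq// => x _; rewrite mul0e.
  rewrite ge0_integralZl//.
  - by rewrite integral_expR_tail ?addr_gt0//.
  - apply/measurable_EFinP; apply: measurable_funM.
      by do 2 apply: measurableT_comp => //; exact: measurable_funM.
    apply: (measurableT_comp (f := fun b : bool => b%:R : R)) => //.
    exact: measurable_fun_ltr.
  - by rewrite lee_fin pospow_ge0.
move=> ->; rewrite muleC.
have mg p : measurable_fun [set: R] (fun w => (pospow p w * expR (- w))%:E).
  apply/measurable_EFinP; apply: measurable_funM; first exact: measurable_pospow.
  by apply: measurableT_comp.
rewrite [in RHS]/egamma -ge0_integralZr//; last 3 first.
- exact: mg.
- by move=> w _; rewrite lee_fin mulr_ge0 ?pospow_ge0 ?expR_ge0.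
- exact: egamma_ge0.
apply: eq_integral => t _.
have [t0|t0] := ltP 0 t; last first.
  rewrite pospow_le0// mul0r mul0e integral0_eq// => x _.
  by rewrite /f /= ltNge t0 mulr0 mulr0.
transitivity (\int[mu]_x (expR (- t) * (pospow (- a) x * expR (- (t * x))))%:E)%E.
  apply: eq_integral => x _; rewrite /f/= t0 mulr1; congr EFin.
  rewrite mulrCA; congr (_ * _); rewrite -expRD; congr expR; ring.
have -> : (pospow (a - 1) t * expR (- t) = expR (- t) * t `^ (- - a - 1))%R.
  by rewrite pospowE// mulrC; congr (_ * _ `^ _); ring.
rewrite ge0_integralMl; first last.
- by move=> x; rewrite mulr_ge0 ?pospow_ge0 ?expR_ge0.
- apply: measurable_funM; first exact: measurable_pospow.
  by do 2 apply: measurableT_comp => //.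
- exact: expR_ge0.
rewrite (integral_expR_pospow _ t0) muleA -EFinM.
have -> : 1 - a - 1 = - a by ring.
by [].
Qed.

Lemma measurable_inv : measurable_fun [set: R] (fun x : R => x^-1).
Proof.
have -> : (fun x : R => x^-1) = (fun x => pospow (-1) x - pospow (-1) (- x)).
  apply/funext => x; rewrite /pospow oppr_gt0.
  have [x0|x0|<-] := ltgtP 0 x; last by rewrite invr0 subr0.
    by rewrite subr0 powR_inv1 ?ltW.
  by rewrite sub0r powR_inv1 ?invrN ?opprK// oppr_ge0 ltW.
apply: measurable_funB; first exact: measurable_pospow.
by apply: measurableT_comp => //; exact: measurable_pospow.
Qed.

Lemma measurable_ebeta a :
  measurable_fun [set: R] (fun w => (pospow (- a) w / (1 + w))%:E).
Proof.
apply/measurable_EFinP; apply: measurable_funM; first exact: measurable_pospow.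
by apply: (measurableT_comp measurable_inv) => //; apply: measurable_funD.
Qed.

Lemma ebeta_ge0 a w : 0 <= pospow (- a) w / (1 + w).
Proof.
have [w0|w0] := ltP 0 w; last by rewrite pospow_le0// mul0r.
by rewrite divr_ge0 ?pospow_ge0// addr_ge0// ltW.
Qed.

Lemma measurable_ltlr (r : R) : measurable_fun [set: R] (fun x => (r < x)%R%:R : R).
Proof.
apply: (measurableT_comp (f := fun b : bool => b%:R : R)) => //.
exact: measurable_fun_ltr.
Qed.

Lemma measurable_ltrr (r : R) : measurable_fun [set: R] (fun x => (x < r)%R%:R : R).
Proof.
apply: (measurableT_comp (f := fun b : bool => b%:R : R)) => //.
exact: measurable_fun_ltr.
Qed.

Lemma ebeta_lty a : 0 < a < 1 -> (ebeta a < +oo)%E.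
Proof.
move=> /andP[a0 a1].
(* The integrand is at most w^-a for w < 1 and at most w^(-1 - a) for w >= 1. The second range
   starts at 1/2 so that its strict inequality covers w = 1; the overlap is harmless. *)
apply: (@le_lt_trans _ _ (\int[mu]_w ((pospow ((1 - a) - 1) w * (w < 1)%R%:R)%:E
   + (pospow (- 1 - a) w * (2^-1 < w)%R%:R)%:E))%E).
  apply: ge0_le_integral => //.
  - by move=> x _; rewrite lee_fin ebeta_ge0.
  - exact: measurable_ebeta.
  - apply: emeasurable_funD; apply/measurable_EFinP; apply: measurable_funM.
    + exact: measurable_pospow.
    + exact: measurable_ltrr.
    + exact: measurable_pospow.
    + exact: measurable_ltlr.
  - move=> x _; rewrite -EFinD lee_fin.
    have [x0|x0] := ltP 0 x; last by rewrite !pospow_le0// !mul0r addr0.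
    rewrite !pospowE//; have -> : 1 - a - 1 = - a by ring.
    have [x1|x1] := ltP x 1.
      rewrite mulr1 ler_wpDr ?mulr_ge0 ?powR_ge0//.
      by rewrite ler_pdivrMr ?addr_gt0// ler_peMr ?powR_ge0// lerDl ltW.
    rewrite mulr0 add0r (_ : (2^-1 < x)%R) ?mulr1; last by lra.
    have -> : - 1 - a = - a - 1 by ring.
    rewrite powRB ?(gt_eqF x0) ?implybT// powRr1 ?(ltW x0)//.
    by rewrite ler_pM2l ?powR_gt0// lef_pV2 ?posrE ?addr_gt0// lerDr.
rewrite ge0_integralD//.
- rewrite integral_pospow_head ?subr_gt0// integral_pospow_tail//.
  by rewrite -EFinD ltry.
- by move=> x _; rewrite lee_fin mulr_ge0 ?pospow_ge0.
- apply/measurable_EFinP/measurable_funM; first exact: measurable_pospow.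
  exact: measurable_ltrr.
- by move=> x _; rewrite lee_fin mulr_ge0 ?pospow_ge0.
- apply/measurable_EFinP/measurable_funM; first exact: measurable_pospow.
  exact: measurable_ltlr.
Qed.

Lemma ebeta_gt0 a : 0 < a -> (0 < ebeta a)%E.
Proof.
move=> a0.
apply: (@lt_le_trans _ _ (\int[mu]_w ((2^-1)%:E * (pospow (- 1 - a) w * (1 < w)%R%:R)%:E))%E).
  rewrite ge0_integralZl//.
  - by rewrite integral_pospow_tail// powR1 -EFinM lte_fin mulr_gt0// mul1r invr_gt0.
  - apply/measurable_EFinP/measurable_funM; first exact: measurable_pospow.
    exact: measurable_ltlr.
  - by move=> x _; rewrite lee_fin mulr_ge0 ?pospow_ge0.
apply: ge0_le_integral => //.
- by move=> x _; rewrite -EFinM lee_fin mulr_ge0// mulr_ge0 ?pospow_ge0.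
- apply: measurable_funeM.
  apply/measurable_EFinP/measurable_funM; first exact: measurable_pospow.
  exact: measurable_ltlr.
- exact: measurable_ebeta.
- move=> x _; rewrite -EFinM lee_fin.
  have [x1|x1] := ltP 1 x; last by rewrite mulr0 mulr0 ebeta_ge0.
  have x0 : 0 < x by lra.
  rewrite !pospowE// mulr1.
  have -> : - 1 - a = - a - 1 by ring.
  rewrite powRB ?(gt_eqF x0) ?implybT// powRr1 ?(ltW x0)// mulrCA.
  rewrite ler_pM2l ?powR_gt0// -invfM lef_pV2 ?posrE ?mulr_gt0 ?addr_gt0//.
  by rewrite mulr_natl mulr2n lerD2r ltW.
Qed.

(** [Gamma] is [fine] of [egamma], which would turn an infinite value into 0. Both factors are
    finite because their product is finite and positive: with a factor +oo it would be +oo or 0. *)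
Lemma Gamma_reflection a : 0 < a < 1 ->
  (Gamma a * Gamma (1 - a))%:E = ebeta a /\ 0 < Gamma a * Gamma (1 - a).
Proof.
move=> a01; have /andP[a0 a1] := a01.
have E := ebetaE a; have F := ebeta_lty a01; have P := ebeta_gt0 a0.
suff H : (Gamma a * Gamma (1 - a))%:E = ebeta a.
  by split => //; rewrite -lte_fin H.
rewrite E !GammaE mulrC; move: F P; rewrite E.
have := egamma_ge0 a; have := egamma_ge0 (1 - a).
case: (egamma (1 - a)) => [x| |//]; case: (egamma a) => [y| |//] //=.
- rewrite !lee_fin => x0 y0.
  rewrite muleC mulyr; case: (ltgtP 0 x) x0 => // x0 _.
    by rewrite gtr0_sg// mul1e.
  by rewrite -x0 sgr0 mul0e ltxx.
- rewrite !lee_fin => _ y0.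
  rewrite mulyr; case: (ltgtP 0 y) y0 => // y0 _.
    by rewrite gtr0_sg// mul1e.
  by rewrite -y0 sgr0 mul0e ltxx.
Qed.

Lemma integral_abel_kernel a w d : 0 < a < 1 -> 0 < w -> 0 < d ->
  (\int[mu]_x (pospow (- a) x * (x < w)%R%:R * (w - x + d) `^ (a - 2))%:E =
   (w `^ (1 - a) * d `^ (a - 1) / ((1 - a) * (w + d)))%:E)%E.
Proof.
move=> /andP[a0 a1] w0 d0.
set c := w + d.
have c0 : 0 < c by rewrite /c addr_gt0.
have a1' : 0 < 1 - a by rewrite subr_gt0.
(* The primitive of x^-a (c - x)^(a - 2), found by the substitution x / (c - x). *)
pose F x : R := ((1 - a) * c)^-1 * (x `^ (1 - a) * (c - x) `^ (a - 1)).
have dF x : 0 < x -> x < c -> is_derive x 1 F (x `^ (- a) * (c - x) `^ (a - 2)).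
  move=> x0 xc; have h := is_derive1_powR (1 - a) x0.
  have cx0 : 0 < c - x by rewrite subr_gt0.
  have h1 : is_derive x 1 (fun z => c - z) (- 1).
    by rewrite -(add0r (- 1)); apply: is_deriveB.
  have h2 := is_derive1_powR (a - 1) cx0.
  have h3 : is_derive x 1 (fun z => (c - z) `^ (a - 1))
      ((a - 1) * (c - x) `^ (a - 1 - 1) * -1).
    exact: (@is_derive1_comp _ (@powR R ^~ (a - 1)) (fun z => c - z) x _ _ h2 h1).
  have -> : x `^ (- a) * (c - x) `^ (a - 2) =
     ((1 - a) * c)^-1 *: (x `^ (1 - a) *: ((a - 1) * (c - x) `^ (a - 1 - 1) * -1)
      + (c - x) `^ (a - 1) *: ((1 - a) * x `^ (1 - a - 1))).
    rewrite /GRing.scale /=.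
    have -> : 1 - a - 1 = - a by ring.
    have -> : a - 1 - 1 = a - 2 by ring.
    have -> : x `^ (1 - a) = x * x `^ (- a).
      by rewrite powRD ?(gt_eqF x0) ?implybT// powRr1 ?ltW.
    have -> : (c - x) `^ (a - 1) = (c - x) * (c - x) `^ (a - 2).
      have -> : a - 1 = 1 + (a - 2) by ring.
      by rewrite (@powRD _ (c - x) 1) ?(gt_eqF cx0) ?implybT// powRr1// ltW.
    by field; rewrite (gt_eqF c0) (gt_eqF a1').
  have h4 := is_deriveM h h3.
  exact: (is_deriveZ ((1 - a) * c)^-1 h4).
transitivity (\int[mu]_(x in `]0%R, w[) (x `^ (- a) * (c - x) `^ (a - 2))%:E)%E.
  rewrite -integral_mul_itv; apply: eq_integral => x _.
  rewrite in_itv/=; case: (ltP 0 x) => x0.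
    rewrite pospowE// /c; have -> : w - x + d = w + d - x by ring.
    by rewrite mulrAC.
  by rewrite pospow_le0// !mul0r mulr0.
have cc x : x < c -> {for x, continuous (fun z => (c - z) `^ (a - 1))}.
  move=> xc; apply: (@continuous_comp _ _ _ (fun z => c - z) (@powR R ^~ (a - 1))).
    by apply: continuousB => //; exact: cst_continuous.
  by apply: continuous_powR; rewrite subr_gt0.
have cc2 x : x < c -> {for x, continuous (fun z => (c - z) `^ (a - 2))}.
  move=> xc; apply: (@continuous_comp _ _ _ (fun z => c - z) (@powR R ^~ (a - 2))).
    by apply: continuousB => //; exact: cst_continuous.
  by apply: continuous_powR; rewrite subr_gt0.
have wc : w < c by rewrite /c ltrDl.
rewrite (@ge0_integral_itvoo_FTC _ _ F)//.
- rewrite /F powR0 ?gt_eqF// mul0r mulr0 subr0.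
  have -> : c - w = d by rewrite /c; ring.
  by rewrite mulrC.
- by move=> x _; rewrite mulr_ge0 ?powR_ge0.
- move=> x; rewrite in_itv/= => /andP[x0 xw]; apply: cvgM.
    exact: continuous_powR.
  by apply: cc2; exact: lt_trans wc.
- by move=> x; rewrite in_itv/= => /andP[x0 xw]; apply: dF => //; exact: lt_trans wc.
- apply: cvgMr; apply: cvgM; first exact: cvg_powR_right0.
  by apply: cvg_at_right_filter; apply: cc.
- apply: cvg_at_left_filter; apply: differentiable_continuous.
  by apply/derivable1_diffP; have ? := dF w w0 wc; exact: ex_derive.
Qed.

End gamma_reflection.

(** * Marchaud kernels *)

Section frac_class.
Context {R : realType}.
Local Notation mu := (@lebesgue_measure R).
Local Notation mu2 := (mu \x mu)%E.
Implicit Types (b c p q r s t u x y : R) (f g : R -> R).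

Definition mker a f (z : R * R) : R :=
  (f z.1 - f z.2) * pospow (- 1 - a) (z.1 - z.2) * (z.1 <= 1)%R%:R.

Definition fnorm a f : \bar R := (\int[mu2]_z `|mker a f z|%:E)%E.

(* For f vanishing off [0, 1[, the term f(x) / x ^ alpha of the fractional
   derivative is the part u < 0 of the Marchaud integral, so that a single
   double integral represents the generalized Lebesgue-Stieltjes integral. *)
Definition frac_class a (A : R -> R) f v (N : R) : Prop :=
  [/\ measurable_fun [set: R] f, forall x, x \notin `[0, 1[ -> f x = 0,
      (fnorm a f <= N%:E)%E &
      (\int[mu2]_z (mker a f z * A z.1)%:E = v%:E)%E].

Lemma measurable_mker a f : measurable_fun [set: R] f ->
  measurable_fun [set: R * R] (mker a f).
Proof.
move=> mf; apply: measurable_funM.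
  apply: measurable_funM.
    apply: measurable_funB; apply: (measurableT_comp mf).
      exact: measurable_fst.
    exact: measurable_snd.
  apply: (measurableT_comp (measurable_pospow _)).
  by apply: measurable_funB; [exact: measurable_fst|exact: measurable_snd].
by apply: measurable_nat_of_bool; apply: measurable_fun_ler.
Qed.

Lemma mkerD a f g z : mker a (fun x => f x + g x) z = mker a f z + mker a g z.
Proof. by rewrite /mker; ring. Qed.

Lemma mkerZ a c f z : mker a (fun x => c * f x) z = c * mker a f z.
Proof. by rewrite /mker; ring. Qed.

Section class.
Variables (a M : R) (A : R -> R).
Hypotheses (mA : measurable_fun [set: R] A) (AM : forall x, `|A x| <= M).

Let M0 : 0 <= M. Proof. exact: le_trans (normr_ge0 _) (AM 0). Qed.

Lemma measurable_mkerA f : measurable_fun [set: R] f ->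
  measurable_fun [set: R * R] (fun z => mker a f z * A z.1).
Proof.
move=> mf; apply: measurable_funM; first exact: measurable_mker.
by apply: (measurableT_comp mA); exact: measurable_fst.
Qed.

Lemma integrable_mker f N : measurable_fun [set: R] f -> (fnorm a f <= N%:E)%E ->
  mu2.-integrable setT (EFin \o mker a f).
Proof.
move=> mf fN; apply/integrableP; split.
  by apply/measurable_EFinP; exact: measurable_mker.
by apply: le_lt_trans fN _; rewrite ltry.
Qed.

Lemma integrable_mkerA f N : measurable_fun [set: R] f -> (fnorm a f <= N%:E)%E ->
  mu2.-integrable setT (fun z => (mker a f z * A z.1)%:E).
Proof.
move=> mf fN.
apply: (@le_integrable _ _ _ mu2 setT measurableT _
    (fun z => (M%:E * (mker a f z)%:E)%E)).
- by apply/measurable_EFinP; exact: measurable_mkerA.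
- move=> z _; rewrite -EFinM lee_fin !normrM mulrC (ger0_norm M0).
  by rewrite ler_wpM2r.
- by apply: (integrableZl measurableT); exact: integrable_mker fN.
Qed.

Lemma frac_class0 : frac_class a A (fun=> 0) 0 0.
Proof.
have E z : mker a (fun=> 0) z = 0 by rewrite /mker subrr !mul0r.
split => //; first by rewrite /fnorm integral0_eq// => z _; rewrite E normr0.
by apply: integral0_eq => z _; rewrite E mul0r.
Qed.

Lemma frac_classD f g v w N L : frac_class a A f v N -> frac_class a A g w L ->
  frac_class a A (fun x => f x + g x) (v + w) (N + L).
Proof.
move=> [mf f0 fN fv] [mg g0 gL gw]; split.
- exact: measurable_funD.
- by move=> x x01; rewrite f0// g0// addr0.
- apply: (@le_trans _ _ (fnorm a f + fnorm a g)%E); last by rewrite EFinD leeD.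
  rewrite /fnorm -ge0_integralDr//; last 2 first.
  + by apply: measurableT_comp => //; exact: measurable_mker.
  + by apply: measurableT_comp => //; exact: measurable_mker.
  apply: le_integral_EFin => //.
  + apply: measurableT_comp => //; apply: measurable_mker.
    exact: measurable_funD.
  + by apply: measurable_funD; apply: measurableT_comp => //; exact: measurable_mker.
  + by move=> z; rewrite mkerD ler_normD.
- rewrite EFinD -fv -gw -integralD_EFin//.
  + by apply: eq_integral => z _; rewrite mkerD mulrDl EFinD.
  + exact: integrable_mkerA fN.
  + exact: integrable_mkerA gL.
Qed.

Lemma frac_classZ c f v N : frac_class a A f v N ->
  frac_class a A (fun x => c * f x) (c * v) (`|c| * N).
Proof.
move=> [mf f0 fN fv]; split.
- exact: measurable_funM.
- by move=> x x01; rewrite f0// mulr0.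
- have -> : fnorm a (fun x => c * f x) = (`|c|%:E * fnorm a f)%E.
    rewrite /fnorm -ge0_integralMl//.
    + by apply: eq_integral => z _; rewrite mkerZ normrM.
    + by apply: measurableT_comp => //; exact: measurable_mker.
  by rewrite EFinM lee_wpmul2l// lee_fin.
- rewrite EFinM -fv -integralZl//; last exact: integrable_mkerA fN.
  by apply: eq_integral => z _; rewrite mkerZ -mulrA EFinM.
Qed.

Lemma frac_class_sum n (f : nat -> R -> R) (v N : nat -> R) :
  (forall i, (i < n)%N -> frac_class a A (f i) (v i) (N i)) ->
  frac_class a A (fun x => \sum_(0 <= i < n) f i x) (\sum_(0 <= i < n) v i)
    (\sum_(0 <= i < n) N i).
Proof.
elim: n => [|n IH] H.
  rewrite !big_geq//; have -> : (fun x => \sum_(0 <= i < 0) f i x) = (fun=> 0).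
    by apply/funext => x; rewrite big_geq.
  exact: frac_class0.
rewrite !big_nat_recr//=.
have -> : (fun x => \sum_(0 <= i < n.+1) f i x) =
    (fun x => \sum_(0 <= i < n) f i x + f n x).
  by apply/funext => x; rewrite big_nat_recr.
by apply: frac_classD; [apply: IH => i ni; apply: H; exact: ltnW|exact: H].
Qed.

(** Summable norms make the sum of all [|mker a (e n) z|] integrable. It dominates the partial sums,
    up to the factor [M] for the values, so both the norm bound and the value survive the limit. *)
Lemma frac_class_series (e : nat -> R -> R) (w N : nat -> R) f v B :
  (forall n, frac_class a A (e n) (w n) (N n)) -> (forall n, 0 <= N n) ->
  (\sum_(n <oo) (N n)%:E <= B%:E)%E ->
  (forall x, \sum_(0 <= i < n) e i x @[n --> \oo] --> f x) ->
  \sum_(0 <= i < n) w i @[n --> \oo] --> v ->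
  frac_class a A f v B.
Proof.
move=> eC N0 NB ef wv.
pose S n x := \sum_(0 <= i < n) e i x.
have SC n : frac_class a A (S n) (\sum_(0 <= i < n) w i) (\sum_(0 <= i < n) N i).
  by apply: frac_class_sum.
have mS n : measurable_fun [set: R] (S n) by case: (SC n).
have mf : measurable_fun [set: R] f.
  by apply: (measurable_fun_cvg (h := S)) => // x _; exact: ef.
have lS z : mker a (S n) z @[n --> \oo] --> mker a f z.
  rewrite /mker; apply: cvgMl; apply: cvgMl.
  by apply: cvgB; exact: ef.
pose g z := (\sum_(n <oo) `|mker a (e n) z|%:E)%E.
have SE n z : mker a (S n) z = \sum_(0 <= i < n) mker a (e i) z.
  elim: n => [|n IH].
    by rewrite /mker /S !big_geq// subrr !mul0r.
  rewrite big_nat_recr//= -IH -mkerD; congr (_ * _ * _).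
  by rewrite /S !big_nat_recr.
have Sg n z : (`|mker a (S n) z|%:E <= g z)%E.
  rewrite SE; apply: (@le_trans _ _ (\sum_(0 <= i < n) `|mker a (e i) z|%:E)%E).
    by rewrite sumEFin lee_fin ler_norm_sum.
  by apply: nneseries_lim_ge => i _ _; rewrite lee_fin.
have fg z : (`|mker a f z|%:E <= g z)%E.
  have h : (`|mker a (S n) z|%:E @[n --> \oo] --> `|mker a f z|%:E)%E.
    by apply: cvg_EFin; [exact: nearW|apply: cvg_norm; exact: lS].
  by apply: (cvge_le _ h); apply: nearW => n; exact: Sg.
have mg : measurable_fun [set: R * R] g.
  apply: ge0_emeasurable_sum => // n _.
  apply/measurable_EFinP; apply: measurableT_comp => //; apply: measurable_mker.
  by case: (eC n).
have g0 z : (0 <= g z)%E by apply: nneseries_ge0 => n _ _; rewrite lee_fin.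
have gB : (\int[mu2]_z g z <= B%:E)%E.
  rewrite integral_nneseries//.
  - apply: le_trans NB; apply: lee_nneseries => [n _ _|n _].
      by apply: integral_ge0 => z _; rewrite lee_fin.
    by case: (eC n).
  - move=> n; apply/measurable_EFinP; apply: measurableT_comp => //.
    by apply: measurable_mker; case: (eC n).
split => //.
- move=> x x01; apply: (cvg_unique (@Rhausdorff R) (ef x)).
  rewrite (_ : (fun n => _) = (fun=> 0)); first exact: cvg_cst.
  by apply/funext => n; case: (SC n) => _ /(_ x x01).
- apply: le_trans gB; apply: ge0_le_integral => //.
  by apply/measurable_EFinP; apply: measurableT_comp => //; exact: measurable_mker.
- have ig : mu2.-integrable setT (fun z => (M%:E * g z)%E).
    apply: integrableZl => //; apply/integrableP; split => //.
    under eq_integral do rewrite gee0_abs//.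
    by apply: le_lt_trans gB _; rewrite ltry.
  have [] := @dominated_convergence _ _ _ mu2 setT measurableT
    (fun n z => (mker a (S n) z * A z.1)%:E) (fun z => (mker a f z * A z.1)%:E)
    (fun z => (M%:E * g z)%E).
  + by move=> n; apply/measurable_EFinP; exact: measurable_mkerA.
  + by apply/measurable_EFinP; exact: measurable_mkerA.
  + apply: aeW => z _; apply: cvg_EFin; first exact: nearW.
    by apply: cvgMl; exact: lS.
  + exact: ig.
  + apply: aeW => z n _; rewrite abse_EFin normrM mulrC EFinM.
    by apply: lee_pmul => //; rewrite lee_fin.
  move=> _ _ c1.
  suff : (\int[mu2]_z (mker a (S n) z * A z.1)%:E @[n --> \oo] --> v%:E)%E.
    exact: (cvg_unique (@ereal_hausdorff R) c1).
  have E n : (\int[mu2]_z (mker a (S n) z * A z.1)%:E = (\sum_(0 <= i < n) w i)%:E)%E.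
    by case: (SC n).
  under eq_cvg do rewrite E.
  by apply: cvg_EFin => //; exact: nearW.
Qed.

End class.

(** * Norms of indicators of intervals *)

Section indicators.
Variables (a : R).
Hypothesis a01 : 0 < a < 1.

Let a0 : 0 < a. Proof. by case/andP: a01. Qed.
Let a1 : 0 < 1 - a. Proof. by case/andP: a01 => _; rewrite subr_gt0. Qed.

Definition ind u v x : R := (u <= x < v)%R%:R.

Lemma measurable_ind u v : measurable_fun [set: R] (ind u v).
Proof.
apply: measurable_nat_of_bool; apply: measurable_and.
  exact: measurable_fun_ler.
exact: measurable_fun_ltr.
Qed.

(** A pair [z.2 < z.1] separated by the interval has either [z.1] inside and [z.2] on its left
    ([ker1]), or [z.2] inside and [z.1] on its right ([ker2], where the cutoff at 1 is dropped). *)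
Let ker1 u v (z : R * R) : R :=
  ind u v z.1 * ((z.2 < u)%R%:R * pospow (- 1 - a) (z.1 - z.2)).
Let ker2 u v (z : R * R) : R :=
  ind u v z.2 * ((v <= z.1)%R%:R * pospow (- 1 - a) (z.1 - z.2)).

Let normr_mker_ind u v z : `|mker a (ind u v) z| <= ker1 u v z + ker2 u v z.
Proof.
have p0 : 0 <= pospow (- 1 - a) (z.1 - z.2) by exact: pospow_ge0.
have k10 : 0 <= ker1 u v z by rewrite /ker1 !mulr_ge0.
have k20 : 0 <= ker2 u v z by rewrite /ker2 !mulr_ge0.
rewrite /mker; case: (z.1 <= 1)%R; last by rewrite mulr0 normr0 addr_ge0.
rewrite mulr1.
have [z12|z12] := leP z.1 z.2.
  by rewrite pospow_le0 ?subr_le0// mulr0 normr0 addr_ge0.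
rewrite normrM (ger0_norm p0) /ker1 /ker2 !mulrA -mulrDl ler_wpM2r//.
rewrite /ind.
case: (leP u z.1) => h1; case: (ltP z.1 v) => h2; case: (leP u z.2) => h3;
  case: (ltP z.2 v) => h4 //=; rewrite ?(mul0r, mulr0, mul1r, mulr1, addr0, add0r,
  subrr, subr0, sub0r, normrN, normr0, normr1)//; try lra.
Qed.

Lemma integral_below u x : u < x ->
  (\int[mu]_y ((y < u)%R%:R * pospow (- 1 - a) (x - y))%:E =
   (a^-1 * pospow (- a) (x - u))%:E)%E.
Proof.
move=> ux; have xu : 0 < x - u by rewrite subr_gt0.
pose h t := pospow (- 1 - a) t * (x - u < t)%R%:R.
have mh : measurable_fun [set: R] (fun x => (h x)%:E).
  apply/measurable_EFinP; apply: measurable_funM; first exact: measurable_pospow.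
  exact: measurable_ltlr.
have h0 t : (0 <= (h t)%:E)%E by rewrite lee_fin !mulr_ge0 ?pospow_ge0.
have := ge0_integral_reflect x mh h0.
rewrite /h integral_pospow_tail// => E.
rewrite pospowE// mulrC -E; apply: eq_integral => y _; congr EFin.
by rewrite mulrC ltrD2l ltrN2.
Qed.

Lemma integral_above v y : y < v ->
  (\int[mu]_x ((v <= x)%R%:R * pospow (- 1 - a) (x - y))%:E =
   (a^-1 * pospow (- a) (v - y))%:E)%E.
Proof.
move=> yv; have vy : 0 < v - y by rewrite subr_gt0.
pose h t := pospow (- 1 - a) t * (v - y <= t)%R%:R.
have mh : measurable_fun [set: R] (fun x => (h x)%:E).
  apply/measurable_EFinP; apply: measurable_funM; first exact: measurable_pospow.
  by apply: measurable_nat_of_bool; exact: measurable_fun_ler.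
have h0 t : (0 <= (h t)%:E)%E by rewrite lee_fin !mulr_ge0 ?pospow_ge0.
have := ge0_integral_shift (- y) mh h0.
rewrite /h integral_pospow_tailc// => E.
rewrite pospowE// mulrC -E; apply: eq_integral => x _; congr EFin.
by rewrite mulrC lerD2r.
Qed.

Let measurable_ker1 u v : measurable_fun [set: R * R] (ker1 u v).
Proof.
apply: measurable_funM.
  by apply: (measurableT_comp (measurable_ind u v)); exact: measurable_fst.
apply: measurable_funM.
  apply: (measurableT_comp (measurable_ltrr u)); exact: measurable_snd.
apply: (measurableT_comp (measurable_pospow _)).
by apply: measurable_funB; [exact: measurable_fst|exact: measurable_snd].
Qed.

Let measurable_ker2 u v : measurable_fun [set: R * R] (ker2 u v).
Proof.
apply: measurable_funM.
  by apply: (measurableT_comp (measurable_ind u v)); exact: measurable_snd.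
apply: measurable_funM.
  apply: measurable_nat_of_bool; apply: measurable_fun_ler => //.
apply: (measurableT_comp (measurable_pospow _)).
by apply: measurable_funB; [exact: measurable_fst|exact: measurable_snd].
Qed.

Let ker1_ge0 u v z : 0 <= ker1 u v z.
Proof. by rewrite !mulr_ge0 ?pospow_ge0. Qed.

Let ker2_ge0 u v z : 0 <= ker2 u v z.
Proof. by rewrite !mulr_ge0 ?pospow_ge0. Qed.

Let integral_ker1 u v : u <= v ->
  (\int[mu2]_z (ker1 u v z)%:E <= (((v - u) `^ (1 - a)) / (a * (1 - a)))%:E)%E.
Proof.
move=> uv; have uv0 : 0 <= v - u by rewrite subr_ge0.
have mk : measurable_fun setT (fun z => (ker1 u v z)%:E).
  by apply/measurable_EFinP; exact: measurable_ker1.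
have k0 z : (0 <= (ker1 u v z)%:E)%E by rewrite lee_fin.
rewrite (@fubini_tonelli1 _ _ _ _ _ mu mu _ mk k0) /fubini_F.
have mF := @measurable_fun_fubini_tonelli_F _ _ _ _ _ mu _ mk k0.
pose h t := a^-1 * (pospow ((1 - a) - 1) t * (t < v - u)%R%:R).
have mh' : measurable_fun [set: R]
    (fun t => (pospow ((1 - a) - 1) t * (t < v - u)%R%:R)).
  apply: measurable_funM; first exact: measurable_pospow.
  exact: measurable_ltrr.
have mh : measurable_fun [set: R] (fun t => (h t)%:E).
  by apply/measurable_EFinP; apply: measurable_funM.
have h0 t : (0 <= (h t)%:E)%E.
  by rewrite lee_fin mulr_ge0 ?invr_ge0 ?(ltW a0)// mulr_ge0 ?pospow_ge0.
have Eh : (\int[mu]_x (h x)%:E = (a^-1 * ((v - u) `^ (1 - a) / (1 - a)))%:E)%E.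
  rewrite /h ge0_integralMl ?invr_ge0 ?(ltW a0)//; last first.
    by move=> x; rewrite mulr_ge0 ?pospow_ge0.
  by rewrite integral_pospow_head// -EFinM.
have := ge0_integral_shift (- u) mh h0; rewrite Eh => E.
rewrite mulrC invfM -mulrA [X in a^-1 * X]mulrC -E.
(* At x = u the inner integral diverges, so this null point is removed on both sides. *)
rewrite -(@integral_setD1 _ _ u setT)//; last 2 first.
- by apply: measurableD.
- exact: measurable_funS mF.
rewrite -[leRHS](@integral_setD1 _ _ u setT)//; last 2 first.
- by apply: measurableD.
- apply: (@measurable_funS _ _ _ _ setT) => //.
  by apply: (measurableT_comp mh); apply: measurable_funB.
apply: ge0_le_integral => //.
- by apply: measurableD.
- by move=> x _; exact: integral_ge0.
- exact: measurable_funS mF.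
- apply: (@measurable_funS _ _ _ _ setT) => //.
  by apply: (measurableT_comp mh); apply: measurable_funB.
- move=> x [_ /eqP xu]; rewrite /ker1 /=.
  rewrite ge0_integralMl//; last 2 first.
  + apply: measurable_funM; first exact: measurable_ltrr.
    by apply: (measurableT_comp (measurable_pospow _)); apply: measurable_funB.
  + by move=> y; rewrite mulr_ge0 ?pospow_ge0.
  rewrite /ind; case: (leP u x) => ux; last by rewrite mul0e.
  have {}ux : u < x by rewrite lt_neqAle ux eq_sym xu.
  rewrite integral_below// -EFinM lee_fin /h ltrD2r.
  have -> : 1 - a - 1 = - a by ring.
  by rewrite mulrC mulrA.
Qed.

Let integral_ker2 u v : u <= v ->
  (\int[mu2]_z (ker2 u v z)%:E <= (((v - u) `^ (1 - a)) / (a * (1 - a)))%:E)%E.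
Proof.
move=> uv; have uv0 : 0 <= v - u by rewrite subr_ge0.
have mk : measurable_fun setT (fun z => (ker2 u v z)%:E).
  by apply/measurable_EFinP; exact: measurable_ker2.
have k0 z : (0 <= (ker2 u v z)%:E)%E by rewrite lee_fin.
rewrite (@fubini_tonelli2 _ _ _ _ _ mu mu _ mk k0) /fubini_G.
pose h t := a^-1 * (pospow ((1 - a) - 1) t * (t <= v - u)%R%:R).
have mh' : measurable_fun [set: R]
    (fun t => (pospow ((1 - a) - 1) t * (t <= v - u)%R%:R)).
  apply: measurable_funM; first exact: measurable_pospow.
  by apply: measurable_nat_of_bool; exact: measurable_fun_ler.
have mh : measurable_fun [set: R] (fun t => (h t)%:E).
  by apply/measurable_EFinP; apply: measurable_funM.
have h0 t : (0 <= (h t)%:E)%E.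
  by rewrite lee_fin mulr_ge0 ?invr_ge0 ?(ltW a0)// mulr_ge0 ?pospow_ge0.
have Eh : (\int[mu]_x (h x)%:E = (a^-1 * ((v - u) `^ (1 - a) / (1 - a)))%:E)%E.
  rewrite /h ge0_integralMl ?invr_ge0 ?(ltW a0)//; last first.
    by move=> x; rewrite mulr_ge0 ?pospow_ge0.
  by rewrite integral_pospow_headc// -EFinM.
have := ge0_integral_reflect v mh h0; rewrite Eh => E.
rewrite mulrC invfM -mulrA [X in a^-1 * X]mulrC -E.
rewrite le_eqVlt; apply/orP; left; apply/eqP.
apply: eq_integral => y _; rewrite /ker2 /=.
rewrite ge0_integralMl//; last 2 first.
- apply: measurable_funM.
    by apply: measurable_nat_of_bool; exact: measurable_fun_ler.
  by apply: (measurableT_comp (measurable_pospow _)); apply: measurable_funB.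
- by move=> x; rewrite mulr_ge0 ?pospow_ge0.
rewrite /ind; case: (ltP y v) => yv; last first.
  by rewrite andbF mul0e /h pospow_le0 ?subr_le0// mul0r mulr0.
rewrite integral_above// -EFinM andbT /h lerD2l lerN2.
have -> : 1 - a - 1 = - a by ring.
by rewrite mulrC mulrA.
Qed.

(** Each of the two kernels integrates, up to 1 / a, the distance to an end of the interval to the
    power - a. The resulting power 1 - a of the length is what the summation over dyadic cells
    relies on. *)
Lemma fnorm_ind u v : u <= v ->
  (fnorm a (ind u v) <= (2 / (a * (1 - a)) * (v - u) `^ (1 - a))%:E)%E.
Proof.
move=> uv.
apply: (@le_trans _ _ (\int[mu2]_z (ker1 u v z + ker2 u v z)%:E)%E).
  apply: le_integral_EFin => //.
  - apply: measurableT_comp => //; apply: measurable_mker.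
    exact: measurable_ind.
  - by apply: measurable_funD; [exact: measurable_ker1|exact: measurable_ker2].
rewrite ge0_integralDr//; last 2 first.
- exact: measurable_ker1.
- exact: measurable_ker2.
have -> : 2 / (a * (1 - a)) * (v - u) `^ (1 - a) =
  (v - u) `^ (1 - a) / (a * (1 - a)) + (v - u) `^ (1 - a) / (a * (1 - a)).
  by rewrite mulrAC mulr_natl mulr2n mulrDl.
by rewrite EFinD; apply: leeD; [exact: integral_ker1|exact: integral_ker2].
Qed.

(** For x in ]u, 1[ the only nonzero differences are those with y < u, and they integrate to the
    Abel kernel. At x = u the integral would diverge; [A 1 = 0] disposes of x = 1, where the
    indicator has dropped to 0 but the kernel is still active. *)
Lemma integral_mker_ind1 A u x : A 1 = 0 -> 0 <= u -> x != u ->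
  (\int[mu]_y (mker a (ind u 1) (x, y) * A x)%:E =
   (a^-1 * (pospow (- a) (x - u) * (x < 1)%R%:R * A x))%:E)%E.
Proof.
move=> A1 u0 xu; rewrite /mker /=.
have [x1|x1] := ltP x 1; last first.
  rewrite mulr0 mul0r mulr0; apply: integral0_eq => y _.
  have [xe|xn] := eqVneq x 1; first by rewrite xe A1 mulr0.
  by rewrite leNgt lt_neqAle eq_sym xn x1 /= mulr0 mul0r.
rewrite (ltW x1) mulr1.
have [ux|ux] := ltP u x; last first.
  rewrite pospow_le0 ?subr_le0// mul0r mulr0; apply: integral0_eq => y _.
  have {}ux : x < u by rewrite lt_neqAle xu.
  have [xy|xy] := leP x y; first by rewrite pospow_le0 ?subr_le0// mulr0 !mul0r.
  by rewrite /ind !leNgt ux (lt_trans xy ux) /= subrr !mul0r.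
transitivity (\int[mu]_y ((A x)%:E * ((y < u)%R%:R * pospow (- 1 - a) (x - y))%:E))%E.
  apply: eq_integral => y _; rewrite -EFinM; congr EFin.
  rewrite mulr1 mulrC; congr (_ * _).
  have [xy|xy] := leP x y; first by rewrite pospow_le0 ?subr_le0// !mulr0.
  congr (_ * _); rewrite /ind (ltW ux) x1 (lt_trans xy x1) andbT.
  by case: ltP; rewrite /= ?subr0 ?subrr.
rewrite integralZl//; last first.
  apply/integrableP; split.
    apply/measurable_EFinP; apply: measurable_funM; first exact: measurable_ltrr.
    by apply: (measurableT_comp (measurable_pospow _)); apply: measurable_funB.
  under eq_integral do rewrite /= ger0_norm ?mulr_ge0 ?pospow_ge0//.
  by rewrite integral_below// ltry.
by rewrite integral_below// -EFinM; congr EFin; ring.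
Qed.

End indicators.
End frac_class.

(** * Abel inversion *)

Section abel_inversion.
Context {R : realType}.
Local Notation mu := (@lebesgue_measure R).
Local Notation mu2 := (mu \x mu)%E.
Implicit Types (b c p q r s t u x y : R).

Lemma integral_affine b c (h : R -> \bar R) : b != 0 ->
  measurable_fun [set: R] h -> mu.-integrable setT h ->
  (\int[mu]_x h (b * x + c)%R = (`|b|^-1)%:E * \int[mu]_x h x)%E.
Proof.
move=> b0 mh ih.
rewrite [in RHS]integralE [in LHS]integralE.
have E1 := ge0_integral_affine c b0 (measurable_funepos mh) (funepos_ge0 h).
have E2 := ge0_integral_affine c b0 (measurable_funeneg mh) (funeneg_ge0 h).
transitivity (\int[mu]_x h^\+ (b * x + c)%R - \int[mu]_x h^\- (b * x + c)%R)%E.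
  by congr (_ - _)%E; apply: eq_integral => x _; rewrite ?funeposE ?funenegE.
rewrite E1 E2.
have D : (\int[mu]_x h^\+ x +? - \int[mu]_x h^\- x)%E.
  by apply: fin_num_adde_defr; exact: integrable_pos_fin_num.
by apply/esym; apply: muleBr.
Qed.

Lemma measurable_prod_ltr : measurable_fun [set: R * R] (fun z => (z.1 < z.2)%R%:R : R).
Proof.
apply: (measurableT_comp (f := fun b : bool => b%:R : R)) => //.
by apply: measurable_fun_ltr; [exact: measurable_fst|exact: measurable_snd].
Qed.

Lemma holder_continuous (H : R -> R) C th : 0 <= C -> 0 < th ->
  (forall x y, `|H x - H y| <= C * `|x - y| `^ th) -> continuous H.
Proof.
move=> C0 th0 Hhol x; apply/cvgrPdist_lt => e e0.
have c0 : 0 < e / (C + 1) by rewrite divr_gt0// ltr_wpDl.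
have d0 : 0 < (e / (C + 1)) `^ th^-1 by rewrite powR_gt0.
near=> y; apply: le_lt_trans (Hhol x y) _.
have xy : `|x - y| `^ th <= e / (C + 1).
  have E : e / (C + 1) = ((e / (C + 1)) `^ th^-1) `^ th.
    by rewrite -powRrM mulVf ?gt_eqF// powRr1// ltW.
  have h : `|x - y| <= (e / (C + 1)) `^ th^-1.
    by apply: ltW; near: y; exact: cvgr_dist_lt.
  by rewrite [leRHS]E; apply: ge0_ler_powR => //; rewrite ?nnegrE//; exact: ltW.
apply: (@le_lt_trans _ _ (C * (e / (C + 1)))); first by rewrite ler_wpM2l.
by rewrite mulrA ltr_pdivrMr ?ltr_wpDl// mulrC ltr_pM2l// ltrDl.
Unshelve. all: by end_near. Qed.

Lemma integrable_fubini_G (f : R * R -> \bar R) :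
  mu2.-integrable setT f -> mu.-integrable setT (fubini_G mu f).
Proof.
move=> i; have mf := measurable_int _ i.
apply/integrableP; split; first exact: (measurable_fubini_G i).
apply: (@le_lt_trans _ _ (\int[mu]_y \int[mu]_x `|f (x, y)|)%E); last first.
  exact/integrable21ltyP.
apply: ge0_le_integral => //.
- by apply: measurableT_comp => //; exact: (measurable_fubini_G i).
- by apply: (@measurable_fun_fubini_tonelli_G _ _ _ _ _ mu (fun z => `|f z|%E)) => //;
    exact: measurableT_comp.
- move=> y _; apply: le_abse_integral => //.
  exact: (measurableT_comp mf (pair2_measurable y)).
Qed.

(* [ab_ker a H u d] is the integrand of the composition of the Abel kernel of
   order a with a Marchaud derivative whose singularity is shifted by d. *)
Definition ab_ker a (H : R -> R) u d (z : R * R) : R :=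
  pospow (- a) (z.1 - u) * (z.1 < 1)%R%:R *
  ((H z.1 - H z.2) * ((z.1 < z.2)%R%:R * pospow (a - 2) (z.2 - z.1 + d))).

Section fixed.
Variables (a K C th u : R) (H : R -> R).
Hypotheses (a01 : 0 < a < 1) (th_gt : 1 - a < th) (C0 : 0 <= C).
Hypotheses (mH : measurable_fun [set: R] H) (HK : forall x, `|H x| <= K).
Hypothesis H1 : forall x, 1 <= x -> H x = 0.
Hypothesis Hhol : forall x y, `|H x - H y| <= C * `|x - y| `^ th.

Let a0 : 0 < a. Proof. by case/andP: a01. Qed.
Let a1 : 0 < 1 - a. Proof. by case/andP: a01 => _; rewrite subr_gt0. Qed.
Let K0 : 0 <= K. Proof. exact: le_trans (normr_ge0 _) (HK 0). Qed.

Let measurable_diff : measurable_fun [set: R * R] (fun z => z.2 - z.1).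
Proof. by apply: measurable_funB; [exact: measurable_snd|exact: measurable_fst]. Qed.

Let measurable_left : measurable_fun [set: R * R]
  (fun z => pospow (- a) (z.1 - u) * (z.1 < 1)%R%:R).
Proof.
apply: measurable_funM.
  apply: (measurableT_comp (measurable_pospow _)).
  by apply: measurable_funB => //; exact: measurable_fst.
by apply: (measurableT_comp (measurable_ltrr 1)); exact: measurable_fst.
Qed.

Let measurable_right d : measurable_fun [set: R * R]
  (fun z => (z.1 < z.2)%R%:R * pospow (a - 2) (z.2 - z.1 + d)).
Proof.
apply: measurable_funM; first exact: measurable_prod_ltr.
apply: (measurableT_comp (measurable_pospow _)).
by apply: measurable_funD.
Qed.

Lemma measurable_ab_ker d : measurable_fun [set: R * R] (ab_ker a H u d).
Proof.
apply: measurable_funM; first exact: measurable_left.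
apply: measurable_funM; last exact: measurable_right.
apply: measurable_funB; apply: (measurableT_comp mH).
  exact: measurable_fst.
exact: measurable_snd.
Qed.

(** The integral of C t^(th + a - 2) over ]0, 1] plus that of 2 K t^(a - 2) over t > 1: the Hölder
    bound near the singularity, the uniform bound away from it. *)
Definition marchaud_bound := C / (th - (1 - a)) + (K + K) / (1 - a).

Lemma marchaud_bound_ge0 : 0 <= marchaud_bound.
Proof.
apply: addr_ge0; apply: divr_ge0 => //; first by rewrite ltW// subr_gt0.
  by rewrite addr_ge0.
exact: ltW.
Qed.

Lemma integral_marchaud_le x :
  (\int[mu]_y (`|(H x - H y) * pospow (a - 2) (y - x)|)%:E <= marchaud_bound%:E)%E.
Proof.
pose g1 t := C * (pospow ((th - (1 - a)) - 1) t * (t <= 1)%R%:R).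
pose g2 t := (K + K) * (pospow (- 1 - (1 - a)) t * (1 < t)%R%:R).
have mg1 : measurable_fun [set: R] g1.
  apply: measurable_funM => //; apply: measurable_funM; first exact: measurable_pospow.
  by apply: measurable_nat_of_bool; exact: measurable_fun_ler.
have mg2 : measurable_fun [set: R] g2.
  apply: measurable_funM => //; apply: measurable_funM; first exact: measurable_pospow.
  exact: measurable_ltlr.
have g10 t : 0 <= g1 t by rewrite mulr_ge0// mulr_ge0 ?pospow_ge0.
have g20 t : 0 <= g2 t by rewrite mulr_ge0 ?addr_ge0// mulr_ge0 ?pospow_ge0.
have mg : measurable_fun [set: R] (fun t => (g1 t + g2 t)%:E).
  by apply/measurable_EFinP; exact: measurable_funD.
have g0 t : (0 <= (g1 t + g2 t)%:E)%E by rewrite lee_fin addr_ge0.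
apply: (@le_trans _ _ (\int[mu]_y (g1 (y + - x) + g2 (y + - x))%:E)%E).
  apply: le_integral_EFin => //.
  - apply: measurableT_comp => //.
    apply: measurable_funM; first by apply: measurable_funB.
    by apply: (measurableT_comp (measurable_pospow _)); apply: measurable_funB.
  - by apply: measurable_funD; [apply: (measurableT_comp mg1)|
      apply: (measurableT_comp mg2)]; apply: measurable_funD.
  - move=> y; rewrite normrM (ger0_norm (pospow_ge0 _ _)).
    have [yx|yx] := leP y x.
      by rewrite pospow_le0 ?subr_le0// mulr0 addr_ge0.
    have yx0 : 0 < y - x by rewrite subr_gt0.
    rewrite /g1 /g2 !pospowE//; case: (leP (y - x) 1) => t1; last first.
      rewrite !mulr0 add0r mulr1; have -> : - 1 - (1 - a) = a - 2 by ring.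
      rewrite ler_wpM2r ?powR_ge0// (le_trans (ler_normB _ _))//.
      by rewrite lerD.
    rewrite !mulr0 addr0 mulr1.
    have -> : th - (1 - a) - 1 = th + (a - 2) by ring.
    rewrite (@powRD _ (y - x) th) ?(gt_eqF yx0) ?implybT// mulrA ler_wpM2r ?powR_ge0//.
    by rewrite (le_trans (Hhol _ _))// distrC gtr0_norm.
have thb : 0 < th - (1 - a) by rewrite subr_gt0.
rewrite (ge0_integral_shift (- x) mg g0) ge0_integralDr// /g1 /g2.
rewrite ge0_integralMl//; last 2 first.
- apply: measurable_funM; first exact: measurable_pospow.
  by apply: measurable_nat_of_bool; exact: measurable_fun_ler.
- by move=> t; rewrite mulr_ge0 ?pospow_ge0.
rewrite ge0_integralMl ?addr_ge0//; last 2 first.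
- apply: measurable_funM; first exact: measurable_pospow.
  exact: measurable_ltlr.
- by move=> t; rewrite mulr_ge0 ?pospow_ge0.
rewrite integral_pospow_headc// integral_pospow_tail// !powR1 -!EFinM -EFinD lee_fin.
by rewrite /marchaud_bound !mul1r.
Qed.

Let normr_left x : `|pospow (- a) (x - u) * (x < 1)%R%:R| =
  pospow (- a) (x - u) * (x < 1)%R%:R.
Proof. by rewrite ger0_norm// mulr_ge0 ?pospow_ge0. Qed.

Lemma integral_left_lty :
  (\int[mu]_x (pospow (- a) (x - u) * (x < 1)%R%:R)%:E < +oo)%E.
Proof.
have [u1|u1] := ltP u 1; last first.
  rewrite integral0_eq// => x _; case: (ltP x 1) => x1; last by rewrite mulr0.
  by rewrite pospow_le0 ?mul0r// subr_le0 ltW// (lt_le_trans x1).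
pose h x := pospow ((1 - a) - 1) x * (x < 1 - u)%R%:R.
have mh : measurable_fun [set: R] (fun x => (h x)%:E).
  apply/measurable_EFinP; apply: measurable_funM; first exact: measurable_pospow.
  exact: measurable_ltrr.
have h0 x : (0 <= (h x)%:E)%E by rewrite lee_fin mulr_ge0 ?pospow_ge0.
have := ge0_integral_shift (- u) mh h0.
rewrite /h integral_pospow_head// ?subr_ge0 1?ltW// => E.
apply: le_lt_trans (ltry ((1 - u) `^ (1 - a) / (1 - a))).
rewrite -E le_eqVlt; apply/orP; left; apply/eqP.
apply: eq_integral => x _; congr (_ _ _)%:E.
  by have -> : 1 - a - 1 = - a by ring.
by rewrite ltrD2r.
Qed.

Lemma integrable_ab_ker0 : mu2.-integrable setT (EFin \o ab_ker a H u 0).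
Proof.
apply/integrable12ltyP.
  by apply/measurable_EFinP; exact: measurable_ab_ker.
apply: (@le_lt_trans _ _
    (\int[mu]_x (marchaud_bound * (pospow (- a) (x - u) * (x < 1)%R%:R))%:E)%E).
  apply: ge0_le_integral => //.
  - by move=> x _; exact: integral_ge0.
  - apply: (@measurable_fun_fubini_tonelli_F _ _ _ _ _ mu
      (fun z => `|(EFin \o ab_ker a H u 0) z|%E)) => //.
    apply: measurableT_comp => //; apply/measurable_EFinP.
    exact: measurable_ab_ker.
  - apply/measurable_EFinP; apply: measurable_funM => //.
    apply: measurable_funM; last exact: measurable_ltrr.
    by apply: (measurableT_comp (measurable_pospow _)); apply: measurable_funB.
  - move=> x _.
    have -> : (\int[mu]_y `|(EFin \o ab_ker a H u 0) (x, y)| =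
       \int[mu]_y ((pospow (- a) (x - u) * (x < 1)%R%:R) *
         `|(H x - H y) * pospow (a - 2) (y - x)|)%:E)%E.
      apply: eq_integral => y _; rewrite /ab_ker/= normrM normr_left addr0.
      congr (_ * `|_ * _|)%:E; case: ltP => xy; rewrite ?mul1r// mul0r.
      by rewrite pospow_le0// subr_le0.
    rewrite ge0_integralMl//; last 2 first.
    + by rewrite mulr_ge0 ?pospow_ge0.
    + apply: measurableT_comp => //; apply: measurable_funM.
        exact: measurable_funB.
      by apply: (measurableT_comp (measurable_pospow _)); apply: measurable_funB.
    rewrite [leRHS]EFinM muleC lee_wpmul2r ?integral_marchaud_le// lee_fin.
    by rewrite mulr_ge0 ?pospow_ge0.
rewrite ge0_integralMl//; last 3 first.
- exact: marchaud_bound_ge0.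
- apply: measurable_funM; last exact: measurable_ltrr.
  by apply: (measurableT_comp (measurable_pospow _)); apply: measurable_funB.
- by move=> x; rewrite mulr_ge0 ?pospow_ge0.
by rewrite lte_mul_pinfty ?lee_fin ?marchaud_bound_ge0// integral_left_lty.
Qed.

(** As [a - 2] is negative, shifting the singularity only decreases the kernel in absolute value, so
    the unshifted kernel dominates. *)
Lemma cvg_ab_ker (e : R^nat) : (forall n, 0 < e n) -> e @ \oo --> 0 ->
  (\int[mu2]_z (ab_ker a H u (e n) z)%:E @[n --> \oo] -->
   \int[mu2]_z (ab_ker a H u 0 z)%:E)%E.
Proof.
move=> e0 ecvg.
have [] := @dominated_convergence _ _ _ mu2 setT measurableT
  (fun n z => (ab_ker a H u (e n) z)%:E) (fun z => (ab_ker a H u 0 z)%:E)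
  (fun z => `|(ab_ker a H u 0 z)%:E|%E).
- by move=> n; apply/measurable_EFinP; exact: measurable_ab_ker.
- by apply/measurable_EFinP; exact: measurable_ab_ker.
- apply: aeW => z _; apply: cvg_EFin; first exact: nearW.
  rewrite /ab_ker /=; apply: cvgMr; apply: cvgMr.
  case: (ltP z.1 z.2) => z12; last first.
    by rewrite mul0r; under eq_cvg do rewrite mul0r; exact: cvg_cst.
  apply: cvgMr; rewrite addr0 pospowE ?subr_gt0//.
  have E n : pospow (a - 2) (z.2 - z.1 + e n) = (z.2 - z.1 + e n) `^ (a - 2).
    by rewrite pospowE// addr_gt0// subr_gt0.
  under eq_cvg do rewrite E.
  apply: (@cvg_comp _ _ _ (fun n => z.2 - z.1 + e n) (@powR R ^~ (a - 2)) _
    (nbhs (z.2 - z.1))).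
    have h : (fun n => z.2 - z.1 + e n) @ \oo --> z.2 - z.1 + 0.
      by apply: cvgD => //; exact: cvg_cst.
    by rewrite addr0 in h.
  by apply: continuous_powR; rewrite subr_gt0.
- exact: (integrable_abse integrable_ab_ker0).
- apply: aeW => z n _; rewrite lee_fin /ab_ker !normrM addr0.
  case: (ltP z.1 z.2) => z12; last by rewrite normr0 !mul0r !mulr0.
  have z0 : 0 < z.2 - z.1 by rewrite subr_gt0.
  have z0' : 0 < z.2 - z.1 + e n by rewrite addr_gt0.
  rewrite ler_wpM2l ?mulr_ge0// ler_wpM2l// ler_wpM2l// !pospowE//.
  rewrite !ger0_norm ?powR_ge0//.
  have -> : a - 2 = - (2 - a) by ring.
  rewrite !powRN lef_pV2 ?posrE ?powR_gt0//.
  apply: ge0_ler_powR; rewrite ?nnegrE ?(ltW z0) ?(ltW z0')//.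
    by move/andP: a01 => [_ h]; lra.
  by rewrite lerDl ltW.
by [].
Qed.

Lemma integral_abel_kernel_shift y d : 0 < d ->
  (\int[mu]_x (pospow (- a) (x - u) *
       ((x < y)%R%:R * pospow (a - 2) (y - x + d)))%:E =
   (pospow (1 - a) (y - u) * d `^ (a - 1) / ((1 - a) * (y - u + d)))%:E)%E.
Proof.
move=> d0; have [uy|uy] := ltP u y; last first.
  rewrite (pospow_le0 _ (_ : y - u <= 0)) ?subr_le0// !mul0r.
  apply: integral0_eq => x _; case: (ltP x y) => xy; last by rewrite mul0r mulr0.
  by rewrite pospow_le0 ?mul0r// subr_le0 ltW// (lt_le_trans xy).
have yu0 : 0 < y - u by rewrite subr_gt0.
pose h x := pospow (- a) x * (x < y - u)%R%:R * (y - u - x + d) `^ (a - 2).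
have mh : measurable_fun [set: R] (fun x => (h x)%:E).
  apply/measurable_EFinP; apply: measurable_funM.
    by apply: measurable_funM; [exact: measurable_pospow|exact: measurable_ltrr].
  apply: (measurableT_comp (@measurable_powR _ _)).
  by apply: measurable_funD => //; apply: measurable_funB.
have h0 x : (0 <= (h x)%:E)%E by rewrite lee_fin !mulr_ge0 ?pospow_ge0 ?powR_ge0.
have := ge0_integral_shift (- u) mh h0.
rewrite /h integral_abel_kernel// => E.
rewrite pospowE// -E; apply: eq_integral => x _; congr EFin.
rewrite ltrD2r -mulrA; have -> : y - u - (x - u) + d = y - x + d by ring.
case: ltP => xy; last by rewrite !mul0r mulr0.
by rewrite (@pospowE _ (a - 2))// addr_gt0// subr_gt0.
Qed.

Lemma integral_tail_shift x d : 0 < d ->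
  (\int[mu]_y ((x < y)%R%:R * pospow (a - 2) (y - x + d))%:E =
   (d `^ (a - 1) / (1 - a))%:E)%E.
Proof.
move=> d0.
pose h t := pospow (- 1 - (1 - a)) t * (d < t)%R%:R.
have mh : measurable_fun [set: R] (fun x => (h x)%:E).
  apply/measurable_EFinP; apply: measurable_funM; first exact: measurable_pospow.
  exact: measurable_ltlr.
have h0 t : (0 <= (h t)%:E)%E by rewrite lee_fin !mulr_ge0 ?pospow_ge0.
have := ge0_integral_shift (- x + d) mh h0.
rewrite /h integral_pospow_tail// opprB => <-; apply: eq_integral => y _.
congr EFin; rewrite mulrC; have -> : y + (- x + d) = y - x + d by ring.
have -> : (d < y - x + d) = (x < y) by apply/idP/idP => ?; lra.
by congr (pospow _ _ * _); ring.
Qed.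

(** The two halves of the difference in [ab_ker]. For [d > 0] each is integrable by itself; at
    [d = 0] only their difference is under control. *)
Let ab_ker1 d (z : R * R) : R :=
  pospow (- a) (z.1 - u) * (z.1 < 1)%R%:R *
  (H z.1 * ((z.1 < z.2)%R%:R * pospow (a - 2) (z.2 - z.1 + d))).

Let ab_ker2 d (z : R * R) : R :=
  pospow (- a) (z.1 - u) * (z.1 < 1)%R%:R *
  (H z.2 * ((z.1 < z.2)%R%:R * pospow (a - 2) (z.2 - z.1 + d))).

Let ab_kerE d z : ab_ker a H u d z = ab_ker1 d z - ab_ker2 d z.
Proof. by rewrite /ab_ker /ab_ker1 /ab_ker2; ring. Qed.

Let measurable_ab_ker1 d : measurable_fun [set: R * R] (ab_ker1 d).
Proof.
apply: measurable_funM; first exact: measurable_left.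
apply: measurable_funM; last exact: measurable_right.
by apply: (measurableT_comp mH); exact: measurable_fst.
Qed.

Let measurable_ab_ker2 d : measurable_fun [set: R * R] (ab_ker2 d).
Proof.
apply: measurable_funM; first exact: measurable_left.
apply: measurable_funM; last exact: measurable_right.
by apply: (measurableT_comp mH); exact: measurable_snd.
Qed.

Let integrable_bounded_ker d (k : R * R -> R) : 0 < d ->
  measurable_fun [set: R * R] k -> (forall z, `|k z| <= K) ->
  mu2.-integrable setT (fun z => (pospow (- a) (z.1 - u) * (z.1 < 1)%R%:R *
  (k z * ((z.1 < z.2)%R%:R * pospow (a - 2) (z.2 - z.1 + d))))%:E).
Proof.
move=> d0 mk kK; apply/integrable12ltyP.
  apply/measurable_EFinP; apply: measurable_funM; first exact: measurable_left.
  by apply: measurable_funM => //; exact: measurable_right.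
apply: (@le_lt_trans _ _
    (\int[mu]_x ((K * (d `^ (a - 1) / (1 - a))) * (pospow (- a) (x - u) * (x < 1)%R%:R))%:E)%E).
  apply: ge0_le_integral => //.
  - by move=> x _; exact: integral_ge0.
  - apply: (@measurable_fun_fubini_tonelli_F _ _ _ _ _ mu
      (fun z : R * R => `|(pospow (- a) (z.1 - u) * (z.1 < 1)%R%:R *
  (k z * ((z.1 < z.2)%R%:R * pospow (a - 2) (z.2 - z.1 + d))))%:E|%E)) => //.
    apply: measurableT_comp => //; apply/measurable_EFinP.
    apply: measurable_funM; first exact: measurable_left.
    by apply: measurable_funM => //; exact: measurable_right.
  - apply/measurable_EFinP; apply: measurable_funM => //.
    apply: measurable_funM; last exact: measurable_ltrr.
    by apply: (measurableT_comp (measurable_pospow _)); apply: measurable_funB.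
  - move=> x _.
    have mr : measurable_fun [set: R]
        (fun y => (x < y)%R%:R * pospow (a - 2) (y - x + d)).
      apply: measurable_funM; first exact: measurable_ltlr.
      by apply: (measurableT_comp (measurable_pospow _));
        apply: measurable_funD => //; apply: measurable_funB.
    apply: (@le_trans _ _ (\int[mu]_y ((pospow (- a) (x - u) * (x < 1)%R%:R) *
        (K * ((x < y)%R%:R * pospow (a - 2) (y - x + d))))%:E)%E).
      apply: le_integral_EFin.
      + apply: measurableT_comp => //;
        apply: (measurable_funM (measurable_cst (pospow (- a) (x - u) * (x < 1)%R%:R))).
        apply: measurable_funM => //.
        by apply: (measurableT_comp mk); exact: pair1_measurable.
      + by apply: measurable_funM => //; exact: measurable_funM.
      + by [].
      + move=> y; rewrite /= normrM normr_left ler_wpM2l ?mulr_ge0 ?pospow_ge0//.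
        rewrite normrM [X in _ * X]ger0_norm ?mulr_ge0 ?pospow_ge0//.
        by rewrite ler_wpM2r ?mulr_ge0 ?pospow_ge0.
    rewrite ge0_integralMl; first last.
    + by move=> y; rewrite mulr_ge0// mulr_ge0 ?pospow_ge0.
    + exact: measurable_funM.
    + by rewrite mulr_ge0 ?pospow_ge0.
    rewrite ge0_integralMl; first last.
    + by move=> y; rewrite mulr_ge0 ?pospow_ge0.
    + by [].
    + exact: K0.
    by rewrite integral_tail_shift// -!EFinM lee_fin mulrC.
have k0 : 0 <= K * (d `^ (a - 1) / (1 - a)).
  by rewrite mulr_ge0// divr_ge0 ?powR_ge0// ltW.
rewrite ge0_integralMl; first last.
- by move=> x; rewrite mulr_ge0 ?pospow_ge0.
- apply: measurable_funM; last exact: measurable_ltrr.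
  by apply: (measurableT_comp (measurable_pospow _)); apply: measurable_funB.
- exact: k0.
by rewrite lte_mul_pinfty ?lee_fin// integral_left_lty.
Qed.

Let H_lt1 x : (x < 1)%R%:R * H x = H x.
Proof. by case: ltP => [|/H1 ->]; rewrite ?mul1r ?mulr0. Qed.

(** The half with [H z.1] is integrated in y first, the half with [H z.2] in x first. They share the
    factor d^(a - 1) H(x) (x - u)^-a / (1 - a), and what remains is 1 - (x - u) / (x - u + d) = d /
    (x - u + d). *)
Lemma integral_ab_ker d : 0 < d ->
  (\int[mu2]_z (ab_ker a H u d z)%:E =
   \int[mu]_x (d `^ a / (1 - a) * (H x * pospow (- a) (x - u) / (x - u + d)))%:E)%E.
Proof.
move=> d0.
have i1 : mu2.-integrable setT (EFin \o ab_ker1 d).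
  apply: (@integrable_bounded_ker d (fun z => H z.1)) => //.
  by apply: (measurableT_comp mH); exact: measurable_fst.
have i2 : mu2.-integrable setT (EFin \o ab_ker2 d).
  apply: (@integrable_bounded_ker d (fun z => H z.2)) => //.
  by apply: (measurableT_comp mH); exact: measurable_snd.
pose h1 x := d `^ (a - 1) / (1 - a) * (H x * pospow (- a) (x - u)).
pose h2 x := H x * (pospow (1 - a) (x - u) * d `^ (a - 1) /
                     ((1 - a) * (x - u + d))).
have F1 x : (\int[mu]_y (ab_ker1 d (x, y))%:E = (h1 x)%:E)%E.
  rewrite /ab_ker1 /=.
  transitivity (\int[mu]_y ((H x * pospow (- a) (x - u))%:E *
     ((x < y)%R%:R * pospow (a - 2) (y - x + d))%:E))%E.
    apply: eq_integral => y _; rewrite -EFinM; congr EFin.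
    by rewrite -[in RHS](H_lt1 x); ring.
  rewrite integralZl//; last first.
    apply/integrableP; split.
      apply/measurable_EFinP; apply: measurable_funM; first exact: measurable_ltlr.
      by apply: (measurableT_comp (measurable_pospow _));
        apply: measurable_funD => //; apply: measurable_funB.
    under eq_integral do rewrite /= ger0_norm ?mulr_ge0 ?pospow_ge0//.
    by rewrite integral_tail_shift// ltry.
  by rewrite integral_tail_shift// -EFinM mulrC.
have F2 y : (\int[mu]_x (ab_ker2 d (x, y))%:E = (h2 y)%:E)%E.
  rewrite /ab_ker2 /=.
  transitivity (\int[mu]_x ((H y)%:E * (pospow (- a) (x - u) *
       ((x < y)%R%:R * pospow (a - 2) (y - x + d)))%:E))%E.
    apply: eq_integral => x _; rewrite -EFinM; congr EFin.
    case: (ltP y 1) => y1; last by rewrite H1// !(mul0r, mulr0).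
    case: (ltP x y) => xy; last by rewrite !(mul0r, mulr0).
    by rewrite (lt_trans xy y1) !mul1r mulr1; ring.
  rewrite integralZl//; last first.
    apply/integrableP; split.
      apply/measurable_EFinP; apply: measurable_funM.
        by apply: (measurableT_comp (measurable_pospow _)); apply: measurable_funB.
      apply: measurable_funM; first exact: measurable_ltrr.
      by apply: (measurableT_comp (measurable_pospow _));
        apply: measurable_funD => //; apply: measurable_funB.
    under eq_integral do rewrite /= ger0_norm ?mulr_ge0 ?pospow_ge0//.
    by rewrite integral_abel_kernel_shift// ltry.
  by rewrite integral_abel_kernel_shift// -EFinM.
transitivity (\int[mu2]_z ((ab_ker1 d z)%:E - (ab_ker2 d z)%:E))%E.
  by apply: eq_integral => z _; rewrite ab_kerE EFinB.
rewrite integralB_EFin//.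
have -> : (\int[mu2]_z (ab_ker1 d z)%:E = \int[mu]_x (h1 x)%:E)%E.
  by rewrite -(integral12_prod_meas1 i1); apply: eq_integral => x _; exact: F1.
have -> : (\int[mu2]_z (ab_ker2 d z)%:E = \int[mu]_x (h2 x)%:E)%E.
  by rewrite -(integral21_prod_meas1 i2); apply: eq_integral => x _; exact: F2.
have j1 : mu.-integrable setT (EFin \o h1).
  by have := integrable_fubini_F i1; apply: eq_integrable => // x _; exact: F1.
have j2 : mu.-integrable setT (EFin \o h2).
  by have := integrable_fubini_G i2; apply: eq_integrable => // x _; exact: F2.
rewrite -integralB_EFin// /h1 /h2.
apply: eq_integral => x _; rewrite -EFinB; congr EFin.
have [ux|ux] := ltP u x; last first.
  by rewrite !(@pospow_le0 _ _ (x - u)) ?subr_le0// !(mul0r, mulr0) subr0.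
have xu : 0 < x - u by rewrite subr_gt0.
have xud : x - u + d != 0 by rewrite gt_eqF// addr_gt0.
rewrite !pospowE//.
have -> : (x - u) `^ (1 - a) = (x - u) * (x - u) `^ (- a).
  by rewrite (@powRD _ (x - u) 1) ?(gt_eqF xu) ?implybT// powRr1// ltW.
have -> : d `^ a = d * d `^ (a - 1).
  rewrite -{2}(powRr1 (ltW d0)) -powRD ?(gt_eqF d0) ?implybT//.
  by congr (_ `^ _); ring.
by field; rewrite xud (gt_eqF a1).
Qed.

Let integrable_ebeta : mu.-integrable setT
  (fun w => (pospow (- a) w / (1 + w))%:E).
Proof.
apply/integrableP; split; first exact: measurable_ebeta.
under eq_integral do rewrite gee0_abs ?lee_fin ?ebeta_ge0//.
exact: ebeta_lty.
Qed.

(** The integrand found in [integral_ab_ker] after the change of variable x = u + d w. The weight is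
    now free of [d], which remains only in the argument of [H]. *)
Let scaled d w := (1 - a)^-1 * (H (d * w + u) * (pospow (- a) w / (1 + w))).

Let measurable_scaled d : measurable_fun [set: R] (fun w => (scaled d w)%:E).
Proof.
apply/measurable_EFinP; apply: measurable_funM => //; apply: measurable_funM.
  by apply: (measurableT_comp mH); apply: measurable_funD => //; exact: measurable_funM.
by apply/measurable_EFinP; exact: measurable_ebeta.
Qed.

Let scaled_le d w :
  (`|(scaled d w)%:E| <= ((1 - a)^-1 * K * (pospow (- a) w / (1 + w)))%:E)%E.
Proof.
rewrite lee_fin /scaled normrM gtr0_norm ?invr_gt0// -mulrA.
rewrite ler_wpM2l ?invr_ge0 ?(ltW a1)// normrM [X in _ * X]ger0_norm ?ebeta_ge0//.
by rewrite ler_wpM2r ?ebeta_ge0.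
Qed.

Let integrable_dom : mu.-integrable setT
  (fun w => ((1 - a)^-1 * K * (pospow (- a) w / (1 + w)))%:E).
Proof.
have := integrableZl measurableT ((1 - a)^-1 * K) integrable_ebeta.
by apply: eq_integrable => // w _; rewrite -EFinM.
Qed.

Let integrable_scaled d : mu.-integrable setT (fun w => (scaled d w)%:E).
Proof.
apply: le_integrable integrable_dom => //; first exact: measurable_scaled.
move=> w _.
by rewrite (le_trans (scaled_le d w))// lee_fin ler_norm.
Qed.

Lemma integral_ab_ker_scaled d : 0 < d ->
  (\int[mu2]_z (ab_ker a H u d z)%:E = \int[mu]_w (scaled d w)%:E)%E.
Proof.
move=> d0; rewrite integral_ab_ker//.
have dN0 : d^-1 != 0 by rewrite invr_eq0 gt_eqF.
have E := integral_affine (- (u / d)) dN0 (measurable_scaled d) (integrable_scaled d).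
transitivity (d^-1%:E * (d%:E * \int[mu]_w (scaled d w)%:E))%E; last first.
  by rewrite muleA -EFinM mulVf ?gt_eqF// mul1e.
rewrite gtr0_norm ?invr_gt0// invrK in E; rewrite -E.
have m' : measurable_fun [set: R] (fun x => (scaled d (d^-1 * x - u / d))%:E).
  apply: (measurableT_comp (measurable_scaled d)).
  by apply: measurable_funB => //; exact: measurable_funM.
have i' : mu.-integrable setT (fun x => (scaled d (d^-1 * x - u / d))%:E).
  apply/integrableP; split => //.
  have := ge0_integral_affine (- (u / d)) dN0
    (measurableT_comp (@abse_measurable R setT) (measurable_scaled d)).
  move=> /(_ (fun=> abse_ge0 _)) /= ->.
  have /integrableP[_ lty] := integrable_scaled d.
  by rewrite lte_mul_pinfty// lee_fin.
rewrite -integralZl//; apply: eq_integral => x _; rewrite -EFinM; congr EFin.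
have -> : d^-1 * x - u / d = (x - u) / d by rewrite mulrBl mulrC.
rewrite /scaled; have -> : d * ((x - u) / d) + u = x by field; rewrite gt_eqF.
have [ux|ux] := ltP u x; last first.
  rewrite !(@pospow_le0 _ _ (x - u)) ?subr_le0// pospow_le0 ?(mul0r, mulr0)//.
  by rewrite pmulr_lle0 ?invr_gt0// subr_le0.
have xu : 0 < x - u by rewrite subr_gt0.
rewrite !pospowE ?divr_gt0// powRM ?invr_ge0 ?(ltW xu) ?(ltW d0)//.
have -> : d^-1 `^ (- a) = d `^ a.
  by rewrite -powR_inv1 ?(ltW d0)// -powRrM mulN1r opprK.
by field; rewrite !gt_eqF// addr_gt0.
Qed.

(** As d tends to 0, H(d w + u) tends to H(u) by continuity and the fixed weight integrates to
    [ebeta a]. This is Abel's inversion: the Abel kernel of order a undoes the Marchaud derivative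
    of order 1 - a. *)
Lemma integral_ab_ker0 :
  (\int[mu2]_z (ab_ker a H u 0 z)%:E = ((1 - a)^-1 * H u)%:E * ebeta a)%E.
Proof.
pose e n : R := n.+1%:R^-1.
have e0 n : 0 < e n by rewrite invr_gt0.
have ecvg : e @ \oo --> 0 by exact: cvg_harmonic.
have c1 := cvg_ab_ker e0 ecvg.
have th0 : 0 < th by rewrite (lt_trans _ th_gt).
suff : (\int[mu2]_z (ab_ker a H u (e n) z)%:E @[n --> \oo] -->
    ((1 - a)^-1 * H u)%:E * ebeta a)%E.
  exact: (cvg_unique (@ereal_hausdorff R) c1).
under eq_cvg do rewrite integral_ab_ker_scaled//.
have [] := @dominated_convergence _ _ _ mu setT measurableT
  (fun n w => (scaled (e n) w)%:E)
  (fun w => ((1 - a)^-1 * H u * (pospow (- a) w / (1 + w)))%:E)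
  (fun w => ((1 - a)^-1 * K * (pospow (- a) w / (1 + w)))%:E).
- by move=> n; exact: measurable_scaled.
- have := measurable_funeM ((1 - a)^-1 * H u)%:E (measurable_ebeta a).
  by apply: eq_measurable_fun => w _; rewrite -EFinM.
- apply: aeW => w _; apply: cvg_EFin; first exact: nearW.
  rewrite /scaled -mulrA; apply: cvgMr; apply: cvgMl.
  apply: (@cvg_comp _ _ _ (fun n => e n * w + u) H _ (nbhs u)).
    have h : (fun n => e n * w + u) @ \oo --> 0 * w + u.
      by apply: cvgD; [apply: cvgMl|exact: cvg_cst].
    by rewrite mul0r add0r in h.
  exact: (holder_continuous C0 th0 Hhol).
- exact: integrable_dom.
- by apply: aeW => w n _; exact: scaled_le.
move=> _ _; rewrite /ebeta -(integralZl measurableT integrable_ebeta).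
by under eq_integral do rewrite EFinM.
Qed.

End fixed.
End abel_inversion.

(** * The right derivative of the integrator and the integrals of indicators *)

Section weyl_derivative.
Context {R : realType}.
Local Notation mu := (@lebesgue_measure R).
Local Notation mu2 := (mu \x mu)%E.
Implicit Types (b c p q r s t u x y : R) (f g : R -> R).

(** Integrability is not assumed: Tonelli's theorem covers the positive and the negative part
    separately. *)
Lemma measurable_integral_pair (k : R * R -> R) : measurable_fun [set: R * R] k ->
  measurable_fun [set: R] (fun x => \int[mu]_y (k (x, y))%:E)%E.
Proof.
move=> mk.
have mE : measurable_fun setT (EFin \o k) by exact/measurable_EFinP.
rewrite (_ : (fun x => _) = (fun x => \int[mu]_y (EFin \o k)^\+ (x, y) -
    \int[mu]_y (EFin \o k)^\- (x, y))%E); last first.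
  apply/funext => x; rewrite integralE.
  by congr (_ - _)%E; apply: eq_integral => y _; rewrite ?funeposE ?funenegE.
apply: emeasurable_funB.
- exact: (@measurable_fun_fubini_tonelli_F _ _ _ _ _ mu _
    (measurable_funepos mE) (funepos_ge0 _)).
- exact: (@measurable_fun_fubini_tonelli_F _ _ _ _ _ mu _
    (measurable_funeneg mE) (funeneg_ge0 _)).
Qed.

Definition clamp t : R := Num.max 0 (Num.min 1 t).

Lemma clamp01 t : clamp t \in `[0, 1].
Proof. by rewrite in_itv/= /clamp le_max lexx /= ge_max ler01 ge_min lexx. Qed.

Lemma clamp_id t : t \in `[0, 1] -> clamp t = t.
Proof.
rewrite in_itv/= => /andP[t0 t1]; rewrite /clamp.
by rewrite min_r// max_r.
Qed.

Lemma clamp_ge1 t : 1 <= t -> clamp t = 1.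
Proof. by move=> t1; rewrite /clamp min_l// max_r. Qed.

Lemma clamp_le0 t : t <= 0 -> clamp t = 0.
Proof.
by move=> t0; rewrite /clamp max_l// ge_min t0 orbT.
Qed.

Lemma clamp_lip s t : `|clamp s - clamp t| <= `|s - t|.
Proof.
wlog st : s t / s <= t.
  by move=> h; case: (leP s t) => [/h//|/ltW/h]; rewrite distrC [leRHS]distrC.
rewrite [leRHS]distrC [leLHS]distrC [leRHS]ger0_norm ?subr_ge0//.
case: (leP s 0) => s0; case: (leP t 0) => t0; case: (leP 1 s) => s1;
  case: (leP 1 t) => t1;
  rewrite ?(clamp_le0 s0) ?(clamp_le0 t0) ?(clamp_ge1 s1) ?(clamp_ge1 t1)
    ?(@clamp_id s) ?(@clamp_id t) ?subrr ?normr0 ?subr0 ?normr1 ?subr_ge0//;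
  rewrite ?in_itv/= ?(ltW s0) ?(ltW t0) ?(ltW s1) ?(ltW t1)//;
  rewrite ?ger0_norm; lra.
Qed.

Section fixed.
Variables (a C th : R) (g : R -> R).
Hypotheses (a01 : 0 < a < 1) (th_gt : 1 - a < th) (C0 : 0 <= C).
Hypothesis ghol : forall s t, s \in `[0, 1] -> t \in `[0, 1] ->
  `|g t - g s| <= C * `|t - s| `^ th.

Let a0 : 0 < a. Proof. by case/andP: a01. Qed.
Let a1 : 0 < 1 - a. Proof. by case/andP: a01 => _; rewrite subr_gt0. Qed.
Let th0 : 0 < th. Proof. exact: lt_trans th_gt. Qed.

(** [g] is constrained on [0, 1] only. Freezing it outside preserves the Hölder bound, and
    subtracting [g 1] makes it vanish beyond 1, as Abel's inversion requires. *)
Definition shifted x := g (clamp x) - g 1.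

Lemma shifted_holder x y : `|shifted x - shifted y| <= C * `|x - y| `^ th.
Proof.
rewrite /shifted opprB addrA subrK.
apply: le_trans (ghol (clamp01 y) (clamp01 x)) _.
rewrite ler_wpM2l//; apply: ge0_ler_powR; rewrite ?nnegrE ?(ltW th0)//.
exact: clamp_lip.
Qed.

Lemma shifted_ge1 x : 1 <= x -> shifted x = 0.
Proof. by move=> x1; rewrite /shifted clamp_ge1// subrr. Qed.

Lemma shiftedE x : x \in `[0, 1] -> shifted x = g x - g 1.
Proof. by move=> x01; rewrite /shifted clamp_id. Qed.

Lemma shifted_le x : `|shifted x| <= C.
Proof.
have c1 : (1 : R) \in `[0, 1] by rewrite in_itv/= ler01 lexx.
apply: le_trans (ghol c1 (clamp01 x)) _.
rewrite -[leRHS]mulr1 ler_wpM2l//.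
have {2}<- : (1 : R) `^ th = 1 by rewrite powR1.
apply: ge0_ler_powR; rewrite ?nnegrE ?(ltW th0)//.
have := clamp01 x; rewrite in_itv/= => /andP[h0 h1].
by rewrite ler_norml; apply/andP; split; lra.
Qed.

Lemma measurable_shifted : measurable_fun [set: R] shifted.
Proof.
apply: continuous_measurable_fun.
exact: (holder_continuous C0 th0 shifted_holder).
Qed.

Let bound := marchaud_bound a C C th.

Let kerR x y := (shifted x - shifted y) * pospow (a - 2) (y - x).

Let kerR_le x : (\int[mu]_y `|kerR x y|%:E <= bound%:E)%E.
Proof.
exact: (integral_marchaud_le a01 th_gt C0 measurable_shifted shifted_le
  shifted_holder).
Qed.

Let measurable_kerR : measurable_fun [set: R * R] (fun z => kerR z.1 z.2).
Proof.
apply: measurable_funM.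
  by apply: measurable_funB; apply: (measurableT_comp measurable_shifted);
    [exact: measurable_fst|exact: measurable_snd].
apply: (measurableT_comp (measurable_pospow _)).
by apply: measurable_funB; [exact: measurable_snd|exact: measurable_fst].
Qed.

Let integrable_kerR x : mu.-integrable setT (fun y => (kerR x y)%:E).
Proof.
apply/integrableP; split.
  apply/measurable_EFinP.
  exact: (measurableT_comp measurable_kerR (pair1_measurable x)).
by apply: le_lt_trans (kerR_le x) _; rewrite ltry.
Qed.

(* the real factor of [rfrac_deriv] *)
Definition weyl x : R :=
  ((g x - g 1) / (1 - x) `^ (1 - a) +
    (1 - a) * \int[mu]_(u in `[x, 1]) rkernel a (fun x => g x - g 1) x u)
  * \1_(`]0, 1[ : set R) x.

Let rkernelE x u : x \in `]0, 1[ ->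
  ((fun u => (rkernel a (fun x => g x - g 1) x u)%:E) \_ `[x, 1]) u =
  (kerR x u * (u <= 1)%R%:R)%:E.
Proof.
rewrite in_itv/= => /andP[x0 x1]; rewrite patchE mem_setE in_itv/=.
case: (leP u 1) => u1; last by rewrite andbF mulr0.
rewrite andbT mulr1 /kerR; case: (ltgtP x u) => xu.
- rewrite pospowE ?subr_gt0// /rkernel !shiftedE ?in_itv/=; first last.
  + by rewrite (ltW x0) ltW.
  + by rewrite u1 andbT ltW// (lt_trans x0).
  have -> : a - 2 = - (2 - a) by ring.
  by rewrite powRN.
- by rewrite pospow_le0 ?mulr0// subr_le0 ltW.
- by rewrite /rkernel xu !subrr !mul0r.
Qed.

Lemma integrable_rkernel x : x \in `]0, 1[ ->
  mu.-integrable `[x, 1] (EFin \o rkernel a (fun x => g x - g 1) x).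
Proof.
move=> x01; apply/integrable_mkcond => //.
apply: (@eq_integrable _ _ _ mu setT measurableT
  (fun u => (kerR x u * (u <= 1)%R%:R)%:E)).
  by move=> u _; rewrite -rkernelE.
apply: (@le_integrable _ _ _ mu setT measurableT _ (fun u => (kerR x u)%:E)) => //.
- apply/measurable_EFinP; apply: measurable_funM.
    exact: (measurableT_comp measurable_kerR (pair1_measurable x)).
  by apply: measurable_nat_of_bool; exact: measurable_fun_ler.
- move=> u _; rewrite lee_fin normrM; case: (u <= 1)%R.
    by rewrite normr1 mulr1.
  by rewrite normr0 mulr0.
Qed.

(** Beyond 1 the function [shifted] vanishes, so the part y > 1 of the half-line integral equals
    (g(x) - g(1)) (1 - x)^(a - 1) / (1 - a): it reproduces the boundary term of the derivative. *)
Lemma weylE x : x \in `]0, 1[ ->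
  ((weyl x)%:E = (1 - a)%:E * \int[mu]_y (kerR x y)%:E)%E.
Proof.
move=> x01; rewrite /weyl indicE mem_set// mulr1.
move: (x01); rewrite in_itv/= => /andP[x0 x1].
have x1' : 0 < 1 - x by rewrite subr_gt0.
pose k1 y := kerR x y * (y <= 1)%R%:R.
pose k2 y := kerR x y * (1 < y)%R%:R.
have mk : measurable_fun [set: R] (kerR x).
  exact: (measurableT_comp measurable_kerR (pair1_measurable x)).
have kle (k : R -> R) : measurable_fun [set: R] k -> (forall y, `|k y| <= `|kerR x y|) ->
    mu.-integrable setT (EFin \o k).
  move=> mk' h.
  apply: (@le_integrable _ _ _ mu setT measurableT _ (fun u => (kerR x u)%:E)) => //.
    exact/measurable_EFinP.
  by move=> y _; rewrite lee_fin; exact: h.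
have i1 : mu.-integrable setT (EFin \o k1).
  apply: kle => [|y].
    apply: measurable_funM => //.
    by apply: measurable_nat_of_bool; exact: measurable_fun_ler.
  by rewrite /k1; case: (y <= 1)%R; rewrite ?mulr1// mulr0 normr0.
have i2 : mu.-integrable setT (EFin \o k2).
  apply: kle => [|y].
    by apply: measurable_funM => //; exact: measurable_ltlr.
  by rewrite /k2; case: (1 < y)%R; rewrite ?mulr1// mulr0 normr0.
have E2 : (\int[mu]_y (k2 y)%:E = (shifted x * ((1 - x) `^ (a - 1) / (1 - a)))%:E)%E.
  transitivity (\int[mu]_y ((shifted x)%:E *
     ((1 < y)%R%:R * pospow (- 1 - (1 - a)) (y - x))%:E))%E.
    apply: eq_integral => y _; rewrite -EFinM /k2 /kerR; congr EFin.
    have -> : - 1 - (1 - a) = a - 2 by ring.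
    case: (ltP 1 y) => y1; last by rewrite mul0r !mulr0.
    by rewrite (shifted_ge1 (ltW y1)) subr0; ring.
  have := ge0_integral_shift (- x) (h := fun t =>
    (pospow (- 1 - (1 - a)) t * (1 - x < t)%R%:R)%:E).
  rewrite integral_pospow_tail// => E.
  have E' : (\int[mu]_y ((1 < y)%R%:R * pospow (- 1 - (1 - a)) (y - x))%:E =
      ((1 - x) `^ (- (1 - a)) / (1 - a))%:E)%E.
    rewrite -E.
    - by apply: eq_integral => y _; rewrite mulrC ltrD2r.
    - apply/measurable_EFinP; apply: measurable_funM; first exact: measurable_pospow.
      exact: measurable_ltlr.
    - by move=> t; rewrite lee_fin mulr_ge0 ?pospow_ge0.
  rewrite integralZl//; last first.
    apply/integrableP; split.
      apply/measurable_EFinP; apply: measurable_funM; first exact: measurable_ltlr.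
      by apply: (measurableT_comp (measurable_pospow _)); apply: measurable_funB.
    under eq_integral do rewrite /= ger0_norm ?mulr_ge0 ?pospow_ge0//.
    by rewrite E' ltry.
  by rewrite E' -EFinM opprB.
have E1 : (\int[mu]_y (k1 y)%:E =
    (\int[mu]_(u in `[x, 1]) rkernel a (fun x => g x - g 1) x u)%:E)%E.
  rewrite /Rintegral fineK; last first.
    by apply: integrable_fin_num => //; exact: integrable_rkernel.
  by rewrite [RHS]integral_mkcond; apply: eq_integral => y _; rewrite rkernelE.
have -> : (\int[mu]_y (kerR x y)%:E = \int[mu]_y ((k1 y)%:E + (k2 y)%:E))%E.
  apply: eq_integral => y _; rewrite -EFinD /k1 /k2.
  by case: (ltP 1 y) => y1; rewrite mulr0 mulr1 ?add0r ?addr0.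
rewrite integralD_EFin// E1 E2 -EFinD -EFinM; congr EFin.
rewrite mulrDr addrC; congr (_ + _).
rewrite shiftedE; last by rewrite in_itv/= (ltW x0) ltW.
have -> : a - 1 = - (1 - a) by ring.
by rewrite powRN; field; rewrite (gt_eqF a1) powR_eq0 (gt_eqF x1').
Qed.

Lemma weyl_out x : x \notin `]0, 1[ -> weyl x = 0.
Proof. by move=> h; rewrite /weyl indicE memNset ?mulr0//= => /(negP h). Qed.

Lemma measurable_weyl : measurable_fun [set: R] weyl.
Proof.
have -> : weyl = (fun x => (1 - a) *
    fine (\int[mu]_y (kerR x y)%:E) * (x \in `]0, 1[)%:R).
  apply/funext => x; case: (boolP (x \in `]0, 1[)) => x01; last first.
    by rewrite mulr0 weyl_out.
  by have /(congr1 fine) := weylE x01; rewrite fineM ?integrable_fin_num//= mulr1.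
apply: measurable_funM; last first.
  apply: measurable_nat_of_bool.
  rewrite (_ : (fun x => _) = (fun x : R => (0 < x) && (x < 1))); last first.
    by apply/funext => x; rewrite in_itv.
  by apply: measurable_and; exact: measurable_fun_ltr.
apply: measurable_funM => //; apply: (measurableT_comp (f := fine)) => //.
exact: (measurable_integral_pair measurable_kerR).
Qed.

Lemma weyl_le x : `|weyl x| <= (1 - a) * bound.
Proof.
have b0 : 0 <= bound by exact: (marchaud_bound_ge0 a01 th_gt C0 shifted_le).
have [x01|x01] := boolP (x \in `]0, 1[); last first.
  by rewrite weyl_out// normr0 mulr_ge0// ltW.
rewrite -lee_fin -abse_EFin weylE// abseM EFinM /= gtr0_norm//.
rewrite lee_wpmul2l ?lee_fin ?(ltW a1)//; apply: le_trans (kerR_le x).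
apply: le_trans (le_abse_integral _ _ _) _ => //.
apply/measurable_EFinP.
exact: (measurableT_comp measurable_kerR (pair1_measurable x)).
Qed.

Lemma fnorm_ind_lty u v : u <= v -> exists N, (fnorm a (ind u v) <= N%:E)%E.
Proof. by move=> uv; eexists; exact: fnorm_ind. Qed.

Let beta := Gamma a * Gamma (1 - a).

(** By [integral_mker_ind1] and [weylE] the double integral is (1 - a) / a times that of the
    unshifted [ab_ker]; Abel's inversion evaluates the latter at [u], and [Gamma_reflection] names
    the constant. *)
Lemma frac_class_ind1 u : 0 <= u <= 1 ->
  exists N, frac_class a weyl (ind u 1) (a^-1 * (beta * (g u - g 1))) N.
Proof.
move=> /andP[u0 u1]; have [N HN] := fnorm_ind_lty u1; exists N.
have mi := measurable_ind u 1.
split => //.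
- move=> x; rewrite in_itv/= negb_and -leNgt -ltNge /ind => /orP[x0|x1].
    by rewrite leNgt (lt_le_trans x0 u0).
  by rewrite ltNge x1 andbF.
have iA := integrable_mkerA measurable_weyl weyl_le mi HN.
rewrite -(integral12_prod_meas1 iA) /fubini_F /=.
have W1 : weyl 1 = 0 by rewrite weyl_out// in_itv/= ltxx andbF.
have mF : measurable_fun [set: R]
    (fun x => \int[mu]_y (mker a (ind u 1) (x, y) * weyl x)%:E)%E.
  by apply: (measurable_integral_pair (k := fun z => mker a (ind u 1) z * weyl z.1));
    exact: (measurable_mkerA _ measurable_weyl).
have mG : measurable_fun [set: R]
    (fun x => \int[mu]_y (ab_ker a shifted u 0 (x, y))%:E)%E.
  by apply: measurable_integral_pair; exact: (measurable_ab_ker a u measurable_shifted).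
transitivity (\int[mu]_x ((a^-1 * (1 - a))%:E *
    \int[mu]_y (ab_ker a shifted u 0 (x, y))%:E))%E.
  rewrite -(@integral_setD1 _ _ u setT)//; last 2 first.
  - by apply: measurableD.
  - exact: measurable_funS mF.
  rewrite -[RHS](@integral_setD1 _ _ u setT)//; last 2 first.
  - by apply: measurableD.
  - by apply: (@measurable_funS _ _ _ _ setT) => //; exact: measurable_funeM.
  apply: eq_integral => x; rewrite inE => -[_ /eqP xu].
  rewrite integral_mker_ind1//.
  have -> : (\int[mu]_y (ab_ker a shifted u 0 (x, y))%:E =
      (pospow (- a) (x - u) * (x < 1)%R%:R)%:E * \int[mu]_y (kerR x y)%:E)%E.
    rewrite -(integralZl measurableT (integrable_kerR x)).
    apply: eq_integral => y _; rewrite -EFinM /ab_ker /kerR /= addr0; congr EFin.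
    congr (_ * (_ * _)); case: (ltP x y) => xy; first by rewrite mul1r.
    by rewrite mul0r pospow_le0// subr_le0.
  case: (ltP x 1) => x1; last by rewrite mulr0 !(mul0r, mulr0, mul0e, mule0).
  case: (ltP u x) => ux; last first.
    by rewrite pospow_le0 ?subr_le0// !(mul0r, mulr0, mul0e, mule0).
  have : x \in `]0, 1[ by rewrite in_itv/= x1 (le_lt_trans u0).
  move=> /weylE; move: (weyl x) => w W; rewrite mulr1 !EFinM W.
  by rewrite -!muleA; congr (_ * _)%E; rewrite muleCA.
have iab := integrable_ab_ker0 u a01 th_gt C0 measurable_shifted shifted_le shifted_holder.
rewrite integralZl//; last exact: (integrable_fubini_F iab).
have -> : (\int[mu]_x \int[mu]_y (ab_ker a shifted u 0 (x, y))%:E =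
    \int[mu2]_z (ab_ker a shifted u 0 z)%:E)%E by rewrite -(integral12_prod_meas1 iab).
rewrite (integral_ab_ker0 u a01 th_gt C0 measurable_shifted shifted_le
  shifted_ge1 shifted_holder).
have [<- _] := Gamma_reflection a01.
rewrite -!EFinM; congr EFin; rewrite shiftedE ?in_itv/= ?u0//.
by rewrite /beta; field; rewrite (gt_eqF a0) (gt_eqF a1).
Qed.

Lemma frac_class_ind u v : 0 <= u -> u <= v -> v <= 1 ->
  frac_class a weyl (ind u v) (- (beta / a) * (g v - g u))
    (2 / (a * (1 - a)) * (v - u) `^ (1 - a)).
Proof.
move=> u0 uv v1.
have [Nu Hu] : exists N, frac_class a weyl (ind u 1) (a^-1 * (beta * (g u - g 1))) N.
  by apply: frac_class_ind1; rewrite u0 (le_trans uv).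
have [Nv Hv] : exists N, frac_class a weyl (ind v 1) (a^-1 * (beta * (g v - g 1))) N.
  by apply: frac_class_ind1; rewrite v1 (le_trans u0).
have := frac_classD measurable_weyl weyl_le Hu
  (frac_classZ measurable_weyl weyl_le (-1) Hv).
have -> : (fun x => ind u 1 x + -1 * ind v 1 x) = ind u v.
  apply/funext => x; rewrite /ind; case: (leP u x) => ux; case: (leP v x) => vx;
    case: (ltP x 1) => x1 /=; lra.
(* The norm bound of the difference of [u, 1[ and [v, 1[ is discarded: it is not small with v - u,
   whereas the one of [fnorm_ind] is. *)
move=> [mi i0 _ E]; split => //.
  exact: fnorm_ind.
rewrite E; congr EFin; ring.
Qed.

End fixed.
End weyl_derivative.

(** * From Marchaud kernels to the generalized Lebesgue-Stieltjes integral *)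

Section gls_of_frac_class.
Context {R : realType}.
Local Notation mu := (@lebesgue_measure R).
Local Notation mu2 := (mu \x mu)%E.
Implicit Types (b c p q r s t u x y : R) (f g : R -> R).

Section left.
Variables (a : R) (f : R -> R).
Hypotheses (a01 : 0 < a < 1) (mf : measurable_fun [set: R] f).
Hypothesis f0 : forall x, x \notin `[0, 1[ -> f x = 0.

Let a0 : 0 < a. Proof. by case/andP: a01. Qed.
Let a1 : 0 < 1 - a. Proof. by case/andP: a01 => _; rewrite subr_gt0. Qed.

Let f_lt0 x : x < 0 -> f x = 0.
Proof. by move=> x0; rewrite f0// in_itv/= negb_and -ltNge x0. Qed.

Lemma lkernel_mker x u : x \in `[0, 1] ->
  ((fun u => (lkernel a f x u)%:E) \_ `[0, x]) u =
  (mker a f (x, u) * (0 <= u)%R%:R)%:E.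
Proof.
rewrite in_itv/= => /andP[x0 x1]; rewrite patchE mem_setE in_itv/=.
case: (leP 0 u) => u0; last by rewrite mulr0.
rewrite /mker/= x1 !mulr1; case: (ltgtP u x) => ux.
- rewrite pospowE ?subr_gt0// /lkernel.
  have -> : - 1 - a = - (1 + a) by ring.
  by rewrite powRN.
- by rewrite pospow_le0 ?mulr0// subr_le0 ltW.
- by rewrite /lkernel ux !subrr !mul0r.
Qed.

Lemma abs_lkernel_mker x u : x \in `[0, 1] ->
  ((fun u => (`|f x - f u| / (x - u) `^ (1 + a))%:E) \_ `[0, x]) u =
  (`|mker a f (x, u)| * (0 <= u)%R%:R)%:E.
Proof.
rewrite in_itv/= => /andP[x0 x1]; rewrite patchE mem_setE in_itv/=.
case: (leP 0 u) => u0; last by rewrite mulr0.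
rewrite /mker/= x1 !mulr1 normrM (ger0_norm (pospow_ge0 _ _)).
case: (ltgtP u x) => ux.
- rewrite pospowE ?subr_gt0//.
  have -> : - 1 - a = - (1 + a) by ring.
  by rewrite powRN.
- by rewrite pospow_le0 ?mulr0// subr_le0 ltW.
- by rewrite ux !subrr normr0 !mul0r.
Qed.

Let integral_neg x : 0 < x ->
  (\int[mu]_y ((y < 0)%R%:R * pospow (- 1 - a) (x - y))%:E =
   (a^-1 * x `^ (- a))%:E)%E.
Proof. by move=> x0; rewrite (integral_below a01 x0) subr0 pospowE. Qed.

Let mmk x : measurable_fun [set: R] (fun y => mker a f (x, y)).
Proof. exact: (measurableT_comp (measurable_mker a mf) (pair1_measurable x)). Qed.

Let msplit : measurable_fun [set: R * R] (fun z => mker a f z * (0 <= z.2)%R%:R).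
Proof.
apply: measurable_funM; first exact: measurable_mker.
by apply: measurable_nat_of_bool; apply: measurable_fun_ler.
Qed.

Let mkerN x y : 0 < x -> x <= 1 ->
  mker a f (x, y) * (y < 0)%R%:R = f x * ((y < 0)%R%:R * pospow (- 1 - a) (x - y)).
Proof.
move=> x0 x1; rewrite /mker/= x1 mulr1; case: (ltP y 0) => y0.
  by rewrite (f_lt0 y0) subr0 mulr1 mul1r.
by rewrite mul0r !mulr0.
Qed.

Let mker_split x y : mker a f (x, y) =
  mker a f (x, y) * (y < 0)%R%:R + mker a f (x, y) * (0 <= y)%R%:R.
Proof. by case: (ltP y 0) => y0; rewrite mulr0 mulr1 ?addr0 ?add0r. Qed.

Lemma integral_mker x : 0 < x -> x <= 1 ->
  mu.-integrable setT (fun y => (mker a f (x, y))%:E) ->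
  (\int[mu]_y (mker a f (x, y))%:E =
   (f x * (a^-1 * x `^ (- a)))%:E + \int[mu]_y (mker a f (x, y) * (0 <= y)%R%:R)%:E)%E.
Proof.
move=> x0 x1 ix.
have kle (k : R -> R) : measurable_fun [set: R] k ->
    (forall y, `|k y| <= `|mker a f (x, y)|) -> mu.-integrable setT (EFin \o k).
  move=> mk' h.
  apply: (@le_integrable _ _ _ mu setT measurableT _ (fun u => (mker a f (x, u))%:E)) => //.
    exact/measurable_EFinP.
  by move=> y _; rewrite lee_fin; exact: h.
have i1 : mu.-integrable setT (EFin \o (fun y => mker a f (x, y) * (y < 0)%R%:R)).
  apply: kle => [|y].
    by apply: measurable_funM => //; exact: measurable_ltrr.
  by case: (y < 0)%R; rewrite ?mulr1// mulr0 normr0.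
have i2 : mu.-integrable setT (EFin \o (fun y => mker a f (x, y) * (0 <= y)%R%:R)).
  apply: kle => [|y].
    apply: measurable_funM => //.
    by apply: measurable_nat_of_bool; exact: measurable_fun_ler.
  by case: (0 <= y)%R; rewrite ?mulr1// mulr0 normr0.
have -> : (\int[mu]_y (mker a f (x, y))%:E = \int[mu]_y
    ((mker a f (x, y) * (y < 0)%R%:R)%:E + (mker a f (x, y) * (0 <= y)%R%:R)%:E))%E.
  by apply: eq_integral => y _; rewrite -EFinD -mker_split.
rewrite integralD_EFin//; congr (_ + _)%E.
transitivity (\int[mu]_y ((f x)%:E *
    ((y < 0)%R%:R * pospow (- 1 - a) (x - y))%:E))%E.
  by apply: eq_integral => y _; rewrite /= mkerN// EFinM.
rewrite integralZl//; last first.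
  apply/integrableP; split.
    apply/measurable_EFinP; apply: measurable_funM; first exact: measurable_ltrr.
    by apply: (measurableT_comp (measurable_pospow _)); apply: measurable_funB.
  under eq_integral do rewrite /= ger0_norm ?mulr_ge0 ?pospow_ge0//.
  by rewrite integral_neg// ltry.
by rewrite integral_neg.
Qed.

Let absmk : measurable_fun [set: R * R] (fun z => `|mker a f z|).
Proof. by apply: measurableT_comp => //; exact: measurable_mker. Qed.

Let absmkx x : measurable_fun [set: R] (fun y => `|mker a f (x, y)|).
Proof. by apply: measurableT_comp. Qed.

Lemma frac_norm_le : (frac_norm a 0 1 f <= fnorm a f)%E.
Proof.
rewrite /frac_norm /fnorm.
have mE : measurable_fun setT (fun z => `|mker a f z|%:E).
  exact/measurable_EFinP.
have kE z : (0 <= `|mker a f z|%:E)%E by rewrite lee_fin.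
rewrite (@fubini_tonelli1 _ _ _ _ _ mu mu _ mE kE) /fubini_F.
have mF := @measurable_fun_fubini_tonelli_F _ _ _ _ _ mu _ mE kE.
apply: (@le_trans _ _ (\int[mu]_(x in `[0%R, 1%R])
    \int[mu]_y `|mker a f (x, y)|%:E)%E); last first.
  apply: ge0_subset_integral => //.
  by move=> x _; exact: integral_ge0.
pose k1 x : \bar R := (`|f x| / (x - 0) `^ a)%:E.
pose k2 x : \bar R := (\int[mu]_y (`|mker a f (x, y)| * (0 <= y)%R%:R)%:E)%E.
have k1m : measurable_fun [set: R] k1.
  apply/measurable_EFinP; apply: measurable_funM.
    by apply: measurableT_comp.
  apply: (measurableT_comp measurable_inv).
  by apply: (measurableT_comp (@measurable_powR _ _)); apply: measurable_funB.
have k2m : measurable_fun [set: R] k2.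
  apply: (measurable_integral_pair (k := fun z => `|mker a f z| * (0 <= z.2)%R%:R)).
  apply: measurable_funM => //.
  by apply: measurable_nat_of_bool; apply: measurable_fun_ler.
have E : forall x, x \in `[0, 1] ->
   (\int[mu]_(z in `[0%R, x]) (`|f x - f z| / (x - z) `^ (1 + a))%:E = k2 x)%E.
  move=> x x01; rewrite integral_mkcond; apply: eq_integral => y _.
  exact: abs_lkernel_mker.
rewrite (_ : (\int[mu]_(s in _) _ = \int[mu]_(s in `[0%R, 1%R]) (k1 s + k2 s))%E); last first.
  by apply: eq_integral => x; rewrite inE => x01; rewrite E.
have k20 x : (0 <= k2 x)%E.
  by apply: integral_ge0 => y _; rewrite lee_fin mulr_ge0.
apply: ge0_le_integral => //.
- by move=> x _; rewrite adde_ge0// lee_fin divr_ge0 ?powR_ge0.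
- by apply: measurable_funTS; exact: emeasurable_funD.
- exact: measurable_funTS.
move=> x /=; rewrite in_itv/= => /andP[x0 x1].
(* At x = 0 the first term of the norm is a division by 0, hence equal to 0. *)
move: x0; rewrite le_eqVlt => /predU1P[<-|x0].
  rewrite /k1 subr0 powR0 ?gt_eqF// invr0 mulr0 add0e.
  apply: le_integral_EFin => //.
  - apply: measurable_funM.
      exact: absmkx.
    by apply: measurable_nat_of_bool; exact: measurable_fun_ler.
  - exact: absmkx.
  - by move=> y; case: (0 <= y)%R; rewrite ?mulr1 ?mulr0.
apply: (@le_trans _ _ (\int[mu]_y (`|mker a f (x, y)| * (y < 0)%R%:R)%:E + k2 x)%E).
  rewrite leeD2r//.
  have -> : (\int[mu]_y (`|mker a f (x, y)| * (y < 0)%R%:R)%:E =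
     \int[mu]_y (`|f x| * ((y < 0)%R%:R * pospow (- 1 - a) (x - y)))%:E)%E.
    apply: eq_integral => y _; congr EFin.
    have -> : `|mker a f (x, y)| * (y < 0)%R%:R =
        `|mker a f (x, y) * (y < 0)%R%:R|.
      by rewrite (normrM (mker a f (x, y))) normr_nat.
    by rewrite mkerN// normrM [X in _ * X]ger0_norm// mulr_ge0 ?pospow_ge0.
  rewrite ge0_integralMl//; last 2 first.
  - apply: measurable_funM; first exact: measurable_ltrr.
    by apply: (measurableT_comp (measurable_pospow _)); apply: measurable_funB.
  - by move=> y; rewrite mulr_ge0 ?pospow_ge0.
  (* The part y < 0 of the kernel contributes |f(x)| x^-a / a, and 1 / a >= 1: hence an inequality
     between the norms and not an equality. *)
  rewrite integral_neg// -EFinM lee_fin subr0 ler_wpM2l// powRN.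
  rewrite ler_peMl ?invr_ge0 ?powR_ge0// invf_ge1//.
  by case/andP: a01 => _ /ltW.
rewrite -ge0_integralDr//.
- apply: le_integral_EFin => //.
  + apply: measurable_funD; apply: measurable_funM.
    * exact: absmkx.
    * exact: measurable_ltrr.
    * exact: absmkx.
    * by apply: measurable_nat_of_bool; exact: measurable_fun_ler.
  + exact: absmkx.
  + by move=> y; case: (ltP y 0) => y0; rewrite mulr0 mulr1 ?addr0 ?add0r.
- apply: measurable_funM; last exact: measurable_ltrr.
  exact: absmkx.
- apply: measurable_funM.
    exact: absmkx.
  by apply: measurable_nat_of_bool; exact: measurable_fun_ler.
Qed.

Variable N : R.
Hypothesis fN : (fnorm a f <= N%:E)%E.

Let imk : mu2.-integrable setT (EFin \o mker a f).
Proof. exact: (integrable_mker mf fN). Qed.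

Lemma ae_integrable_lkernel : {ae mu, forall x, 0 < x < 1 ->
  mu.-integrable `[0, x] (EFin \o lkernel a f x)}.
Proof.
apply: filterS (ae_integrable1 imk) => x ix /andP[x0 x1].
apply/integrable_mkcond => //.
apply: (@eq_integrable _ _ _ mu setT measurableT
  (fun u => (mker a f (x, u) * (0 <= u)%R%:R)%:E)).
  by move=> u _; rewrite -lkernel_mker// in_itv/= !ltW.
apply: (@le_integrable _ _ _ mu setT measurableT _ (fun u => (mker a f (x, u))%:E)) => //.
  apply/measurable_EFinP; apply: measurable_funM; first exact: mmk.
  by apply: measurable_nat_of_bool; exact: measurable_fun_ler.
move=> u _; rewrite lee_fin normrM; case: (0 <= u)%R.
  by rewrite normr1 mulr1.
by rewrite normr0 mulr0.
Qed.

(** [fine] gives an arbitrary value where the kernel is not integrable in y. By Fubini's theorem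
    this happens on a null set only, so identities involving [L] are stated almost everywhere. *)
Let L x := fine (\int[mu]_y (mker a f (x, y))%:E)%E.

Lemma lfrac_derivE : {ae mu, forall x, x \in `]0, 1[ ->
  lfrac_deriv 0 1 a f x = (Gamma (1 - a))^-1 * (a * L x)}.
Proof.
apply: filterS (ae_integrable1 imk) => x ix x01; move: (x01).
rewrite in_itv/= => /andP[x0 x1].
rewrite /lfrac_deriv indicE mem_set// mulr1; congr (_ * _).
have := integral_mker x0 (ltW x1) ix.
have -> : (\int[mu]_y (mker a f (x, y) * (0 <= y)%R%:R)%:E)%E =
    (\int[mu]_(u in `[0%R, x]) (lkernel a f x u)%:E)%E.
  rewrite [RHS]integral_mkcond; apply: eq_integral => y _.
  by rewrite lkernel_mker// in_itv/= !ltW.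
move=> E.
have Ff : (\int[mu]_(u in `[0%R, x]) (lkernel a f x u)%:E)%E \is a fin_num.
  have := integrable_fin_num measurableT ix; rewrite E.
  by rewrite fin_numD => /andP[].
rewrite /L E fineD//= mulrDr subr0; congr (_ + _).
by rewrite powRN; field; rewrite (gt_eqF a0) powR_eq0 (gt_eqF x0).
Qed.

(** The formula for the function itself is used rather than [lfrac_derivE], since an almost
    everywhere identity does not transfer Borel measurability. *)
Lemma measurable_lfrac_deriv : measurable_fun [set: R] (lfrac_deriv 0 1 a f).
Proof.
pose k z := mker a f z * (0 <= z.2)%R%:R.
have E : lfrac_deriv 0 1 a f = (fun x => (Gamma (1 - a))^-1 *
    (f x / (x - 0) `^ a + a * fine (\int[mu]_y (k (x, y))%:E)%E)
    * \1_(`]0, 1[ : set R) x).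
  apply/funext => x; rewrite /lfrac_deriv indicE.
  case: (boolP (x \in `]0, 1[)) => x01; last by rewrite memNset ?mulr0//= => /(negP x01).
  congr (_ * (_ + _ * _) * _); rewrite /Rintegral integral_mkcond.
  congr fine; apply: eq_integral => y _; rewrite lkernel_mker//.
  by move: x01; rewrite !in_itv/= => /andP[x0 x1]; rewrite !ltW.
rewrite E; apply: measurable_funM => //.
apply: measurable_funM => //; apply: measurable_funD; last first.
  apply: measurable_funM => //; apply: (measurableT_comp (f := fine)) => //.
  exact: measurable_integral_pair.
apply: measurable_funM => //; apply: (measurableT_comp measurable_inv).
by apply: (measurableT_comp (@measurable_powR _ _)); apply: measurable_funB.
Qed.

Let mL : measurable_fun [set: R] L.
Proof.
apply: (measurableT_comp (f := fine)) => //.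
exact: (measurable_integral_pair (measurable_mker a mf)).
Qed.

Let iL : mu.-integrable setT (EFin \o L).
Proof.
have := integrable_fubini_F imk; rewrite /fubini_F => h.
apply: (le_integrable measurableT _ _ h).
  exact/measurable_EFinP.
by move=> x _; rewrite /L /=; case: (integral _ _ _) => [r| |] //=; rewrite normr0 leey.
Qed.

Lemma ae_lfrac_derivE (w : R -> R) : (forall x, x \notin `]0, 1[ -> w x = 0) ->
  ae_eq mu setT (EFin \o (fun x => lfrac_deriv 0 1 a f x * w x))
    (EFin \o (fun x => (Gamma (1 - a))^-1 * (a * L x) * w x)).
Proof.
move=> w0; apply: (negligibleS _ lfrac_derivE) => x /=; apply: contra_not => xE _.
by case: (boolP (x \in `]0, 1[)) => [/xE ->//|/w0 ->]; rewrite !mulr0.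
Qed.

Section pairing.
Variables (M : R) (w : R -> R).
Hypotheses (mw : measurable_fun [set: R] w) (wM : forall x, `|w x| <= M).
Hypothesis w0 : forall x, x \notin `]0, 1[ -> w x = 0.

Lemma integrable_lfracM :
  mu.-integrable setT (EFin \o (fun x => lfrac_deriv 0 1 a f x * w x)).
Proof.
have M0 : 0 <= M by exact: le_trans (normr_ge0 _) (wM 0).
have mlw : measurable_fun setT (EFin \o (fun x => lfrac_deriv 0 1 a f x * w x)).
  apply/measurable_EFinP; apply: measurable_funM => //.
  exact: measurable_lfrac_deriv.
apply/integrableP; split => //.
have mLw : measurable_fun setT
    (EFin \o (fun x => (Gamma (1 - a))^-1 * (a * L x) * w x)).
  apply/measurable_EFinP; apply: measurable_funM => //.
  by apply: measurable_funM => //; apply: measurable_funM.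
have -> : (\int[mu]_x `|(lfrac_deriv 0 1 a f x * w x)%R%:E| =
    \int[mu]_x `|((Gamma (1 - a))^-1 * (a * L x) * w x)%R%:E|)%E.
  apply: ae_eq_integral => //.
  - exact: measurableT_comp.
  - exact: measurableT_comp.
  - apply: (negligibleS _ (ae_lfrac_derivE w0)) => x /=; apply: contra_not => xE xT.
    by have [->] := xE xT.
have : mu.-integrable setT (EFin \o (fun x => (Gamma (1 - a))^-1 * (a * L x) * w x)).
  apply: (@le_integrable _ _ _ mu setT measurableT _
    (fun x => ((Gamma (1 - a))^-1 * a * M)%:E * (L x)%:E)%E) => //.
    move=> x _; rewrite -EFinM lee_fin /= !normrM (ger0_norm M0).
    have := wM x; move: `|_^-1| `|a| `|L x| (normr_ge0 (Gamma (1 - a))^-1)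
      (normr_ge0 a) (normr_ge0 (L x)) => p q r p0 q0 r0 h.
    have -> : p * q * M * r = p * (q * r) * M by ring.
    by rewrite ler_wpM2l// !mulr_ge0.
  by apply: integrableZl.
by move=> /integrableP[].
Qed.

Lemma integral_lfracM :
  (\int[mu]_x (lfrac_deriv 0 1 a f x * w x)%:E =
   ((Gamma (1 - a))^-1 * a)%:E * \int[mu2]_z (mker a f z * w z.1)%:E)%E.
Proof.
have iA := integrable_mkerA mw wM mf fN.
rewrite -(integral12_prod_meas1 iA) -integralZl//; last first.
  exact: (integrable_fubini_F iA).
rewrite (ae_eq_integral _ _ _ _ _ (ae_lfrac_derivE w0))//; last 2 first.
- by case/integrableP: integrable_lfracM.
- apply/measurable_EFinP; apply: measurable_funM => //.
  by apply: measurable_funM => //; apply: measurable_funM.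
apply: ae_eq_integral => //.
- apply/measurable_EFinP; apply: measurable_funM => //.
  by apply: measurable_funM => //; apply: measurable_funM.
- apply: measurable_funeM.
  apply: (measurable_integral_pair (k := fun z => mker a f z * w z.1)).
  by apply: (measurable_mkerA _ mw).
apply: filterS (ae_integrable1 imk) => x ix _; rewrite /fubini_F /=.
transitivity (((Gamma (1 - a))^-1 * a)%:E *
    \int[mu]_y ((w x)%:E * (mker a f (x, y))%:E))%E; last first.
  by congr (_ * _)%E; apply: eq_integral => y _; rewrite mulrC EFinM.
rewrite integralZl// /L -(fineK (integrable_fin_num measurableT ix)) /= -!EFinM.
by congr EFin; ring.
Qed.

End pairing.

(** The pairing with the indicator of ]0, 1[, off which the derivative vanishes. *)
Lemma integrable_lfrac_deriv : mu.-integrable setT (EFin \o lfrac_deriv 0 1 a f).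
Proof.
have := @integrable_lfracM 1 (fun x => (x \in `]0, 1[)%:R).
have -> : (fun x => lfrac_deriv 0 1 a f x * (x \in `]0, 1[)%:R) =
    lfrac_deriv 0 1 a f.
  apply/funext => x; case: (boolP (x \in `]0, 1[)) => x01; rewrite ?mulr1 ?mulr0//.
  by rewrite /lfrac_deriv indicE memNset ?mulr0//= => /(negP x01).
apply.
- apply: measurable_nat_of_bool.
  rewrite (_ : (fun x => _) = (fun x : R => (0 < x) && (x < 1))); last first.
    by apply/funext => x; rewrite in_itv.
  by apply: measurable_and; exact: measurable_fun_ltr.
- by move=> x; case: (x \in _); rewrite ?normr1 ?normr0.
- by move=> x /negPf ->.
Qed.

End left.

Lemma cexpiN_mul t : cexpi (- t) * cexpi t = 1.
Proof.
rewrite /cexpi cosN sinN; apply/eqP; rewrite eq_complex /=; apply/andP; split.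
  by rewrite mulNr opprK -!expr2 cos2Dsin2.
by rewrite mulNr mulrC subrr.
Qed.

(** The constant undoes the normalizations: the factor a / Gamma(1 - a) of the left derivative turns
    the value into - Gamma(a) v, the factor 1 / Gamma(a) of the right derivative and the leading
    minus sign leave v, and the two complex phases cancel. *)
Theorem is_gls_integral_frac_class (a C th : R) f g v N :
  0 < a < 1 -> 1 - a < th -> 0 <= C ->
  (forall s t, s \in `[0, 1] -> t \in `[0, 1] -> `|g t - g s| <= C * `|t - s| `^ th) ->
  frac_class a (weyl a g) f (- (Gamma a * Gamma (1 - a) / a) * v) N ->
  is_gls_integral a 0 1 f g v /\ finite_frac_norm a 0 1 f.
Proof.
move=> a01 th_gt C0 ghol [mf f0 fN fv].
have mW : measurable_fun setT (weyl a g) by exact: measurable_weyl ghol.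
have WM : forall x, `|weyl a g x| <= (1 - a) * marchaud_bound a C C th.
  exact: weyl_le ghol.
have W0 : forall x, x \notin `]0, 1[ -> weyl a g x = 0 by exact: weyl_out.
have [GG G0] := Gamma_reflection a01.
have [Ga Gb] : Gamma a != 0 /\ Gamma (1 - a) != 0.
  by move: (lt0r_neq0 G0); rewrite mulf_eq0 negb_or => /andP.
split; last first.
  split; first exact: measurable_funTS.
  apply: le_lt_trans (frac_norm_le a01 mf f0) _.
  by apply: le_lt_trans fN _; rewrite ltry.
pose c := cexpi (pi * a) / (Gamma a)%:C%C.
have rE x : rfrac_deriv 0 1 a (fun x => g x - g 1) x = c * (weyl a g x)%:C%C by [].
split.
- exact: ae_integrable_lkernel fN.
- by apply: aeW => x x01; apply: (integrable_rkernel a01 th_gt C0 ghol); rewrite in_itv.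
- apply: (integrableS measurableT) => //.
  exact: (integrable_lfrac_deriv a01 mf f0 fN).
- split.
  + rewrite (_ : _ \o _ = fun x => complex.Re c * weyl a g x).
      by apply: measurable_funM => //; exact: measurable_funTS.
    by apply/funext => x; rewrite /comp rE; case: (c) => p q /=; rewrite mulr0 subr0.
  + rewrite (_ : _ \o _ = fun x => complex.Im c * weyl a g x).
      by apply: measurable_funM => //; exact: measurable_funTS.
    by apply/funext => x; rewrite /comp rE; case: (c) => p q /=; rewrite mulr0 add0r.
  + exists (ComplexField.Normc.normc c * ((1 - a) * marchaud_bound a C C th)).
    apply: aeW => x _; rewrite rE ComplexField.Normc.normcM ler_wpM2l//.
      by case: (c) => p q; rewrite sqrtr_ge0.
    by rewrite /= expr0n /= addr0 sqrtr_sqr.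
have iI := integrable_lfracM a01 mf f0 fN mW WM W0.
pose I := \int[mu]_(x in `[0, 1]) (lfrac_deriv 0 1 a f x * weyl a g x).
have -> : complex_integral `[0, 1] (fun x => (lfrac_deriv 0 1 a f x)%:C%C *
    rfrac_deriv 0 1 a (fun x => g x - g 1) x) = c * I%:C%C.
  have iI' : mu.-integrable `[0, 1] (EFin \o
      (fun x => lfrac_deriv 0 1 a f x * weyl a g x)).
    by apply: (integrableS measurableT).
  have -> : (fun x => (lfrac_deriv 0 1 a f x)%:C%C *
      rfrac_deriv 0 1 a (fun x => g x - g 1) x) =
      (fun x => c * (lfrac_deriv 0 1 a f x * weyl a g x)%:C%C).
    by apply/funext => x; rewrite rE mulrCA -rmorphM.
  rewrite /complex_integral; case: (c) => p q.
  apply/eqP; rewrite eq_complex /= !mulr0 subr0 add0r; apply/andP; split.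
  + rewrite /I -RintegralZl//; apply/eqP; apply: eq_Rintegral => x _.
    by rewrite subr0.
  + rewrite /I -RintegralZl//; apply/eqP; apply: eq_Rintegral => x _.
    by rewrite add0r.
have -> : I = - Gamma a * v.
  rewrite /I /Rintegral integral_mkcond.
  transitivity (fine (\int[mu]_x (lfrac_deriv 0 1 a f x * weyl a g x)%:E)%E).
    congr fine; apply: eq_integral => x _; rewrite patchE mem_setE.
    case: ifPn => // x01; rewrite W0 ?mulr0//.
    apply: contra x01; rewrite !in_itv/= => /andP[x0 x1].
    by rewrite !ltW.
  rewrite (integral_lfracM a01 mf f0 fN mW WM W0) fv -EFinM /=.
  have a0 : a != 0 by case/andP: a01 => /gt_eqF ->.
  by move: (Gamma a) (Gamma (1 - a)) Ga Gb => p q p0 q0; field; rewrite a0 q0.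
rewrite /c.
have -> : - cexpi (- (pi * a)) * (cexpi (pi * a) / (Gamma a)%:C%C *
    (- Gamma a * v)%:C%C) = (cexpi (- (pi * a)) * cexpi (pi * a)) *
    ((Gamma a)%:C%C^-1 * (Gamma a * v)%:C%C).
  rewrite (mulNr (Gamma a)) rmorphN /= mulrN mulrNN.
  by rewrite !mulrA.
rewrite cexpiN_mul mul1r rmorphM mulrA mulVf ?mul1r//.
by rewrite eq_complex /= negb_and Ga.
Qed.

End gls_of_frac_class.

(** * Dyadic approximation and the strategy *)

Section smooth_step.
Context {R : realType}.
Implicit Types a b x : R.

(** The lowest even polynomial profile for which 1 - [step] vanishes to second order at -1 and 1.
    The pieces glue to a function with Lipschitz derivative [dstep], and being constant off [-1, 1]
    makes a block exact however far X has moved. *)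
Definition step x : R := if `|x| <= 1 then 1 - (1 - x ^+ 2) ^+ 2 else 1.
Definition dstep x : R := if `|x| <= 1 then 4 * x * (1 - x ^+ 2) else 0.

Lemma step0 : step 0 = 0.
Proof. by rewrite /step normr0 ler01 expr0n /= subr0 expr1n subrr. Qed.

Lemma dstep0 : dstep 0 = 0.
Proof. by rewrite /dstep normr0 ler01 mulr0 mul0r. Qed.

Lemma step_ge1 x : 1 <= `|x| -> step x = 1.
Proof.
rewrite /step le_eqVlt => /predU1P[x1|]; last by move=> x1; rewrite leNgt x1.
have -> : x ^+ 2 = 1 by rewrite -real_normK ?num_real// -x1 expr1n.
by rewrite -x1 lexx subrr expr0n subr0.
Qed.

(** Controls a passage across |x| = 1: 1 - a^2 = (1 - |a|) (1 + |a|) is at most 2 (|b| - |a|). *)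
Let sqr1_le a b : `|a| <= 1 -> 1 < `|b| -> 0 <= 1 - a ^+ 2 <= 2 * `|b - a|.
Proof.
move=> a1 b1; have : `|b| - `|a| <= `|b - a| by exact: lerB_dist.
have -> : a ^+ 2 = `|a| ^+ 2 by rewrite real_normK ?num_real.
have := normr_ge0 a; move: `|a| `|b| `|b - a| a1 b1 => p q r *.
by apply/andP; split; nra.
Qed.

Lemma dstep_lip a b : `|dstep b - dstep a| <= 8 * `|b - a|.
Proof.
have mixed x y : `|x| <= 1 -> 1 < `|y| -> `|4 * x * (1 - x ^+ 2)| <= 8 * `|y - x|.
  move=> x1 y1; have /andP[h0 h1] := sqr1_le x1 y1.
  rewrite !normrM (ger0_norm h0) normr_nat.
  move: (normr_ge0 x) x1; move: `|x| `|y - x| (1 - x ^+ 2) h0 h1 => p q r *.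
  nra.
rewrite /dstep; case: (leP `|a| 1) => a1; case: (leP `|b| 1) => b1.
- have -> : 4 * b * (1 - b ^+ 2) - 4 * a * (1 - a ^+ 2) =
    (4 * (1 - (a ^+ 2 + a * b + b ^+ 2))) * (b - a) by ring.
  rewrite normrM ler_wpM2r//; move: a1 b1; rewrite !ler_norml => /andP[? ?] /andP[? ?].
  by apply/andP; split; nra.
- by rewrite sub0r normrN; exact: mixed.
- by rewrite subr0 distrC; exact: mixed.
- by rewrite subrr normr0 mulr_ge0.
Qed.

(** The second derivative jumps at -1 and 1, so the quadratic bound is checked case by case. Its
    exponent 2 is what gives the Riemann sums a local error of exponent 2 th > 1. *)
Lemma step_taylor a b : `|step b - step a - dstep a * (b - a)| <= 12 * `|b - a| ^+ 2.
Proof.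
rewrite /step /dstep; case: (leP `|a| 1) => a1; case: (leP `|b| 1) => b1.
- have -> : 1 - (1 - b ^+ 2) ^+ 2 - (1 - (1 - a ^+ 2) ^+ 2) -
      4 * a * (1 - a ^+ 2) * (b - a) =
    (2 - (b ^+ 2 + 2 * a * b + 3 * a ^+ 2)) * (b - a) ^+ 2 by ring.
  rewrite normrM normrX ler_wpM2r ?exprn_ge0//; move: a1 b1.
  rewrite !ler_norml => /andP[? ?] /andP[? ?].
  by apply/andP; split; nra.
- have /andP[h0 h1] := sqr1_le a1 b1.
  rewrite opprB addrA (addrC 1) addrK.
  apply: le_trans (ler_normB _ _) _; rewrite !normrM normr_nat.
  rewrite !(ger0_norm h0).
  move: (normr_ge0 a) (normr_ge0 (b - a)) a1.
  move: `|a| `|b - a| (1 - a ^+ 2) h0 h1 => p q r *.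
  have : r ^+ 2 <= 4 * q ^+ 2 by nra.
  have pr : p * r <= 2 * q by nra.
  have : 4 * p * r * q <= 8 * q ^+ 2 by nra.
  lra.
- have /andP[h0 h1] := sqr1_le b1 a1; rewrite distrC in h1.
  rewrite mul0r subr0 addrAC subrr sub0r normrN normrX (ger0_norm h0).
  by move: `|b - a| (1 - b ^+ 2) h0 h1 (normr_ge0 (b - a)) => p q *; nra.
- by rewrite subrr mul0r subrr normr0 mulr_ge0 ?exprn_ge0.
Qed.

End smooth_step.

Section dyadic.
Context {R : realType}.
Variables (h g : R -> R).
Implicit Types (p q x : R).

(** The left endpoint approximation on 2^n equal cells. Halving the whole interval first, instead of
    listing the cells, makes each estimate an induction over all intervals at once. *)
Fixpoint dyadic_step n p q x : R :=
  if n is n'.+1 then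
    dyadic_step n' p ((p + q) / 2) x + dyadic_step n' ((p + q) / 2) q x
  else h p * ind p q x.

Fixpoint dyadic_sum n p q : R :=
  if n is n'.+1 then
    dyadic_sum n' p ((p + q) / 2) + dyadic_sum n' ((p + q) / 2) q
  else h p * (g q - g p).

Let midl p q : p <= q -> p <= (p + q) / 2. Proof. by move=> ?; lra. Qed.
Let midr p q : p <= q -> (p + q) / 2 <= q. Proof. by move=> ?; lra. Qed.

Lemma dyadic_step_out n p q x : p <= q -> ~~ (p <= x < q) -> dyadic_step n p q x = 0.
Proof.
elim: n p q => [|n IH] p q pq xpq /=; first by rewrite /ind (negPf xpq) mulr0.
have [pm mq] := (midl pq, midr pq).
rewrite !IH ?addr0//; apply: contra xpq => /andP[x1 x2].
  by rewrite (le_trans pm)//.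
by rewrite x1 (lt_le_trans x2).
Qed.

Lemma dyadic_step_dist K th n p q x : 0 <= K -> 0 <= th ->
  (forall y z, p <= y -> y <= z -> z <= q -> `|h z - h y| <= K * (z - y) `^ th) ->
  p <= x < q -> `|dyadic_step n p q x - h x| <= K * ((q - p) / 2 ^+ n) `^ th.
Proof.
move=> K0 th0; elim: n p q => [|n IH] p q H /andP[px xq] /=.
  rewrite /ind px xq mulr1 divr1 distrC.
  apply: le_trans (H p x _ _ _) _ => //; first exact: ltW.
  rewrite ler_wpM2l//; apply: ge0_ler_powR; rewrite ?nnegrE//; lra.
have pq : p <= q by rewrite (le_trans px)// ltW.
have [pm mq] := (midl pq, midr pq).
have E : (q - p) / 2 ^+ n.+1 = ((p + q) / 2 - p) / 2 ^+ n.
  by rewrite exprS invfM mulrA; congr (_ * _); lra.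
have E' : (q - p) / 2 ^+ n.+1 = (q - (p + q) / 2) / 2 ^+ n.
  by rewrite exprS invfM mulrA; congr (_ * _); lra.
case: (ltP x ((p + q) / 2)) => xm.
  rewrite (@dyadic_step_out n ((p + q) / 2))//; last by rewrite leNgt xm.
  rewrite addr0 E; apply: IH; last by rewrite px.
  by move=> y z py yz zm; apply: H => //; exact: le_trans mq.
rewrite (@dyadic_step_out n p)//; last by rewrite (ltNge x) xm andbF.
rewrite add0r E'; apply: IH; last by rewrite xm.
by move=> y z py yz zm; apply: H => //; exact: le_trans py.
Qed.

(** Increments of [G] are additive, so the errors of the 2^n cells just add up; the total tends to 0
    as soon as [e > 1]. *)
Lemma dyadic_sum_dist G L e n p q : p <= q ->
  (forall y z, p <= y -> y <= z -> z <= q ->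
    `|h y * (g z - g y) - (G z - G y)| <= L * (z - y) `^ e) ->
  `|dyadic_sum n p q - (G q - G p)| <= L * (2 ^+ n * ((q - p) / 2 ^+ n) `^ e).
Proof.
elim: n p q => [|n IH] p q pq H /=; first by rewrite expr0 divr1 mul1r; exact: H.
have [pm mq] := (midl pq, midr pq).
set m := (p + q) / 2 in pm mq *.
have -> : dyadic_sum n p m + dyadic_sum n m q - (G q - G p) =
  (dyadic_sum n p m - (G m - G p)) + (dyadic_sum n m q - (G q - G m)) by ring.
apply: le_trans (ler_normD _ _) _.
have h1 := IH p m pm; have h2 := IH m q mq.
have E : (q - p) / 2 ^+ n.+1 = (m - p) / 2 ^+ n.
  by rewrite exprS invfM mulrA; congr (_ * _); rewrite /m; lra.
have E' : (q - p) / 2 ^+ n.+1 = (q - m) / 2 ^+ n.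
  by rewrite exprS invfM mulrA; congr (_ * _); rewrite /m; lra.
rewrite -E in h1; rewrite -E' in h2.
have -> : L * (2 ^+ n.+1 * ((q - p) / 2 ^+ n.+1) `^ e) =
    L * (2 ^+ n * ((q - p) / 2 ^+ n.+1) `^ e) + L * (2 ^+ n * ((q - p) / 2 ^+ n.+1) `^ e).
  by rewrite [X in L * (X * _)]exprS; ring.
apply: lerD.
  by apply: h1 => y z py yz zm; apply: H => //; exact: le_trans mq.
by apply: h2 => y z py yz zm; apply: H => //; exact: le_trans py.
Qed.

End dyadic.

Section halving_limits.
Context {R : realType}.

Lemma powR_half_n (s : R) n : (2 ^- n : R) `^ s = ((2^-1) `^ s) ^+ n.
Proof.
by rewrite -exprVn -powR_mulrn ?invr_ge0// powRAC powR_mulrn ?powR_ge0.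
Qed.

Lemma half_powR_lt1 (s : R) : 0 < s -> (2^-1 : R) `^ s < 1.
Proof.
move=> s0; have := @gt0_ltr_powR _ s s0 2^-1 1.
by rewrite !nnegrE powR1; apply => //; lra.
Qed.

Lemma mul2_half_powR_lt1 (s : R) : 1 < s -> 2 * (2^-1 : R) `^ s < 1.
Proof.
move=> s1; rewrite -(@mulr_powRB1 _ 2^-1 s)//; last by lra.
by rewrite mulrA divff// mul1r; apply: half_powR_lt1; lra.
Qed.

Lemma cvg_halving (c D s : R) : 0 <= D -> 0 < s ->
  c * (D / 2 ^+ n) `^ s @[n --> \oo] --> 0.
Proof.
move=> D0 s0.
rewrite (_ : (fun n => _) = geometric (c * D `^ s) ((2^-1) `^ s)); last first.
  apply/funext => n.
  by rewrite /geometric /= powRM ?invr_ge0 ?exprn_ge0// powR_half_n mulrA.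
by apply: cvg_geometric; rewrite ger0_norm ?powR_ge0// half_powR_lt1.
Qed.

Lemma cvg_doubling_halving (c D s : R) : 0 <= D -> 1 < s ->
  c * (2 ^+ n * (D / 2 ^+ n) `^ s) @[n --> \oo] --> 0.
Proof.
move=> D0 s1.
rewrite (_ : (fun n => _) = geometric (c * D `^ s) (2 * (2^-1) `^ s)); last first.
  apply/funext => n.
  rewrite /geometric /= powRM ?invr_ge0 ?exprn_ge0// powR_half_n exprMn.
  by ring.
by apply: cvg_geometric; rewrite ger0_norm ?mulr_ge0 ?powR_ge0// mul2_half_powR_lt1.
Qed.

End halving_limits.

(** * The strategy on the grid accumulating at 1 *)

Section trading.
Context {R : realType}.
Implicit Types (g : R -> R) (r eps p q x : R).

Definition block r eps g p q x : R :=
  r / eps * dstep ((g x - g p) / eps) * ind p q x.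

Definition tn n : R := 1 - 2 ^- n.

Lemma tn_ge0 n : 0 <= tn n.
Proof. by rewrite subr_ge0 invf_le1 ?exprn_gt0// exprn_ege1// ler1n. Qed.

Lemma tn_lt1 n : tn n < 1.
Proof. by rewrite gtrBl invr_gt0 exprn_gt0. Qed.

Lemma tnS n : tn n.+1 - tn n = 2 ^- n.+1.
Proof.
rewrite /tn exprS; have : (2 ^+ n : R) != 0 by rewrite expf_neq0.
by move: (2 ^+ n : R) => y y0; field.
Qed.

Lemma tn_leS n : tn n <= tn n.+1.
Proof. by rewrite -subr_ge0 tnS invr_ge0 exprn_ge0. Qed.

Lemma tn_mono : {homo tn : m n / (m <= n)%N >-> m <= n}.
Proof. by apply: homo_leq => [x|y x z|n]; [exact: lexx|exact: le_trans|exact: tn_leS]. Qed.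

Lemma cvg_tn : tn n @[n --> \oo] --> (1 : R).
Proof.
rewrite -[X in _ --> X]subr0; apply: cvgB; first exact: cvg_cst.
have := @cvg_halving R 1 1 1 ler01 ltr01.
under eq_cvg do rewrite mul1r mul1r powRr1 ?invr_ge0 ?exprn_ge0//.
by [].
Qed.

Lemma tn_above x : x < 1 -> exists n, x < tn n.
Proof.
move=> x1; have /cvgrPdist_lt/(_ (1 - x)) := cvg_tn.
rewrite subr_gt0 => /(_ x1)[n _ /(_ n (leqnn n))] /=.
rewrite ger0_norm ?subr_ge0 ?(ltW (tn_lt1 n))// => h; exists n.
by lra.
Qed.

(** The limit always exists: for [x < 1] the blocks starting after [x] vanish there, so the sums are
    eventually constant, and for [x >= 1] they are all 0. *)
Definition strategy (r eps : nat -> R) g x : R :=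
  limn (fun n => \sum_(0 <= i < n) block (r i) (eps i) g (tn i) (tn i.+1) x).

Lemma strategy_partial (r eps : nat -> R) g x m n : x < tn m -> (m <= n)%N ->
  \sum_(0 <= i < n) block (r i) (eps i) g (tn i) (tn i.+1) x =
  \sum_(0 <= i < m) block (r i) (eps i) g (tn i) (tn i.+1) x.
Proof.
move=> xm mn; rewrite (big_cat_nat (leq0n m) mn)/= [X in _ + X]big_nat_cond.
rewrite [X in _ + X]big1 ?addr0// => i /andP[/andP[mi _] _].
by rewrite /block /ind leNgt (lt_le_trans xm (tn_mono mi)) mulr0.
Qed.

Lemma strategy_ge1 (r eps : nat -> R) g x n : 1 <= x ->
  \sum_(0 <= i < n) block (r i) (eps i) g (tn i) (tn i.+1) x = 0.
Proof.
move=> x1; apply: big1 => i _; rewrite /block /ind [(x < _)%R]ltNge.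
by rewrite (le_trans (ltW (tn_lt1 i.+1)) x1) andbF mulr0.
Qed.

Lemma strategyE (r eps : nat -> R) g x m : x < tn m -> strategy r eps g x =
  \sum_(0 <= i < m) block (r i) (eps i) g (tn i) (tn i.+1) x.
Proof.
move=> xm; apply: cvg_lim => //; apply: cvg_near_cst; exists m => // n mn.
exact: strategy_partial.
Qed.

Lemma strategy_out (r eps : nat -> R) g x : 1 <= x -> strategy r eps g x = 0.
Proof.
move=> x1; apply: cvg_lim => //; apply: cvg_near_cst; apply: nearW => n.
exact: strategy_ge1.
Qed.

Lemma cvg_strategy (r eps : nat -> R) g x :
  \sum_(0 <= i < n) block (r i) (eps i) g (tn i) (tn i.+1) x @[n --> \oo]
    --> strategy r eps g x.
Proof.
case: (ltP x 1) => x1.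
  have [m xm] := tn_above x1; rewrite (strategyE _ _ _ xm).
  by apply: cvg_near_cst; exists m => // n mn; exact: strategy_partial.
rewrite strategy_out//.
by apply: cvg_near_cst; apply: nearW => n; exact: strategy_ge1.
Qed.

End trading.

(** * From indicators to blocks and to the whole strategy *)

Section block.
Context {R : realType}.
Variables (a M : R) (A : R -> R).
Hypotheses (mA : measurable_fun [set: R] A) (AM : forall x, `|A x| <= M).
Variables (g : R -> R) (kap c0 : R).
Hypothesis c00 : 0 <= c0.
Hypothesis Hind : forall u v : R, 0 <= u -> u <= v -> v <= 1 ->
  frac_class a A (ind u v) (kap * (g v - g u)) (c0 * (v - u) `^ (1 - a)).
Implicit Types (p q x : R).

Section halving.
Variables (h : R -> R) (K th : R).
Hypotheses (K0 : 0 <= K) (th0 : 0 < th) (ath : a < th).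

Let e := th + (1 - a).
Let z : R := 2 * (2^-1) `^ e.
(* the 2 ^ n cells of length D / 2 ^ n.+1 of the n-th refinement contribute
   K (D / 2 ^ n.+1) ^ e each, and 2 (1 / 2) ^ e = z *)
Let N n D : R := c0 * K * (D / 2) `^ e * z ^+ n.

(** Splitting a cell [p, q[ at its midpoint m changes the step function by h(m) - h(p) on [m, q[
    only. With D = q - p this costs K (D / 2)^th times (D / 2)^(1 - a), hence the exponent [e]. *)
Lemma frac_class_dyadic_step n p q : 0 <= p -> p <= q -> q <= 1 ->
  (forall y z, p <= y -> y <= z -> z <= q -> `|h z - h y| <= K * (z - y) `^ th) ->
  frac_class a A (fun x => dyadic_step h n.+1 p q x - dyadic_step h n p q x)
    (kap * (dyadic_sum h g n.+1 p q - dyadic_sum h g n p q)) (N n (q - p)).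
Proof.
elim: n p q => [|n IH] p q p0 pq q1 H.
  set m := (p + q) / 2.
  have pm : p <= m by rewrite /m; lra.
  have mq : m <= q by rewrite /m; lra.
  have := frac_classZ mA AM (h m - h p) (Hind (le_trans p0 pm) mq q1).
  have -> : (fun x => (h m - h p) * ind m q x) =
      (fun x => dyadic_step h 1 p q x - dyadic_step h 0 p q x).
    apply/funext => x /=; rewrite -/m.
    have -> : ind p q x = ind p m x + ind m q x.
      rewrite /ind; case: (leP p x) => h1; case: (ltP x q) => h2;
      case: (leP m x) => h3; rewrite /= ?addr0 ?add0r//; lra.
    by ring.
  have -> : (h m - h p) * (kap * (g q - g m)) =
      kap * (dyadic_sum h g 1 p q - dyadic_sum h g 0 p q).
    by rewrite /= -/m; ring.
  move=> [? ? hN ?]; split => //; apply: le_trans hN _; rewrite lee_fin.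
  have Em : q - m = (q - p) / 2 by rewrite /m; lra.
  rewrite /N expr0 mulr1 Em mulrCA -mulrA ler_wpM2l//.
  rewrite /e (@powRD _ _ th); last first.
    by move: ath => h1; apply/implyP => /eqP h2; exfalso; lra.
  rewrite mulrA ler_wpM2r ?powR_ge0//.
  have <- : m - p = (q - p) / 2 by rewrite /m; lra.
  exact: H.
set m := (p + q) / 2.
have pm : p <= m by rewrite /m; lra.
have mq : m <= q by rewrite /m; lra.
have E1 := IH p m p0 pm (le_trans mq q1).
have E2 := IH m q (le_trans p0 pm) mq q1.
have := frac_classD mA AM (E1 _) (E2 _).
have -> : N n (m - p) + N n (q - m) = N n.+1 (q - p).
  have -> : m - p = (q - p) / 2 by rewrite /m; lra.
  have -> : q - m = (q - p) / 2 by rewrite /m; lra.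
  rewrite /N exprS powRM; [|lra..].
  by rewrite /z; ring.
have -> : (fun x => dyadic_step h n.+1 p m x - dyadic_step h n p m x +
      (dyadic_step h n.+1 m q x - dyadic_step h n m q x)) =
    (fun x => dyadic_step h n.+2 p q x - dyadic_step h n.+1 p q x).
  by apply/funext => x /=; rewrite -/m; ring.
have -> : kap * (dyadic_sum h g n.+1 p m - dyadic_sum h g n p m) +
      kap * (dyadic_sum h g n.+1 m q - dyadic_sum h g n m q) =
    kap * (dyadic_sum h g n.+2 p q - dyadic_sum h g n.+1 p q).
  by rewrite /= -/m; ring.
apply.
  by move=> y t py yt tm; apply: H => //; exact: le_trans mq.
by move=> y t py yt tm; apply: H => //; exact: le_trans py.
Qed.

(** As [h p = 0], the approximation of level 0 is 0 and the refinements telescope to [h] on the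
    interval. Their norms are geometric of ratio [z], below 1 because [a < th]; their values are
    Riemann sums, convergent because [1 < e']. *)
Lemma frac_class_block G L e' p q : 0 <= p -> p <= q -> q <= 1 -> h p = 0 -> 1 < e' ->
  (forall y z, p <= y -> y <= z -> z <= q -> `|h z - h y| <= K * (z - y) `^ th) ->
  (forall y z, p <= y -> y <= z -> z <= q ->
    `|h y * (g z - g y) - (G z - G y)| <= L * (z - y) `^ e') ->
  frac_class a A (fun x => h x * ind p q x) (kap * (G q - G p))
    (c0 * K * (q - p) `^ e / (1 - z)).
Proof.
move=> p0 pq q1 hp e'1 Hh HG.
have z0 : 0 <= z by rewrite mulr_ge0 ?powR_ge0.
have z1 : z < 1 by apply: mul2_half_powR_lt1; move: ath; rewrite /e; lra.
have N0 n : 0 <= N n (q - p) by rewrite !mulr_ge0 ?powR_ge0 ?exprn_ge0.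
apply: (@frac_class_series _ a M A mA AM
  (fun n x => dyadic_step h n.+1 p q x - dyadic_step h n p q x)
  (fun n => kap * (dyadic_sum h g n.+1 p q - dyadic_sum h g n p q))
  (fun n => N n (q - p))) => //.
- by move=> n; exact: frac_class_dyadic_step.
- apply: lime_le.
    by apply: is_cvg_nneseries => n _ _; rewrite lee_fin.
  apply: nearW => n; rewrite sumEFin lee_fin /N -mulr_sumr.
  have -> : \sum_(0 <= i < n) z ^+ i = (1 - z ^+ n) / (1 - z).
    have := geometric_seriesE 1 (negbT (lt_eqF z1)) => /(congr1 (fun f => f n)).
    rewrite /series /geometric /= mul1r => <-.
    by apply: eq_bigr => i _; rewrite mul1r.
  rewrite mulrA ler_wpM2r ?invr_ge0 ?subr_ge0 ?(ltW z1)//.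
  apply: (@le_trans _ _ (c0 * K * ((q - p) / 2) `^ e * 1)).
    by rewrite ler_wpM2l ?mulr_ge0 ?powR_ge0// gerBl exprn_ge0.
  rewrite mulr1 ler_wpM2l ?mulr_ge0//.
  by apply: ge0_ler_powR; move: ath; rewrite ?nnegrE /e; lra.
- move=> x; have E0 : dyadic_step h 0 p q x = 0 by rewrite /= hp mul0r.
  rewrite (_ : (fun n => _) = fun n => dyadic_step h n p q x); last first.
    by apply/funext => n; rewrite telescope_sumr// E0 subr0.
  case: (boolP (p <= x < q)) => xpq; last first.
    rewrite /ind (negPf xpq) mulr0.
    rewrite (_ : (fun n => _) = fun=> 0); last first.
      by apply/funext => n; rewrite dyadic_step_out.
    exact: cvg_cst.
  rewrite /ind xpq mulr1.
  apply/subr_cvg0; apply: norm_cvg0.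
  apply: (squeeze_cvgr (f := fun=> 0) (h := fun n => K * ((q - p) / 2 ^+ n) `^ th)).
  + apply: nearW => n; rewrite normr_ge0/=.
    exact: (@dyadic_step_dist _ _ _ _ _ _ _ _ K0 (ltW th0)).
  + exact: cvg_cst.
  + by apply: cvg_halving => //; rewrite subr_ge0.
- have E0 : dyadic_sum h g 0 p q = 0 by rewrite /= hp mul0r.
  under eq_cvg do rewrite -mulr_sumr telescope_sumr// E0 subr0.
  apply: cvgMr; apply/subr_cvg0; apply: norm_cvg0.
  apply: (squeeze_cvgr (f := fun=> 0)
    (h := fun n => L * (2 ^+ n * ((q - p) / 2 ^+ n) `^ e'))).
  + by apply: nearW => n; rewrite normr_ge0/=; exact: dyadic_sum_dist.
  + exact: cvg_cst.
  + by apply: cvg_doubling_halving => //; rewrite subr_ge0.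
Qed.

End halving.

Section strategy.
Variables (C th : R).
Hypotheses (C0 : 0 <= C) (ath : a < th) (th_gt : 1 < 2 * th).
Hypothesis ghol : forall s t, s \in `[0, 1] -> t \in `[0, 1] ->
  `|g t - g s| <= C * `|t - s| `^ th.

Let e := th + (1 - a).

(** One factor 1 / eps comes from the chain rule, the other from the argument of the Lipschitz
    function [dstep]. The Riemann sums converge since the Taylor remainder of [step] has exponent
    [2 * th], which exceeds 1. *)
Lemma frac_class_strategy_block r eps p q :
  0 <= p -> p <= q -> q <= 1 -> 0 < eps ->
  frac_class a A (block r eps g p q) (kap * (r * step ((g q - g p) / eps)))
    (c0 * (`|r| / eps ^+ 2 * (8 * C)) * (q - p) `^ e / (1 - 2 * (2^-1) `^ e)).
Proof.
move=> p0 pq q1 eps0.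
have th0 : 0 < th by move: th_gt; lra.
pose h x := r / eps * dstep ((g x - g p) / eps).
pose G x := r * step ((g x - g p) / eps).
have G0 : G p = 0 by rewrite /G subrr mul0r step0 mulr0.
rewrite -[r * step _]subr0 -[X in _ - X]G0.
have gd y z : p <= y -> y <= z -> z <= q -> `|g z - g y| <= C * (z - y) `^ th.
  move=> py yz zq; have := @ghol y z.
  rewrite (ger0_norm (_ : 0 <= z - y)) ?subr_ge0//; apply; rewrite in_itv/=;
    apply/andP; split; lra.
have dE y z : (g z - g p) / eps - (g y - g p) / eps = (g z - g y) / eps.
  by rewrite -mulrBl; congr (_ / _); ring.
have epsN : `|eps^-1| = eps^-1 by rewrite ger0_norm// invr_ge0 ltW.
apply: (@frac_class_block h _ th _ _ _ G (`|r| / eps ^+ 2 * (12 * C ^+ 2)) (2 * th)) => //.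
- by rewrite !mulr_ge0// invr_ge0 exprn_ge0// ltW.
- by rewrite /h subrr mul0r dstep0 mulr0.
- move=> y z py yz zq; rewrite /h -mulrBr normrM normrM epsN.
  apply: (@le_trans _ _ (`|r| / eps * (8 * ((C * (z - y) `^ th) / eps)))).
    rewrite ler_wpM2l ?mulr_ge0 ?invr_ge0 ?(ltW eps0)//.
    apply: le_trans (dstep_lip _ _) _; rewrite dE normrM epsN.
    by rewrite ler_wpM2l// ler_wpM2r ?invr_ge0 ?(ltW eps0)// gd.
  by rewrite expr2 invfM le_eqVlt; apply/orP; left; apply/eqP; ring.
- move=> y z py yz zq; rewrite /h /G.
  have -> : r / eps * dstep ((g y - g p) / eps) * (g z - g y) -
      (r * step ((g z - g p) / eps) - r * step ((g y - g p) / eps)) =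
    - (r * (step ((g z - g p) / eps) - step ((g y - g p) / eps) -
     dstep ((g y - g p) / eps) * ((g z - g p) / eps - (g y - g p) / eps))).
    by rewrite dE; ring.
  rewrite normrN normrM -!mulrA ler_wpM2l//.
  apply: le_trans (step_taylor _ _) _; rewrite dE normrM epsN.
  rewrite (mulrC 2 th) powRrM powR_mulrn ?powR_ge0//.
  have -> : eps ^- 2 * (12 * (C * (C * ((z - y) `^ th) ^+ 2))) =
      12 * (C * (z - y) `^ th / eps) ^+ 2 by rewrite -exprVn; ring.
  rewrite ler_wpM2l// lerXn2r// ?nnegrE ?mulr_ge0 ?powR_ge0 ?invr_ge0 ?(ltW eps0)//.
  by rewrite ler_wpM2r ?invr_ge0 ?(ltW eps0)// gd.
Qed.

Lemma frac_class_strategy (r eps : nat -> R) v B : (forall n, 0 < eps n) ->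
  (forall n, \sum_(0 <= i < n) `|r i| / eps i ^+ 2 * (2 ^- i.+1) `^ e <= B) ->
  \sum_(0 <= i < n) r i * step ((g (tn i.+1) - g (tn i)) / eps i) @[n --> \oo] --> v ->
  exists N, frac_class a A (strategy r eps g) (kap * v) N.
Proof.
move=> eps0 rB rv; exists (c0 * (8 * C) / (1 - 2 * (2^-1) `^ e) * B).
have z1 : 0 <= (1 - 2 * (2^-1 : R) `^ e)^-1.
  rewrite invr_ge0 subr_ge0 ltW//; apply: mul2_half_powR_lt1.
  by move: ath; rewrite /e; lra.
apply: (@frac_class_series _ a M A mA AM
  (fun n => block (r n) (eps n) g (tn n) (tn n.+1))
  (fun n => kap * (r n * step ((g (tn n.+1) - g (tn n)) / eps n)))
  (fun n => c0 * (`|r n| / eps n ^+ 2 * (8 * C)) * (tn n.+1 - tn n) `^ e /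
    (1 - 2 * (2^-1) `^ e))).
- move=> n; apply: frac_class_strategy_block => //.
  + exact: tn_ge0.
  + exact: tn_leS.
  + exact: ltW (tn_lt1 _).
- move=> n; rewrite !mulr_ge0 ?powR_ge0//.
  by rewrite invr_ge0 exprn_ge0// ltW.
- apply: lime_le.
    apply: is_cvg_nneseries => n _ _; rewrite lee_fin !mulr_ge0 ?powR_ge0//.
    by rewrite invr_ge0 exprn_ge0// ltW.
  apply: nearW => n; rewrite sumEFin lee_fin.
  apply: le_trans (ler_wpM2l _ (rB n)); last by rewrite !mulr_ge0.
  rewrite mulr_sumr le_eqVlt; apply/orP; left; apply/eqP; apply: eq_bigr => i _.
  by rewrite tnS; ring.
- exact: cvg_strategy.
- by under eq_cvg do rewrite -mulr_sumr; apply: cvgMr.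
Qed.

End strategy.
End block.

(** * Pathwise replication of the terminal value *)

Section replication.
Context {R : realType}.
Implicit Types (g zeta : R -> R) (eps : nat -> R).

(* By the chain rule, [wealth n] is the integral of [strategy] over [0, tn n[. *)
Fixpoint wealth eps g zeta n : R :=
  if n is m.+1 then
    wealth eps g zeta m + (zeta (tn m) - wealth eps g zeta m) *
      step ((g (tn m.+1) - g (tn m)) / eps m)
  else 0.

Definition gap eps g zeta n : R := zeta (tn n) - wealth eps g zeta n.

Lemma wealthE eps g zeta n : wealth eps g zeta n =
  \sum_(0 <= i < n) gap eps g zeta i * step ((g (tn i.+1) - g (tn i)) / eps i).
Proof.
elim: n => [|n IH]; first by rewrite big_geq.
by rewrite big_nat_recr//= -IH.
Qed.

Lemma wealth_catch eps g zeta n : 0 < eps n ->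
  eps n <= `|g (tn n.+1) - g (tn n)| -> wealth eps g zeta n.+1 = zeta (tn n).
Proof.
move=> e0 h; rewrite /= step_ge1 ?mulr1 ?subrKC//.
by rewrite normrM normfV (gtr0_norm e0) ler_pdivlMr// mul1r.
Qed.

Lemma tn_in01 n : (tn n : R) \in `[0, 1].
Proof. by rewrite in_itv/= tn_ge0 ltW// tn_lt1. Qed.

Lemma bounded_partial_sums (x : nat -> R) N K z : 0 <= K -> 0 <= z < 1 ->
  (forall n, 0 <= x n) -> (forall n, (N <= n)%N -> x n <= K * z ^+ n) ->
  exists B, forall n, \sum_(0 <= i < n) x i <= B.
Proof.
move=> K0 /andP[z0 z1] x0 xK.
exists (\sum_(0 <= i < N) x i + K / (1 - z)) => n.
have geo m : \sum_(0 <= i < m) K * z ^+ i <= K / (1 - z).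
  have := geometric_seriesE K (negbT (lt_eqF z1)) => /(congr1 (fun f => f m)).
  rewrite /series /geometric /= => ->.
  rewrite ler_wpM2r ?invr_ge0 ?subr_ge0 ?(ltW z1)// mulrBr mulr1 gerBl.
  by rewrite mulr_ge0 ?exprn_ge0.
apply: le_trans (lerD (lexx _) (geo n)).
elim: n => [|n IH]; first by rewrite [leLHS]big_geq// [X in _ + X]big_geq// addr0 sumr_ge0.
rewrite [leLHS]big_nat_recr//= [X in _ <= _ + X]big_nat_recr//= addrA.
case: (leqP N n) => Nn; first by apply: lerD => //; exact: xK.
have -> : \sum_(0 <= i < n) x i + x n = \sum_(0 <= i < n.+1) x i by rewrite big_nat_recr.
apply: (@le_trans _ _ (\sum_(0 <= i < N) x i)).
  rewrite (big_cat_nat (n := n.+1) (leq0n _) Nn)/= lerDl sumr_ge0//.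
by rewrite -addrA lerDl addr_ge0 ?mulr_ge0 ?exprn_ge0// sumr_ge0// => i _;
  rewrite mulr_ge0 ?exprn_ge0.
Qed.

(** The gap is of order 2^-(n rho), the two factors 1 / eps bring 2^(2 n kap), and the cell brings
    2^-(n (th + 1 - a)). The condition on [kap] says precisely that the product decays
    geometrically. *)
Theorem pathwise_replication (a th kap rho : R) g zeta :
  0 < a < 1 / 2 -> 1 - a < th -> 0 < rho -> 2 * kap < rho + (th + (1 - a)) ->
  holder01 th g -> holder01 rho zeta ->
  let eps n := (2 ^- n.+1) `^ kap in
  (exists N, forall n, (N <= n)%N -> eps n <= `|g (tn n.+1) - g (tn n)|) ->
  finite_frac_norm a 0 1 (strategy (gap eps g zeta) eps g) /\
  is_gls_integral a 0 1 (strategy (gap eps g zeta) eps g) g (zeta 1).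
Proof.
move=> /andP[a0 a12] ath rho0 exps [C0 gC0] [C1 zC1] eps [N HN].
pose C := `|C0|; have C_ge0 : 0 <= C by rewrite normr_ge0.
have gC s t : s \in `[0, 1] -> t \in `[0, 1] -> `|g t - g s| <= C * `|t - s| `^ th.
  move=> s01 t01; apply: le_trans (gC0 s t s01 t01) _.
  by rewrite ler_wpM2r ?powR_ge0// ler_norm.
pose K := `|C1|.
have zK s t : s \in `[0, 1] -> t \in `[0, 1] ->
    `|zeta t - zeta s| <= K * `|t - s| `^ rho.
  move=> s01 t01; apply: le_trans (zC1 s t s01 t01) _.
  by rewrite ler_wpM2r ?powR_ge0// ler_norm.
have one01 : (1 : R) \in `[0, 1] by rewrite in_itv/= ler01 lexx.
have a01 : 0 < a < 1 by lra.
have eps0 n : 0 < eps n by rewrite powR_gt0// invr_gt0 exprn_gt0.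
have cz : zeta (tn n) @[n --> \oo] --> zeta 1.
  apply/subr_cvg0; apply: norm_cvg0.
  apply: (squeeze_cvgr (f := fun=> 0) (h := fun n => K * (1 / 2 ^+ n) `^ rho)).
  - apply: nearW => n; rewrite normr_ge0/=.
    apply: le_trans (zK _ _ one01 (tn_in01 n)) _.
    rewrite distrC /tn opprB addrCA subrr addr0 mul1r.
    by rewrite (ger0_norm (_ : 0 <= 2 ^- n)) ?invr_ge0 ?exprn_ge0.
  - exact: cvg_cst.
  - by apply: cvg_halving.
have wN n : (N <= n)%N -> wealth eps g zeta n.+1 = zeta (tn n).
  by move=> Nn; apply: wealth_catch => //; exact: HN.
have cw : wealth eps g zeta n @[n --> \oo] --> zeta 1.
  rewrite -(cvg_shiftS (wealth eps g zeta)).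
  apply: cvg_trans cz; apply: near_eq_cvg.
  by exists N => // n Nn; exact: esym (wN n Nn).
pose s := rho + (th + (1 - a)) - 2 * kap.
have s0 : 0 < s by rewrite subr_gt0.
pose z : R := (2^-1) `^ s.
have z01 : 0 <= z < 1 by rewrite powR_ge0/= half_powR_lt1.
(* A success on block n - 1 sets the wealth at t_n to zeta(t_(n-1)), so the gap at n is the
   increment of zeta over one cell. Hence the strict inequality here, and [N.+1] in the summation
   below. *)
have gapN n : (N < n)%N -> `|gap eps g zeta n| <= K * (2 ^- n) `^ rho.
  case: n => // n; rewrite ltnS => Nn; rewrite /gap wN//.
  apply: le_trans (zK _ _ (tn_in01 n) (tn_in01 n.+1)) _.
  by rewrite tnS (ger0_norm (_ : 0 <= 2 ^- n.+1)) ?invr_ge0 ?exprn_ge0.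
have [B HB] : exists B, forall n, \sum_(0 <= i < n)
    `|gap eps g zeta i| / eps i ^+ 2 * (2 ^- i.+1) `^ (th + (1 - a)) <= B.
  (* The factor 2^rho rewrites (2^-n)^rho as a power of the cell length 2^-(n+1); the extra [z]
     accounts for the exponent n + 1. *)
  apply: (@bounded_partial_sums _ N.+1 (K * 2 `^ rho * z) z) => //.
  - by rewrite !mulr_ge0 ?powR_ge0 /K ?normr_ge0.
  - by move=> n; rewrite !mulr_ge0 ?powR_ge0 ?invr_ge0 ?exprn_ge0 ?powR_ge0.
  - move=> n Nn.
    have D0 : (2 ^- n.+1 : R) != 0 by rewrite invr_eq0 expf_neq0.
    have -> : K * 2 `^ rho * z * z ^+ n = K * (2 ^- n) `^ rho / eps n ^+ 2 *
        (2 ^- n.+1) `^ (th + (1 - a)).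
      rewrite -mulrA -exprS -powR_half_n /s powRB ?D0 ?implybT//.
      rewrite powRD ?D0 ?implybT//.
      have -> : (2 ^- n.+1 : R) `^ (2 * kap) = eps n ^+ 2.
        by rewrite mulrC powRrM powR_mulrn// powR_ge0.
      have -> : (2 ^- n : R) = 2 * 2 ^- n.+1.
        by rewrite exprS invfM mulrA divff// mul1r.
      by rewrite powRM ?invr_ge0 ?exprn_ge0//; ring.
    rewrite !ler_wpM2r ?powR_ge0 ?invr_ge0 ?exprn_ge0 ?powR_ge0//.
    exact: gapN.
have := @frac_class_strategy R a _ _ (measurable_weyl a01 ath C_ge0 gC)
   (weyl_le a01 ath C_ge0 gC) g (- (Gamma a * Gamma (1 - a) / a))
   (2 / (a * (1 - a))) _ (frac_class_ind a01 ath C_ge0 gC) C th C_ge0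
   _ _ gC (gap eps g zeta) eps (zeta 1) B eps0 HB.
case.
- by rewrite divr_ge0// mulr_ge0; lra.
- lra.
- lra.
- by under eq_cvg do rewrite -wealthE.
move=> M /(is_gls_integral_frac_class a01 ath C_ge0 gC) [? ?].
by split.
Qed.

End replication.

(** * Increments of Gaussian processes *)

Section gaussian.
Context {R : realType}.
Local Notation mu := (@lebesgue_measure R).

(** The density agrees almost everywhere with the Radon-Nikodym derivative, since both have the same
    integral over every measurable set. *)
Lemma integral_normal_prob (s : R) (f : R -> R) : measurable_fun [set: R] f ->
  (forall y, 0 <= f y) ->
  (\int[normal_prob 0 s]_y (f y)%:E = \int[mu]_y (f y * normal_pdf 0 s y)%:E)%E.
Proof.
move=> mf f0.
have dom : normal_prob 0 s `<< mu by exact: normal_prob_dominates.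
rewrite -(@Radon_Nikodym_SigmaFinite.change_of_variables _ _ _ _ mu dom
  (fun y => (f y)%:E) setT)//; last exact/measurable_EFinP.
have mRN : measurable_fun [set: R] (Radon_Nikodym_SigmaFinite.f (normal_prob 0 s) mu).
  exact: measurable_int (Radon_Nikodym_SigmaFinite.f_integrable dom).
have mpdf := measurable_normal_pdf (0 : R) s.
apply: ae_eq_integral => //.
- by apply: emeasurable_funM => //; exact/measurable_EFinP.
- by apply/measurable_EFinP; apply: measurable_funM.
- have : ae_eq mu setT (Radon_Nikodym_SigmaFinite.f (normal_prob 0 s) mu)
      (fun y => (normal_pdf 0 s y)%:E).
    apply: integral_ae_eq => //.
    + exact: Radon_Nikodym_SigmaFinite.f_integrable.
    + exact/measurable_EFinP.
    + by move=> E _ mE; rewrite -Radon_Nikodym_SigmaFinite.f_integral.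
  apply: negligibleS => y /=; apply: contra_not => h yT.
  by rewrite (h yT) EFinM.
Qed.

Lemma centered_normal_pdfE (s y : R) : 0 < s ->
  normal_pdf 0 s y = normal_peak s * expR (- y ^+ 2 / (s ^+ 2 *+ 2)).
Proof. by move=> s0; rewrite normal_pdfE ?gt_eqF// /normal_fun subr0. Qed.

Lemma normal_peak_double (s : R) : normal_peak s = 2 * normal_peak (2 * s).
Proof.
rewrite /normal_peak.
have -> : (2 * s) ^+ 2 * pi *+ 2 = 2 ^+ 2 * (s ^+ 2 * pi *+ 2) by ring.
by rewrite sqrtrM ?exprn_ge0// sqrtr_sqr ger0_norm// invfM mulrA divff// mul1r.
Qed.

(** A crude constant suffices, as it only serves to bound s from below by the variance. The density
    of deviation s is twice that of deviation 2 s times exp(- u) with u = 3 y^2 / (8 s^2), and u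
    exp(- u) <= 1 absorbs the factor y^2. *)
Lemma normal_second_moment_le (s : R) : 0 < s ->
  (\int[normal_prob 0 s]_y (y ^+ 2)%:E <= (8 * s ^+ 2)%:E)%E.
Proof.
move=> s0; rewrite integral_normal_prob//; last by move=> y; exact: sqr_ge0.
have s2 : 2 * s != 0 by rewrite gt_eqF// mulr_gt0.
apply: (@le_trans _ _ (\int[mu]_y (8 * s ^+ 2 * normal_pdf 0 (2 * s) y)%:E)%E).
  apply: le_integral_EFin => //.
  - apply: measurable_funM; first exact: measurable_funX.
    exact: measurable_normal_pdf.
  - by apply: measurable_funM => //; exact: measurable_normal_pdf.
  - by move=> y; rewrite mulr_ge0 ?sqr_ge0 ?normal_pdf_ge0.
  - move=> y; rewrite !centered_normal_pdfE ?mulr_gt0// normal_peak_double.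
    pose u := 3 * y ^+ 2 / (8 * s ^+ 2).
    have -> : - y ^+ 2 / (s ^+ 2 *+ 2) = - y ^+ 2 / ((2 * s) ^+ 2 *+ 2) - u.
      by rewrite /u; field; rewrite gt_eqF.
    rewrite expRD; set p := normal_peak _; set E := expR (- y ^+ 2 / _).
    have p0 : 0 <= p by exact: normal_peak_ge0.
    have E0 : 0 <= E by exact: expR_ge0.
    have -> : y ^+ 2 * (2 * p * (E * expR (- u))) =
      2 * (y ^+ 2 * expR (- u)) * (p * E) by ring.
    rewrite ler_wpM2r ?mulr_ge0//.
    have yu : y ^+ 2 = 8 / 3 * s ^+ 2 * u by rewrite /u; field; rewrite gt_eqF.
    have u1 : u * expR (- u) <= 1.
      rewrite expRN ler_pdivrMr ?expR_gt0// mul1r.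
      by apply: le_trans (expR_ge1Dx _); rewrite lerDr.
    rewrite yu.
    have -> : 2 * (8 / 3 * s ^+ 2 * u * expR (- u)) =
      16 / 3 * (s ^+ 2 * (u * expR (- u))) by field.
    have : 0 <= s ^+ 2 by exact: sqr_ge0.
    move: (u * _) u1 (s ^+ 2) => q q1 S S0; nra.
rewrite ge0_integralMl//; last 3 first.
- by rewrite mulr_ge0 ?sqr_ge0.
- exact: measurable_normal_pdf.
- by move=> y; exact: normal_pdf_ge0.
by rewrite integral_normal_pdf mule1.
Qed.

Lemma normal_small_ball (s eps : R) : 0 < s -> 0 <= eps ->
  (normal_prob 0 s `](- eps)%R, eps[%classic <= (2 * eps * normal_peak s)%:E)%E.
Proof.
move=> s0 e0; rewrite /normal_prob.
apply: (@le_trans _ _ (\int[mu]_(x in `](- eps)%R, eps[) (normal_peak s)%:E)%E).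
  apply: ge0_le_integral => //.
  - by move=> x _; rewrite lee_fin normal_pdf_ge0.
  - apply: measurable_funTS; apply/measurable_EFinP; exact: measurable_normal_pdf.
  - by move=> x _; rewrite lee_fin normal_pdf_ub// gt_eqF.
rewrite integral_cst//= lebesgue_measure_itv/= lte_fin.
case: ifPn => _; last by rewrite mule0 lee_fin !mulr_ge0 ?normal_peak_ge0.
rewrite -EFinD -EFinM lee_fin le_eqVlt; apply/orP; left; apply/eqP; ring.
Qed.

End gaussian.

Section small_ball.
Context d (T : measurableType d) {R : realType} (P : probability T R).

Lemma gaussian_small_ball (Y : T -> R) (v eps : R) : centered_normal_rv P Y ->
  0 < v -> (v%:E <= 'E_P[(fun w => Y w ^+ 2)%R])%E -> 0 <= eps ->
  (P [set w | (`|Y w| < eps)%R] <= (4 * eps / Num.sqrt v)%:E)%E.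
Proof.
move=> [mY [s [s0 sP]]] v0 vY e0.
(* the Borel structure on which [normal_prob] is a measure *)
pose Y' : T -> g_sigma_algebraType (R.-ocitv.-measurable) := Y.
have mY' : measurable_fun setT Y' by exact: mY.
have E2 : ('E_P[(fun w => Y w ^+ 2)%R] = \int[pushforward P Y']_y (y ^+ 2)%:E)%E.
  rewrite unlock ge0_integral_pushforward//.
  - by apply/measurable_EFinP; exact: measurable_funX.
  - by move=> y _; rewrite lee_fin sqr_ge0.
(* The degenerate law has second moment 0, against the positive lower bound [v]. *)
move: s0; rewrite le_eqVlt => /predU1P[s0|s0].
  have : ('E_P[(fun w => Y w ^+ 2)%R] = 0)%E.
    rewrite E2.
    rewrite (eq_measure_integral (\d_(0 : g_sigma_algebraType R.-ocitv.-measurable)));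
      last first.
      by move=> A mA _; have := sP A mA; rewrite -s0 eqxx.
    rewrite integral_dirac//; first by rewrite expr0n/= mule0.
    by apply/measurable_EFinP; exact: measurable_funX.
  by move=> h; move: vY; rewrite h lee_fin leNgt v0.
have snz : s == 0 = false by rewrite gt_eqF.
have vs : v <= 8 * s ^+ 2.
  rewrite -lee_fin; apply: le_trans vY _; rewrite E2.
  apply: le_trans (normal_second_moment_le s0).
  rewrite le_eqVlt; apply/orP; left; apply/eqP.
  by apply: eq_measure_integral => A mA _; have := sP A mA; rewrite snz.
have -> : [set w | `|Y w| < eps] = Y @^-1` `]- eps, eps[.
  by apply/seteqP; split => w /=; rewrite in_itv/= ltr_norml.
rewrite sP// snz; apply: le_trans (normal_small_ball s0 e0) _.
rewrite lee_fin.
(* It remains to bound the peak 1 / sqrt(2 pi s^2) by 2 / sqrt v, that is, v by 8 pi s^2. *)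
have -> : 4 * eps / Num.sqrt v = 2 * eps * (2 / Num.sqrt v) by ring.
rewrite ler_wpM2l ?mulr_ge0// /normal_peak.
rewrite -[2 / _]invf_div lef_pV2 ?posrE; last 2 first.
- by rewrite sqrtr_gt0 mulrn_wgt0// mulr_gt0 ?pi_gt0// exprn_gt0.
- by rewrite divr_gt0// sqrtr_gt0.
rewrite ler_pdivrMr// -[X in _ * X](@ger0_norm _ 2)// -sqrtr_sqr -sqrtrM; last first.
  by rewrite mulrn_wge0// mulr_ge0 ?pi_ge0 ?sqr_ge0.
apply: ler_wsqrtr; apply: le_trans vs _.
have p2 : 2 <= (pi : R) by exact: pi_ge2.
by have : 0 <= s ^+ 2 by [exact: sqr_ge0]; move: (s ^+ 2) => S S0; nra.
Qed.

End small_ball.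

Section borel_cantelli.
Context d (T : measurableType d) {R : realType} (P : probability T R).

Lemma ae_eventually_large (Y : nat -> T -> R) (eps : nat -> R) (K z : R) :
  0 <= K -> 0 <= z < 1 -> (forall n, measurable_fun [set: T] (Y n)) ->
  (forall n, P [set w | (`|Y n w| < eps n)%R] <= (K * z ^+ n)%:E)%E ->
  {ae P, forall w, exists N, forall n, (N <= n)%N -> eps n <= `|Y n w|}.
Proof.
move=> K0 /andP[z0 z1] mY YP.
pose A n := [set w | (`|Y n w| < eps n)%R].
have mA n : measurable (A n).
  rewrite (_ : A n = (fun w => `|Y n w|) @^-1` `]-oo, (eps n)[).
    have h : measurable_fun [set: T] (fun w => `|Y n w|) by apply: measurableT_comp.
    by rewrite -[X in measurable X]setTI; exact: h.
  by apply/seteqP; split => w; rewrite /A /= in_itv.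
exists (lim_sup_set A); split.
- apply: bigcap_measurable => // n _; exact: bigcup_measurable.
- apply: lim_sup_set_cvg0 => //.
  apply: (@le_lt_trans _ _ (K / (1 - z))%:E); last by rewrite ltry.
  apply: lime_le; first by apply: is_cvg_nneseries.
  apply: nearW => n; apply: (@le_trans _ _ (\sum_(0 <= i < n) (K * z ^+ i)%:E)%E).
    by apply: lee_sum => i _; exact: YP.
  rewrite sumEFin lee_fin.
  have := geometric_seriesE K (negbT (lt_eqF z1)) => /(congr1 (fun f => f n)).
  rewrite /series /geometric /= => ->.
  rewrite ler_wpM2r ?invr_ge0 ?subr_ge0 ?(ltW z1)// mulrBr mulr1 gerBl.
  by rewrite mulr_ge0 ?exprn_ge0.
- move=> w /= h n _; apply: contrapT => h'; apply: h; exists n => k nk.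
  by rewrite leNgt; apply/negP => e; apply: h'; exists k.
Qed.

End borel_cantelli.

(** * Adaptedness of the strategy *)

Section adaptedness.
Context {R : realType}.

Lemma measurable_step : measurable_fun [set: R] step.
Proof.
apply: measurable_fun_ifT => //.
- by apply: measurable_fun_ler => //; exact: measurableT_comp.
- apply: measurable_funB => //; apply: measurable_funX.
  by apply: measurable_funB => //; exact: measurable_funX.
Qed.

Lemma measurable_dstep : measurable_fun [set: R] dstep.
Proof.
apply: measurable_fun_ifT => //.
- by apply: measurable_fun_ler => //; exact: measurableT_comp.
- apply: measurable_funM; first exact: measurable_funM.
  by apply: measurable_funB => //; exact: measurable_funX.
Qed.

Section measurable_strategy.
Context d (T : measurableType d).
Variables (X Z : R -> T -> R) (eps : nat -> R) (t : R).
Hypotheses (mX : forall s, 0 <= s <= t -> measurable_fun [set: T] (X s))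
           (mZ : forall s, 0 <= s <= t -> measurable_fun [set: T] (Z s)).

Let tn_lt n : tn n.+1 <= t -> tn n <= t.
Proof. exact: le_trans (tn_leS n). Qed.

Lemma measurable_wealth n : tn n <= t ->
  measurable_fun [set: T] (fun w => wealth eps (X ^~ w) (Z ^~ w) n).
Proof.
elim: n => [|n IH] nt //=; have nt' := tn_lt nt.
apply: measurable_funD; first exact: IH.
apply: measurable_funM.
  by apply: measurable_funB; [apply: mZ; rewrite tn_ge0|exact: IH].
apply: (measurableT_comp measurable_step); apply: measurable_funM => //.
by apply: measurable_funB; apply: mX; rewrite tn_ge0.
Qed.

(** When [t < tn n] the indicator kills the block. Otherwise [gap] reads both processes only at grid
    times up to [tn n], so nothing later than [t] enters. *)
Lemma measurable_block n : 0 <= t -> measurable_fun [set: T] (fun w =>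
  block (gap eps (X ^~ w) (Z ^~ w) n) (eps n) (X ^~ w) (tn n) (tn n.+1) t).
Proof.
move=> t0; rewrite /block /ind; case: (leP (tn n) t) => nt; last first.
  by under eq_fun do rewrite mulr0; exact: measurable_cst.
apply: measurable_funM => //; apply: measurable_funM.
  apply: measurable_funM => //; apply: measurable_funB.
    by apply: mZ; rewrite tn_ge0.
  exact: measurable_wealth.
apply: (measurableT_comp measurable_dstep); apply: measurable_funM => //.
by apply: measurable_funB; apply: mX; rewrite ?tn_ge0 ?t0 ?lexx.
Qed.

Lemma measurable_strategy : 0 <= t -> measurable_fun [set: T] (fun w =>
  strategy (gap eps (X ^~ w) (Z ^~ w)) eps (X ^~ w) t).
Proof.
move=> t0; case: (ltP t 1) => t1; last first.
  by under eq_fun do rewrite strategy_out//; exact: measurable_cst.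
have [m tm] := tn_above t1.
under eq_fun do rewrite (strategyE _ _ _ tm).
by apply: measurable_sum => i; exact: measurable_block.
Qed.

End measurable_strategy.

(** Equipping the space with [F t] as its sigma-algebra turns adaptedness at time t into plain
    measurability; monotonicity of the filtration makes the earlier values of both processes
    measurable there. *)
Lemma adapted_strategy d (T : measurableType d) (P : probability T R)
    (F : R -> set_system T) (X Z : R -> T -> R) (eps : nat -> R) :
  usual_conditions P F -> adapted F X -> adapted F Z ->
  adapted F (fun t w => strategy (gap eps (X ^~ w) (Z ^~ w)) eps (X ^~ w) t).
Proof.
move=> hF aX aZ t t01 B mB; move: (t01); rewrite in_itv/= => /andP[t0 t1].
have sF := uc_sigma_algebra hF t01.
have E := measurable_g_measurableTypeE sF.
have sub (U : R -> T -> R) : adapted F U -> forall s, 0 <= s <= t ->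
    measurable_fun [set: g_sigma_algebraType (F t)] (U s).
  move=> aU s /andP[s0 st] _ C mC; rewrite setTI E.
  apply: (uc_incr hF s0 st t1); apply: aU => //.
  by rewrite in_itv/= s0 (le_trans st).
have := @measurable_strategy _ (g_sigma_algebraType (F t)) X Z eps t
  (sub X aX) (sub Z aZ) t0 measurableT B mB.
by rewrite setTI E.
Qed.

End adaptedness.

(** * Almost sure lower bounds for the increments over the grid *)

Section increments.
Context d (T : measurableType d) {R : realType} (P : probability T R).
Variable X : R -> T -> R.
Hypothesis Xgauss : centered_gaussian_process P X.

Lemma centered_normal_increment s t : s \in `[0, 1] -> t \in `[0, 1] ->
  centered_normal_rv P (fun w => X t w - X s w).
Proof.
move=> s01 t01.
have := @Xgauss 2 (fun i => if i == ord0 then t else s)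
  (fun i => if i == ord0 then 1 else -1).
rewrite (_ : (fun w => \sum_(i < 2) _) = (fun w => X t w - X s w)).
  by apply => i; case: ifP.
by apply/funext => w; rewrite !big_ord_recl big_ord0 /= mul1r mulN1r addr0.
Qed.

(** Over a cell of length D the standard deviation is at least sqrt(C) D^H, so the increment falls
    below D^(H + eta) with probability at most 4 / sqrt(C) times D^eta. The margin [eta] is what
    makes this a convergent geometric series. *)
Lemma ae_large_increments (C H eta : R) : 0 < C -> 0 < eta ->
  (forall s t : R, s \in `[0, 1] -> t \in `[0, 1] ->
    ((C * `|t - s| `^ (2 * H))%:E <= 'E_P[(fun w => (X t w - X s w) ^+ 2)%R])%E) ->
  {ae P, forall w, exists N, forall n, (N <= n)%N ->
    (2 ^- n.+1) `^ (H + eta) <= `|X (tn n.+1) w - X (tn n) w|}.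
Proof.
move=> C0 eta0 XC.
apply: (@ae_eventually_large _ _ _ P (fun n w => X (tn n.+1) w - X (tn n) w)
  (fun n => (2 ^- n.+1) `^ (H + eta))
  (4 / Num.sqrt C * (2^-1) `^ eta) ((2^-1) `^ eta)).
- by rewrite mulr_ge0 ?powR_ge0// divr_ge0.
- by rewrite powR_ge0/= half_powR_lt1.
- by move=> n; case: (centered_normal_increment (tn_in01 n) (tn_in01 n.+1)).
- move=> n.
  have D0 : 0 < (2 ^- n.+1 : R) by rewrite invr_gt0 exprn_gt0.
  have := XC _ _ (tn_in01 n) (tn_in01 n.+1); rewrite tnS (gtr0_norm D0) => v.
  apply: le_trans (gaussian_small_ball (centered_normal_increment (tn_in01 n)
    (tn_in01 n.+1)) _ v (powR_ge0 _ _)) _; first by rewrite mulr_gt0// powR_gt0.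
  rewrite lee_fin.
  have -> : 4 / Num.sqrt C * (2^-1) `^ eta * (2^-1) `^ eta ^+ n =
    4 / Num.sqrt C * (2 ^- n.+1) `^ eta by rewrite powR_half_n exprS mulrA.
  rewrite sqrtrM ?(ltW C0)//.
  rewrite (mulrC 2 H) powRrM powR_mulrn ?powR_ge0// sqrtr_sqr ger0_norm ?powR_ge0//.
  rewrite powRD; last by rewrite (gt_eqF D0) implybT.
  rewrite le_eqVlt; apply/orP; left; apply/eqP.
  have : (2 ^- n.+1 : R) `^ H != 0 by rewrite gt_eqF// powR_gt0.
  have : Num.sqrt C != 0 by rewrite gt_eqF// sqrtr_gt0.
  move: ((2 ^- n.+1 : R) `^ H) ((2 ^- n.+1 : R) `^ eta) (Num.sqrt C) => p q r r0 p0.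
  by field; rewrite r0 p0.
Qed.

End increments.

Theorem theorem4p1 (R : realType) (d : measure_display) (T : measurableType d)
    (P : probability T R) (F : R -> set_system T) (X : R -> T -> R)
    (H1 H2 C1 C2 : R)
    (hF : usual_conditions P F)
    (Xadapted : adapted F X)
    (Xgauss : centered_gaussian_process P X)
    (hH1 : 0 < H1 <= 1) (hH2 : 0 < H2 <= 1) (hC1 : 0 < C1) (hC2 : 0 < C2)
    (Xvar : forall s t : R, s \in `[0, 1] -> t \in `[0, 1] ->
      ((C1 * `|t - s| `^ (2 * H1))%:E <= 'E_P[(fun w => (X t w - X s w) ^+ 2)%R]
        <= (C2 * `|t - s| `^ (2 * H2))%:E)%E)
    (Xincr : forall s1 t1 s2 t2 : R, 0 <= s1 -> s1 <= t1 -> t1 <= s2 -> s2 <= t2 ->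
      t2 <= 1 ->
      (0 <= 'E_P[(fun w => (X t1 w - X s1 w) * (X t2 w - X s2 w))%R])%E)
    (Xholder : {ae P, forall w, forall theta : R, 0 < theta < H2 ->
      holder01 theta (X ^~ w)})
    (hH : 0 < 2 * H1 - 1) (hH' : 2 * H1 - 1 < H2) (hH'' : H2 <= H1)
    (hH2' : 1 / 2 < H2)
    (xi : {RV P >-> R}) (Z : R -> T -> R) (rho : R)
    (Zadapted : adapted F Z)
    (Zholder : {ae P, forall w, holder01 rho (Z ^~ w)})
    (hrho : (1 + H2) * (H1 - H2) / (H2 + 1 - 2 * H1) < rho)
    (hxi : {ae P, forall w, xi w = Z 1 w}) :
  exists psi : R -> T -> R, adapted F psi /\
    exists2 alpha : R, 1 - H2 < alpha < 1 / 2 &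
      {ae P, forall w, finite_frac_norm alpha 0 1 (psi ^~ w) /\
        is_gls_integral alpha 0 1 (psi ^~ w) (X ^~ w) (xi w)}.
Proof.
(* 2 (H1 - H2) <= rho_0 because 1 + H2 <= 4 H1 *)
have rho2 : 2 * (H1 - H2) < rho.
  apply: le_lt_trans hrho; rewrite ler_pdivlMr; last by lra.
  have : 0 <= (H1 - H2) * (4 * H1 - 1 - H2) by apply: mulr_ge0; lra.
  lra.
(* With alpha = 1 - H2 + eta, Hölder exponent H2 - eta / 2 and kap = H1 + eta, the margin required
   pathwise is rho - 2 (H1 - H2) - 7 eta / 2, which the factor 5 keeps positive. The last bound
   gives alpha < 1 / 2. *)
have [eta [eta0 eta1 eta2]] : exists eta, [/\ 0 < eta, 5 * eta <= rho - 2 * (H1 - H2) &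
    2 * eta <= H2 - 1 / 2].
  pose p := (rho - 2 * (H1 - H2)) / 5; pose q := (H2 - 1 / 2) / 2.
  have hp : Num.min p q <= p by rewrite ge_min lexx.
  have hq : Num.min p q <= q by rewrite ge_min lexx orbT.
  exists (Num.min p q); split.
  - by rewrite lt_min; apply/andP; split; rewrite /p /q; lra.
  - by apply: (@le_trans _ _ (5 * p)); [rewrite ler_wpM2l|rewrite /p; lra].
  - by apply: (@le_trans _ _ (2 * q)); [rewrite ler_wpM2l|rewrite /q; lra].
pose eps n : R := (2 ^- n.+1) `^ (H1 + eta).
exists (fun t w => strategy (gap eps (X ^~ w) (Z ^~ w)) eps (X ^~ w) t); split.
  exact: adapted_strategy hF Xadapted Zadapted.
exists (1 - H2 + eta); first by apply/andP; split; lra.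
have Xlarge := ae_large_increments Xgauss hC1 eta0
  (fun s t s01 t01 => (andP (Xvar s t s01 t01)).1).
apply: filterS2 (filterI Xholder Zholder) (filterI hxi Xlarge) => w [Xw Zw] [-> Lw].
(* The exponent H2 - eta / 2 lies strictly between 1 - alpha = H2 - eta, which it has to exceed, and
   H2, below which the paths of X are Hölder. *)
apply: (@pathwise_replication _ (1 - H2 + eta) (H2 - eta / 2) (H1 + eta) rho) => //.
- by apply/andP; split; lra.
- lra.
- lra.
- lra.
- by apply: Xw; apply/andP; split; lra.
Qed.
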